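(* Assume the Riemann hypothesis. Let $\Phi(x)=x\lfloor 1/x\rfloor$ on $(0,1]$. Let $L_0:[0,\infty)\to[0,\infty)$ be slowly varying (i.e. $\lim_{x\to\infty}L_0(\lambda x)/L_0(x)=1$ for every $\lambda>0$), increasing on $[1,\infty)$, and such that there is a constant $C$ with $0\le L_0(n+1)-L_0(n)<C$ for all $n$. Let $\beta\ge1/2$ and let $(a_n)_{n\ge1}$ be the real sequence with $a_1=1$ and $\sum_{k=1}^{n}a_k\Phi\left(\frac{k}{n}\right)=n^{-\beta}L_0(n)$ for all $n\ge2$. Then for every $\varepsilon>0$, $\sum_{n\le x}a_n=O(x^{-1/2+\varepsilon})$ as $x\to\infty$. *)

(* Defs.v *)
(* Stdlib reals with Coquelicot (complex numbers, limits, finite sums). *)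
From Stdlib Require Import Reals.
From Coquelicot Require Export Coquelicot.
Open Scope R_scope.

Definition Cexp (z : C) : C :=
  (exp (Re z) * cos (Im z), exp (Re z) * sin (Im z)).

(* x ^ s = exp (s * ln x); only meaningful for x > 0. *)
Definition Rcpow (x : R) (s : C) : C := Cexp (s * RtoC (ln x))%C.

(* zeta is the analytic continuation to the plane minus the point 1 of the
   Dirichlet series 1^(-s) + 2^(-s) + ... (Re s > 1).  These two conditions
   determine zeta away from s = 1; the value zeta 1 is unconstrained. *)
Definition is_riemann_zeta (zeta : C -> C) : Prop :=
  (forall s : C, s <> RtoC 1 -> ex_derive zeta s) /\
  (forall s : C, 1 < Re s ->
     is_series (fun n : nat => Rcpow (INR (S n)) (- s)%C) (zeta s)).

(* The zeros -2, -4, -6, ... are the trivial ones. *)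
Definition riemann_hypothesis : Prop :=
  forall zeta : C -> C, is_riemann_zeta zeta ->
  forall s : C, s <> RtoC 1 -> zeta s = RtoC 0 ->
    (forall m : nat, s <> RtoC (- 2 * INR (S m))) ->
    Re s = 1 / 2.

(* Int_part is the floor function. *)
Definition Phi (x : R) : R := x * IZR (Int_part (/ x)).

(* Since / 0 = 0, the limit forces L x <> 0 for all large x. *)
Definition slowly_varying (L : R -> R) : Prop :=
  forall lambda : R, 0 < lambda ->
    is_lim (fun x => L (lambda * x) / L x) p_infty 1.

(* The sum of a n over the integers 1 <= n <= x; it is empty when x < 1. *)
Definition summatory (a : nat -> R) (x : R) : R :=
  sum_n_m a 1 (Z.to_nat (Int_part x)).

Definition bigO_infty (f g : R -> R) : Prop :=
  exists M x0 : R, forall x : R, x0 <= x -> Rabs (f x) <= M * Rabs (g x).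

(* Main.v *)
Require Import Defs.
From Stdlib Require Import Reals ZArith Arith Bool Lra Lia Classical ClassicalEpsilon.
From Coquelicot Require Import Coquelicot.
Open Scope R_scope.

(** Write [b k = k * a k] and [f n] for the sum of [b d] over [d | n].  The recurrence says that the
    partial sums of [f] are [n ^ (1 - beta) * L0 n], and Moebius inversion gives
    [a 1 + ... + a N = sum_(d <= N) f d / d * m (N / d)] with [m N = sum_(n <= N) mu n / n].  Since [L0]
    is monotone and [O (x ^ e)], the series of [|f d| * d ^ (- 1/2 - e)] converges, so it suffices to
    show [m N = O (N ^ (- 1/2 + e))] under the Riemann hypothesis (Littlewood).

    For this put [Z s = (s - 1) * zeta s], which is holomorphic and zero-free on [Re s > 1/2].  On discs
    around [2 + i t] let [g] be the logarithm of [Z s / Z (2 + i t)].  Its real part is at most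
    [O (log t)], and [O (1)] on the concentric disc of radius [1/2]; bounding low Taylor coefficients on
    the small circle and high ones on the large circle gives [|g| <= e * log t + O (1)], and since
    [1 / Z (2 + i t) = O (1 / t)] we get [1 / Z = O (t ^ (- 1 + e))].  The sums
    [S x = sum mu n * max 0 (x / n - 1)] are vertical integrals of [x ^ w / (w * Z w)] on [Re w = 2]
    (Perron); this integrand has no pole in [Re w > 1/2], so the line moves to [Re w = 1/2 + e], and
    [m N] is the difference quotient of [S] with step [sqrt N], up to [O (N ^ (- 1/2))].

    All functions that occur have explicit continuous complex derivatives, so Cauchy's theorem
    reduces to differentiation under the integral sign. *)

(** * Complex calculus *)

(** The Riemann hypothesis is stated for every function satisfying [is_riemann_zeta], so it can only
    be applied once such a function is exhibited: zeta has to be continued to the whole plane minus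
    1, although the estimates live in [Re s > 0]. The weight [max 0 (x / n - 1)] replaces a sharp
    cut-off because its kernel [y ^ w / (w * (w - 1))] decays quadratically on vertical lines:
    Perron's formula then has an error tending to 0 with the height, and the moved integral
    converges absolutely. The price is that m N must be recovered by differencing. A step h costs
    [h / N] from the integers between N and N + h, while the difference of the integrals, divided by
    h, costs about [N ^ (- 1/2 + delta) * (h / N) ^ (- 2 eps)]; with h = sqrt N both are admissible.
    The discs have centre on [Re s = 2] and limiting radius 3/2, which reaches the critical line;
    the circle of radius 1/2 stays in [Re s >= 3/2], where zeta and its inverse are bounded by the
    same convergent series. All heights stay finite: truncation errors are removed by an arbitrary
    epsilon, so no improper integral occurs. *)

Lemma C_eq (z w : C) : Re z = Re w -> Im z = Im w -> z = w.
Proof. destruct z, w; simpl; congruence. Qed.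

Lemma Cmod_minus_sym (z w : C) : Cmod (z - w) = Cmod (w - z).
Proof. rewrite <- Cmod_opp; f_equal; ring. Qed.

Lemma Cmod_triangle_minus (z w : C) : Cmod (z - w) <= Cmod z + Cmod w.
Proof.
  replace (z - w)%C with (z + - w)%C by ring.
  rewrite <- (Cmod_opp w); apply Cmod_triangle.
Qed.

Lemma Cmod_triangle_rev (z w : C) : Cmod z - Cmod w <= Cmod (z - w).
Proof.
  generalize (Cmod_triangle (z - w) w).
  replace (z - w + w)%C with z by ring. lra.
Qed.

Lemma Im_le_Cmod (z : C) : Rabs (Im z) <= Cmod z.
Proof.
  apply Rle_trans with (2 := Rmax_Cmod z). apply Rmax_r.
Qed.

Lemma Cmod_le_Re_Im (z : C) : Cmod z <= Rabs (Re z) + Rabs (Im z).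
Proof.
  replace z with (RtoC (Re z) + Ci * RtoC (Im z))%C at 1.
  - eapply Rle_trans; [apply Cmod_triangle|].
    rewrite Cmod_mult, !Cmod_R, Cmod_Ci; lra.
  - apply C_eq; simpl; ring.
Qed.

(** Cauchy-Schwarz in the plane, read off from [Re (Cconj z * w)]. It reduces norm bounds for
    complex increments and integrals to bounds for one real projection. *)
Lemma C_inner_le (z w : C) : Re z * Re w + Im z * Im w <= Cmod z * Cmod w.
Proof.
  rewrite <- (Cmod_conj z), <- Cmod_mult.
  replace (Re z * Re w + Im z * Im w) with (Re (Cconj z * w)%C)
    by (unfold Re, Im; simpl; ring).
  eapply Rle_trans; [apply Rle_abs | apply re_le_Cmod].
Qed.

Lemma Cmod_sqr (z : C) : Cmod z * Cmod z = Re z * Re z + Im z * Im z.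
Proof. generalize (Cmod2_alt z); simpl; lra. Qed.

(** * Continuity of complex-valued maps *)

Lemma cont_C_intro {U : UniformSpace} (f : U -> C) (x : U) :
  continuous (fun y => Re (f y)) x -> continuous (fun y => Im (f y)) x ->
  continuous f x.
Proof.
  intros H1 H2 P [e He].
  assert (A := H1 _ (locally_ball _ e)). assert (B := H2 _ (locally_ball _ e)).
  unfold filtermap in *.
  generalize (filter_and _ _ A B). apply filter_imp.
  intros y [Ha Hb]. apply He. split; assumption.
Qed.

Lemma cont_Re {U : UniformSpace} (f : U -> C) (x : U) :
  continuous f x -> continuous (fun y => Re (f y)) x.
Proof. intros H. apply (continuous_comp f fst x H). apply continuous_fst. Qed.

Lemma cont_Im {U : UniformSpace} (f : U -> C) (x : U) :
  continuous f x -> continuous (fun y => Im (f y)) x.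
Proof. intros H. apply (continuous_comp f snd x H). apply continuous_snd. Qed.

Ltac cont_re_im := match goal with
  | |- continuous (fun y => Re (@?f y)) _ => apply cont_Re; assumption
  | |- continuous (fun y => Im (@?f y)) _ => apply cont_Im; assumption
  | |- continuous (fun y => fst (@?f y)) _ => apply (cont_Re f); assumption
  | |- continuous (fun y => snd (@?f y)) _ => apply (cont_Im f); assumption
  end.

Lemma cont_Rinv {U : UniformSpace} (f : U -> R) (x : U) :
  continuous f x -> f x <> 0 -> continuous (fun y => / f y) x.
Proof.
  intros H n. apply (continuous_comp f Rinv x H).
  now apply continuous_Rinv.
Qed.

Lemma cont_Rmult {U : UniformSpace} (f g : U -> R) (x : U) :
  continuous f x -> continuous g x -> continuous (fun y => f y * g y) x.
Proof. intros; apply (continuous_mult f g); assumption. Qed.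

Lemma cont_Rplus {U : UniformSpace} (f g : U -> R) (x : U) :
  continuous f x -> continuous g x -> continuous (fun y => f y + g y) x.
Proof. intros; apply (continuous_plus f g); assumption. Qed.

Lemma cont_Rminus {U : UniformSpace} (f g : U -> R) (x : U) :
  continuous f x -> continuous g x -> continuous (fun y => f y - g y) x.
Proof. intros; apply (continuous_minus f g); assumption. Qed.

Lemma cont_Cplus {U : UniformSpace} (f g : U -> C) (x : U) :
  continuous f x -> continuous g x -> continuous (fun y => f y + g y)%C x.
Proof.
  intros Hf Hg. apply cont_C_intro; simpl;
  apply cont_Rplus; cont_re_im.
Qed.

Lemma cont_Copp {U : UniformSpace} (f : U -> C) (x : U) :
  continuous f x -> continuous (fun y => - f y)%C x.
Proof.
  intros Hf. apply cont_C_intro; simpl.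
  - apply (continuous_opp (fun y => Re (f y))). now apply cont_Re.
  - apply (continuous_opp (fun y => Im (f y))). now apply cont_Im.
Qed.

Lemma cont_Cminus {U : UniformSpace} (f g : U -> C) (x : U) :
  continuous f x -> continuous g x -> continuous (fun y => f y - g y)%C x.
Proof.
  intros Hf Hg. apply (cont_Cplus f (fun y => - g y)%C); [assumption|].
  now apply cont_Copp.
Qed.

Lemma cont_Cmult {U : UniformSpace} (f g : U -> C) (x : U) :
  continuous f x -> continuous g x -> continuous (fun y => f y * g y)%C x.
Proof.
  intros Hf Hg. apply cont_C_intro; simpl;
  [apply cont_Rminus | apply cont_Rplus]; apply cont_Rmult;
  cont_re_im.
Qed.

Lemma cont_RtoC {U : UniformSpace} (f : U -> R) (x : U) :
  continuous f x -> continuous (fun y => RtoC (f y)) x.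
Proof.
  intros Hf. apply cont_C_intro; simpl; [assumption | apply continuous_const].
Qed.

Lemma cont_Cinv {U : UniformSpace} (f : U -> C) (x : U) :
  continuous f x -> f x <> RtoC 0 -> continuous (fun y => / f y)%C x.
Proof.
  intros Hf n.
  assert (D : fst (f x) * fst (f x) + snd (f x) * snd (f x) <> 0).
  { intros E. apply n. apply Cmod_eq_0.
    assert (F := Cmod_sqr (f x)). unfold Re, Im in F. rewrite E in F. nra. }
  assert (K : continuous
    (fun y => / (Re (f y) * Re (f y) + Im (f y) * Im (f y))) x).
  { apply (cont_Rinv (fun y => Re (f y) * Re (f y) + Im (f y) * Im (f y))).
    apply cont_Rplus; apply cont_Rmult; cont_re_im.
    exact D. }
  apply cont_C_intro.
  - apply (continuous_ext (fun y => Re (f y) * / (Re (f y) * Re (f y) + Im (f y) * Im (f y)))).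
    + intros y; unfold Cinv, Re, Im, Rdiv; simpl. now rewrite !Rmult_1_r.
    + apply cont_Rmult; [now apply cont_Re | exact K].
  - apply (continuous_ext (fun y => (0 - Im (f y)) * / (Re (f y) * Re (f y) + Im (f y) * Im (f y)))).
    + intros y; unfold Cinv, Re, Im, Rdiv; simpl. now rewrite !Rmult_1_r, Rminus_0_l.
    + apply cont_Rmult; [| exact K]. apply cont_Rminus; [apply continuous_const | now apply cont_Im].
Qed.

Lemma cont_Cdiv {U : UniformSpace} (f g : U -> C) (x : U) :
  continuous f x -> continuous g x -> g x <> RtoC 0 ->
  continuous (fun y => f y / g y)%C x.
Proof.
  intros. apply (cont_Cmult f (fun y => / g y)%C); [assumption|].
  now apply cont_Cinv.
Qed.

Lemma cont_Cexp {U : UniformSpace} (f : U -> C) (x : U) :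
  continuous f x -> continuous (fun y => Cexp (f y)) x.
Proof.
  intros Hf. apply cont_C_intro; unfold Cexp; simpl; apply cont_Rmult;
  [ apply (continuous_comp (fun y => Re (f y)) exp)
  | apply (continuous_comp (fun y => Im (f y)) cos)
  | apply (continuous_comp (fun y => Re (f y)) exp)
  | apply (continuous_comp (fun y => Im (f y)) sin) ];
  try cont_re_im.
  - apply continuity_pt_filterlim, derivable_continuous_pt, derivable_pt_exp.
  - apply continuity_pt_filterlim, continuity_cos.
  - apply continuity_pt_filterlim, derivable_continuous_pt, derivable_pt_exp.
  - apply continuity_pt_filterlim, continuity_sin.
Qed.

Lemma cont_Cpow {U : UniformSpace} (f : U -> C) (n : nat) (x : U) :
  continuous f x -> continuous (fun y => f y ^ n)%C x.
Proof.
  intros H. induction n; simpl.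
  - apply continuous_const.
  - now apply (cont_Cmult f).
Qed.

Lemma cont_Cmod {U : UniformSpace} (f : U -> C) (x : U) :
  continuous f x -> continuous (fun y => Cmod (f y)) x.
Proof.
  intros H.
  apply (continuous_ext (fun y => sqrt (Re (f y) * Re (f y) + Im (f y) * Im (f y)))).
  { intros y. unfold Cmod. f_equal. unfold Re, Im; ring. }
  apply (continuous_comp (fun y => Re (f y) * Re (f y) + Im (f y) * Im (f y)) sqrt).
  - apply cont_Rplus; apply cont_Rmult; cont_re_im.
  - apply continuity_pt_filterlim, continuity_pt_sqrt. nra.
Qed.

(** The balls of [C] as a product space are squares, whereas all estimates use the modulus; halving
    the radius passes from one to the other, because the modulus is at most the sum of the
    coordinates. *)
Lemma cont_C_eps (f : C -> C) (z : C) :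
  (forall eps, 0 < eps -> exists d, 0 < d /\
     forall w, Cmod (w - z) < d -> Cmod (f w - f z) < eps) <->
  continuous f z.
Proof.
  split.
  - intros H P [e He].
    destruct (H e (cond_pos e)) as (d & Hd & Hw).
    assert (Hd2 : 0 < d / 2) by lra.
    exists (mkposreal _ Hd2). intros w [Hb1 Hb2].
    apply He.
    assert (L : Cmod (f w - f z) < e).
    { apply Hw. eapply Rle_lt_trans; [apply Cmod_le_Re_Im|].
      change (Rabs (Re w - Re z) < d / 2) in Hb1.
      change (Rabs (Im w - Im z) < d / 2) in Hb2.
      simpl. unfold Rminus in *. unfold Re, Im in *. lra. }
    split.
    + eapply Rle_lt_trans; [|exact L]. exact (re_le_Cmod (f w - f z)).
    + eapply Rle_lt_trans; [|exact L]. exact (Im_le_Cmod (f w - f z)).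
  - intros H eps Heps.
    assert (He2 : 0 < eps / 2) by lra.
    destruct (H _ (locally_ball (f z) (mkposreal _ He2))) as [d Hd].
    exists d. split; [apply cond_pos|]. intros w Hw.
    destruct (Hd w) as [A B].
    + split; (eapply Rle_lt_trans; [|exact Hw]).
      exact (re_le_Cmod (w - z)). exact (Im_le_Cmod (w - z)).
    + change (Rabs (Re (f w - f z)) < eps / 2) in A.
      change (Rabs (Im (f w - f z)) < eps / 2) in B.
      eapply Rle_lt_trans; [apply Cmod_le_Re_Im|]. lra.
Qed.

Lemma cont_CR_eps (f : C * R -> C) (z : C) (u : R) :
  continuous f (z, u) ->
  forall eps, 0 < eps -> exists d, 0 < d /\
    forall w v, Cmod (w - z) < d -> Rabs (v - u) < d ->
      Cmod (f (w, v) - f (z, u)) < eps.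
Proof.
  intros H eps Heps.
  assert (He2 : 0 < eps / 2) by lra.
  destruct (H _ (locally_ball (f (z, u)) (mkposreal _ He2))) as [d Hd].
  exists d. split; [apply cond_pos|]. intros w v Hw Hv.
  destruct (Hd (w, v)) as [A B].
  - split; [split|]; [| | exact Hv]; (eapply Rle_lt_trans; [|exact Hw]).
    exact (re_le_Cmod (w - z)). exact (Im_le_Cmod (w - z)).
  - change (Rabs (Re (f (w, v) - f (z, u))) < eps / 2) in A.
    change (Rabs (Im (f (w, v) - f (z, u))) < eps / 2) in B.
    eapply Rle_lt_trans; [apply Cmod_le_Re_Im|]. lra.
Qed.

(** * The complex exponential *)

Lemma Cexp_plus (z w : C) : Cexp (z + w) = (Cexp z * Cexp w)%C.
Proof.
  unfold Cexp. apply C_eq; unfold Re, Im; simpl; rewrite exp_plus, ?cos_plus, ?sin_plus; ring.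
Qed.

Lemma Cexp_0 : Cexp 0 = 1%C.
Proof. unfold Cexp; simpl. rewrite exp_0, cos_0, sin_0. apply C_eq; simpl; ring. Qed.

Lemma Cmod_Cexp (z : C) : Cmod (Cexp z) = exp (Re z).
Proof.
  assert (H := Cmod_sqr (Cexp z)). unfold Cexp in H; simpl in H.
  assert (T := sin2_cos2 (Im z)). unfold Rsqr in T.
  replace (exp (Re z) * cos (Im z) * (exp (Re z) * cos (Im z)) +
    exp (Re z) * sin (Im z) * (exp (Re z) * sin (Im z)))
    with (exp (Re z) * exp (Re z)) in H by (ring_simplify; nra).
  assert (P := exp_pos (Re z)). assert (Q := Cmod_ge_0 (Cexp z)).
  unfold Cexp in *. nra.
Qed.

Lemma Cexp_neq_0 (z : C) : Cexp z <> 0%C.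
Proof. intros H. assert (P := exp_pos (Re z)). rewrite <- Cmod_Cexp, H, Cmod_0 in P. lra. Qed.

Lemma Cexp_opp (z : C) : Cexp (- z) = (/ Cexp z)%C.
Proof.
  assert (H : (Cexp z * Cexp (- z) = 1)%C).
  { rewrite <- Cexp_plus. replace (z + - z)%C with (RtoC 0) by ring. apply Cexp_0. }
  assert (N := Cexp_neq_0 z).
  replace (Cexp (- z)) with (/ Cexp z * (Cexp z * Cexp (- z)))%C by (field; exact N).
  rewrite H; ring.
Qed.

(** Remainder form without division, so that no quotient at [w = z] arises and the remainders of
    integrands or of terms of a series can simply be added up. The translation to [is_derive] is
    made once, in [cderiv_is_derive]. *)
Definition cderiv (f : C -> C) (z l : C) : Prop :=
  forall eps, 0 < eps -> exists d, 0 < d /\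
    forall w, Cmod (w - z) < d ->
      Cmod (f w - f z - (w - z) * l) <= eps * Cmod (w - z).

(** Derivative of a curve in its real parameter, taken by coordinates so that the real mean value
    theorem and the real fundamental theorem of calculus apply directly. *)
Definition cpath (h : R -> C) (t : R) (l : C) : Prop :=
  is_derive (fun u => Re (h u)) t (Re l) /\ is_derive (fun u => Im (h u)) t (Im l).

Lemma cpath_cont (h : R -> C) t l : cpath h t l -> continuous h t.
Proof.
  intros [A B]. apply cont_C_intro.
  - apply (ex_derive_continuous (fun u => Re (h u))). now exists (Re l).
  - apply (ex_derive_continuous (fun u => Im (h u))). now exists (Im l).
Qed.

(** The mean value theorem has no vector form with equality. The curve is therefore projected onto
    the direction [z] of its own increment; the real theorem applies there, and Cauchy-Schwarz
    returns the modulus. *)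
Lemma path_mvt (h dh : R -> C) (D a b : R) : a <= b ->
  (forall t, a <= t <= b -> cpath h t (dh t)) ->
  (forall t, a <= t <= b -> Cmod (dh t) <= D) ->
  Cmod (h b - h a) <= D * (b - a).
Proof.
  intros Hab Hd HD.
  set (z := (h b - h a)%C).
  set (k := fun t => Re z * Re (h t) + Im z * Im (h t)).
  set (dk := fun t => Re z * Re (dh t) + Im z * Im (dh t)).
  assert (Hk : forall t, a <= t <= b -> is_derive k t (dk t)).
  { intros t Ht. destruct (Hd t Ht) as [A B].
    apply (is_derive_plus (fun t => Re z * Re (h t)) (fun t => Im z * Im (h t))).
    - apply (is_derive_scal (fun t => Re (h t))). exact A.
    - apply (is_derive_scal (fun t => Im (h t))). exact B. }
  destruct (MVT_gen k a b dk) as (c & Hc & E).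
  - intros x Hx. rewrite Rmin_left, Rmax_right in Hx by lra. apply Hk; lra.
  - intros x Hx. rewrite Rmin_left, Rmax_right in Hx by lra.
    apply continuity_pt_filterlim. apply (ex_derive_continuous k).
    exists (dk x); apply Hk; lra.
  - rewrite Rmin_left, Rmax_right in Hc by lra.
    assert (E2 : Cmod z * Cmod z = dk c * (b - a)).
    { rewrite <- E, Cmod_sqr. unfold k, z; simpl. unfold Re, Im; ring. }
    assert (L1 := C_inner_le z (dh c)). fold (dk c) in L1.
    assert (L2 := HD c Hc). assert (P := Cmod_ge_0 z).
    destruct (Req_dec (Cmod z) 0) as [Z|Z].
    + rewrite Z. assert (0 <= D) by (eapply Rle_trans; [apply Cmod_ge_0 | exact L2]).
      nra.
    + assert (0 < Cmod z) by lra.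
      apply Rmult_le_reg_l with (Cmod z); [assumption|].
      rewrite E2.
      assert (dk c <= Cmod z * D).
      { eapply Rle_trans; [exact L1|]. now apply Rmult_le_compat_l. }
      nra.
Qed.

Lemma is_derive_eps (f : R -> R) (t l : R) :
  (forall eps, 0 < eps -> exists d, 0 < d /\ forall u, Rabs (u - t) < d ->
     Rabs (f u - f t - (u - t) * l) <= eps * Rabs (u - t)) <-> is_derive f t l.
Proof.
  split.
  - intros H. apply is_derive_Reals. intros eps Heps.
    destruct (H (eps / 2)) as (d & Hd & Hu); [lra|].
    exists (mkposreal d Hd). intros h Hh Hlt. simpl in Hlt.
    specialize (Hu (t + h)). replace (t + h - t) with h in Hu by ring.
    specialize (Hu Hlt).
    replace ((f (t + h) - f t) / h - l) with ((f (t + h) - f t - h * l) / h) by (field; exact Hh).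
    unfold Rdiv. rewrite Rabs_mult, Rabs_inv.
    assert (0 < Rabs h) by now apply Rabs_pos_lt.
    apply Rmult_lt_reg_r with (Rabs h); [assumption|].
    rewrite Rmult_assoc, Rinv_l by lra. nra.
  - intros H eps Heps. apply is_derive_Reals in H.
    destruct (H eps Heps) as [d Hd]. exists d. split; [apply cond_pos|].
    intros u Hu. destruct (Req_dec u t) as [->|N].
    + replace (f t - f t - (t - t) * l) with 0 by ring.
      replace (t - t) with 0 by ring. rewrite Rabs_R0; lra.
    + assert (Hn : u - t <> 0) by lra.
      specialize (Hd (u - t) Hn Hu). replace (t + (u - t)) with u in Hd by ring.
      replace (f u - f t - (u - t) * l) with (((f u - f t) / (u - t) - l) * (u - t)) by (field; exact Hn).
      rewrite Rabs_mult. apply Rmult_le_compat_r; [apply Rabs_pos | lra].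
Qed.

Lemma cpath_eps (h : R -> C) (t : R) (l : C) :
  (forall eps, 0 < eps -> exists d, 0 < d /\ forall u, Rabs (u - t) < d ->
     Cmod (h u - h t - RtoC (u - t) * l) <= eps * Rabs (u - t)) <-> cpath h t l.
Proof.
  split.
  - intros H. split; apply is_derive_eps; intros eps He;
    destruct (H eps He) as (d & Hd & Hu); exists d; (split; [assumption|]);
    intros u Hlt; (eapply Rle_trans; [|exact (Hu u Hlt)]).
    + eapply Rle_trans; [|apply re_le_Cmod]. right; f_equal; unfold Re, Im; simpl; ring.
    + eapply Rle_trans; [|apply Im_le_Cmod]. right; f_equal; unfold Re, Im; simpl; ring.
  - intros [A B] eps He.
    destruct (proj2 (is_derive_eps _ _ _) A (eps / 2)) as (d1 & Hd1 & H1); [lra|].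
    destruct (proj2 (is_derive_eps _ _ _) B (eps / 2)) as (d2 & Hd2 & H2); [lra|].
    exists (Rmin d1 d2). split; [now apply Rmin_pos|]. intros u Hu.
    specialize (H1 u (Rlt_le_trans _ _ _ Hu (Rmin_l _ _))).
    specialize (H2 u (Rlt_le_trans _ _ _ Hu (Rmin_r _ _))).
    eapply Rle_trans; [apply Cmod_le_Re_Im|].
    replace (Re (h u - h t - RtoC (u - t) * l)) with
      (Re (h u) - Re (h t) - (u - t) * Re l) by (unfold Re, Im; simpl; ring).
    replace (Im (h u - h t - RtoC (u - t) * l)) with
      (Im (h u) - Im (h t) - (u - t) * Im l) by (unfold Re, Im; simpl; ring).
    lra.
Qed.

Lemma cpath_comp (f : C -> C) (g : R -> C) (t : R) (l d : C) :
  cderiv f (g t) l -> cpath g t d -> cpath (fun u => f (g u)) t (d * l)%C.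
Proof.
  intros Hf Hg. assert (Hg' := proj2 (cpath_eps _ _ _) Hg).
  apply cpath_eps. intros eps He.
  assert (Pl := Cmod_ge_0 l). assert (Pd := Cmod_ge_0 d).
  assert (He1 : 0 < eps / (2 * (Cmod d + 1))) by (apply Rdiv_lt_0_compat; lra).
  assert (He2 : 0 < Rmin 1 (eps / (2 * (Cmod l + 1)))).
  { apply Rmin_pos; [lra|]. apply Rdiv_lt_0_compat; lra. }
  destruct (Hf _ He1) as (d1 & Hd1 & H1).
  destruct (Hg' _ He2) as (d2 & Hd2 & H2).
  exists (Rmin d2 (d1 / (Cmod d + 1))). split.
  { apply Rmin_pos; [assumption|]. apply Rdiv_lt_0_compat; lra. }
  intros u Hu.
  assert (Hu2 := Rlt_le_trans _ _ _ Hu (Rmin_l _ _)).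
  assert (Hu1 := Rlt_le_trans _ _ _ Hu (Rmin_r _ _)).
  specialize (H2 u Hu2).
  assert (Hm1 := Rmin_l 1 (eps / (2 * (Cmod l + 1)))).
  assert (Hm2 := Rmin_r 1 (eps / (2 * (Cmod l + 1)))).
  assert (Pu := Rabs_pos (u - t)).
  assert (G : Cmod (g u - g t) <= (Cmod d + 1) * Rabs (u - t)).
  { replace (g u - g t)%C with ((g u - g t - RtoC (u - t) * d) + RtoC (u - t) * d)%C by ring.
    eapply Rle_trans; [apply Cmod_triangle|]. rewrite Cmod_mult, Cmod_R. nra. }
  assert (Hg1 : Cmod (g u - g t) < d1).
  { eapply Rle_lt_trans; [exact G|].
    apply Rmult_lt_compat_l with (r := Cmod d + 1) in Hu1; [|lra].
    replace ((Cmod d + 1) * (d1 / (Cmod d + 1))) with d1 in Hu1 by (field; lra). exact Hu1. }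
  specialize (H1 _ Hg1).
  replace (f (g u) - f (g t) - RtoC (u - t) * (d * l))%C with
   ((f (g u) - f (g t) - (g u - g t) * l) + (g u - g t - RtoC (u - t) * d) * l)%C by ring.
  eapply Rle_trans; [apply Cmod_triangle|]. rewrite Cmod_mult.
  assert (K1 : Cmod (f (g u) - f (g t) - (g u - g t) * l) <= eps / 2 * Rabs (u - t)).
  { eapply Rle_trans; [exact H1|].
    eapply Rle_trans; [apply Rmult_le_compat_l; [lra | exact G]|].
    right; field; lra. }
  assert (K2 : Cmod (g u - g t - RtoC (u - t) * d) * Cmod l <= eps / 2 * Rabs (u - t)).
  { eapply Rle_trans; [apply Rmult_le_compat_r; [exact Pl | exact H2]|].
    assert (E : eps / (2 * (Cmod l + 1)) * (Cmod l) <= eps / 2).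
    { apply Rmult_le_reg_r with (2 * (Cmod l + 1)); [lra|].
      replace (eps / (2 * (Cmod l + 1)) * Cmod l * (2 * (Cmod l + 1))) with (eps * Cmod l) by (field; lra).
      nra. }
    apply Rle_trans with (1 := Rmult_le_compat_r _ _ _ Pl Hm2) in E.
    rewrite Rmult_assoc, (Rmult_comm _ (Cmod l)), <- Rmult_assoc.
    apply Rmult_le_compat_r; assumption. }
  lra.
Qed.

Lemma cderiv_cont (f : C -> C) (z l : C) : cderiv f z l -> continuous f z.
Proof.
  intros H. apply cont_C_eps. intros eps He.
  destruct (H 1) as (d & Hd & Hw); [lra|].
  assert (P := Cmod_ge_0 l).
  exists (Rmin d (eps / (Cmod l + 2))). split.
  { apply Rmin_pos; [assumption|]. apply Rdiv_lt_0_compat; lra. }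
  intros w Hlt.
  specialize (Hw w (Rlt_le_trans _ _ _ Hlt (Rmin_l _ _))).
  assert (H2 := Rlt_le_trans _ _ _ Hlt (Rmin_r _ _)).
  replace (f w - f z)%C with ((f w - f z - (w - z) * l) + (w - z) * l)%C by ring.
  eapply Rle_lt_trans; [apply Cmod_triangle|]. rewrite Cmod_mult.
  apply Rmult_lt_compat_r with (r := Cmod l + 2) in H2; [|lra].
  replace (eps / (Cmod l + 2) * (Cmod l + 2)) with eps in H2 by (field; lra).
  assert (Q := Cmod_ge_0 (w - z)). nra.
Qed.

Lemma cderiv_ext_loc (f g : C -> C) (z l : C) (r : R) : 0 < r ->
  (forall w, Cmod (w - z) < r -> f w = g w) -> cderiv f z l -> cderiv g z l.
Proof.
  intros Hr E H eps He. destruct (H eps He) as (d & Hd & Hw).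
  exists (Rmin d r). split; [now apply Rmin_pos|]. intros w Hlt.
  rewrite <- (E w), <- (E z).
  - apply Hw. eapply Rlt_le_trans; [exact Hlt | apply Rmin_l].
  - replace (z - z)%C with (RtoC 0) by ring. now rewrite Cmod_0.
  - eapply Rlt_le_trans; [exact Hlt | apply Rmin_r].
Qed.

Lemma cderiv_ext (f g : C -> C) (z l : C) :
  (forall w, f w = g w) -> cderiv f z l -> cderiv g z l.
Proof. intros E. apply (cderiv_ext_loc f g z l 1); [lra | intros; apply E]. Qed.

Lemma cderiv_const (c z : C) : cderiv (fun _ => c) z 0%C.
Proof.
  intros eps He. exists 1. split; [lra|]. intros w _.
  replace (c - c - (w - z) * 0)%C with (RtoC 0) by ring. rewrite Cmod_0.
  assert (Q := Cmod_ge_0 (w - z)). nra.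
Qed.

Lemma cderiv_id (z : C) : cderiv (fun w => w) z 1%C.
Proof.
  intros eps He. exists 1. split; [lra|]. intros w _.
  replace (w - z - (w - z) * 1)%C with (RtoC 0) by ring. rewrite Cmod_0.
  assert (Q := Cmod_ge_0 (w - z)). nra.
Qed.

Lemma cderiv_plus (f g : C -> C) (z l m : C) :
  cderiv f z l -> cderiv g z m -> cderiv (fun w => f w + g w)%C z (l + m)%C.
Proof.
  intros Hf Hg eps He.
  destruct (Hf (eps / 2)) as (d1 & Hd1 & H1); [lra|].
  destruct (Hg (eps / 2)) as (d2 & Hd2 & H2); [lra|].
  exists (Rmin d1 d2). split; [now apply Rmin_pos|]. intros w Hw.
  specialize (H1 w (Rlt_le_trans _ _ _ Hw (Rmin_l _ _))).
  specialize (H2 w (Rlt_le_trans _ _ _ Hw (Rmin_r _ _))).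
  replace (f w + g w - (f z + g z) - (w - z) * (l + m))%C with
    ((f w - f z - (w - z) * l) + (g w - g z - (w - z) * m))%C by ring.
  eapply Rle_trans; [apply Cmod_triangle|]. lra.
Qed.

Lemma cderiv_mult (f g : C -> C) (z l m : C) :
  cderiv f z l -> cderiv g z m ->
  cderiv (fun w => f w * g w)%C z (l * g z + f z * m)%C.
Proof.
  intros Hf Hg eps He.
  assert (Cg := proj2 (cont_C_eps g z) (cderiv_cont _ _ _ Hg)).
  set (A := Cmod (g z) + 1). set (B := Cmod (f z) + 1). set (D := Cmod l + 1).
  assert (PA : 0 < A) by (unfold A; generalize (Cmod_ge_0 (g z)); lra).
  assert (PB : 0 < B) by (unfold B; generalize (Cmod_ge_0 (f z)); lra).
  assert (PD : 0 < D) by (unfold D; generalize (Cmod_ge_0 l); lra).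
  assert (Ha : 0 < eps / (3 * A)) by (apply Rdiv_lt_0_compat; lra).
  assert (Hb : 0 < eps / (3 * B)) by (apply Rdiv_lt_0_compat; lra).
  assert (Hc : 0 < Rmin 1 (eps / (3 * D))).
  { apply Rmin_pos; [lra | apply Rdiv_lt_0_compat; lra]. }
  destruct (Hf _ Ha) as (d1 & Hd1 & H1).
  destruct (Hg _ Hb) as (d2 & Hd2 & H2).
  destruct (Cg _ Hc) as (d3 & Hd3 & H3).
  exists (Rmin d1 (Rmin d2 d3)). split; [repeat apply Rmin_pos; assumption|].
  intros w Hw.
  assert (M := Rmin_r d1 (Rmin d2 d3)).
  specialize (H1 w (Rlt_le_trans _ _ _ Hw (Rmin_l _ _))).
  assert (Hw2 := Rlt_le_trans _ _ _ Hw M).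
  specialize (H2 w (Rlt_le_trans _ _ _ Hw2 (Rmin_l _ _))).
  specialize (H3 w (Rlt_le_trans _ _ _ Hw2 (Rmin_r _ _))).
  assert (M1 := Rmin_l 1 (eps / (3 * D))). assert (M2 := Rmin_r 1 (eps / (3 * D))).
  replace (f w * g w - f z * g z - (w - z) * (l * g z + f z * m))%C with
    ((f w - f z - (w - z) * l) * g w + f z * (g w - g z - (w - z) * m)
      + (w - z) * (l * (g w - g z)))%C by ring.
  set (X := Cmod (w - z)) in *. assert (PX : 0 <= X) by apply Cmod_ge_0.
  eapply Rle_trans; [apply Cmod_triangle|].
  eapply Rle_trans; [apply Rplus_le_compat_r, Cmod_triangle|].
  rewrite !Cmod_mult. fold X.
  assert (G : Cmod (g w) <= A).
  { generalize (Cmod_triangle_rev (g w) (g z)). unfold A; lra. }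
  assert (K1 : Cmod (f w - f z - (w - z) * l) * Cmod (g w) <= eps / 3 * X).
  { replace (eps / 3 * X) with (eps / (3 * A) * X * A) by (field; lra).
    apply Rmult_le_compat; try apply Cmod_ge_0; assumption. }
  assert (K2 : Cmod (f z) * Cmod (g w - g z - (w - z) * m) <= eps / 3 * X).
  { replace (eps / 3 * X) with (B * (eps / (3 * B) * X)) by (field; lra).
    apply Rmult_le_compat; try apply Cmod_ge_0; [unfold B; lra | assumption]. }
  assert (K3 : X * (Cmod l * Cmod (g w - g z)) <= eps / 3 * X).
  { replace (eps / 3 * X) with (X * (D * (eps / (3 * D)))) by (field; lra).
    apply Rmult_le_compat_l; [assumption|].
    apply Rmult_le_compat; try apply Cmod_ge_0; [unfold D; lra | lra]. }
  lra.
Qed.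

Lemma cderiv_comp (f g : C -> C) (z l d : C) :
  cderiv f (g z) l -> cderiv g z d -> cderiv (fun w => f (g w)) z (d * l)%C.
Proof.
  intros Hf Hg eps He.
  assert (Pl := Cmod_ge_0 l). assert (Pd := Cmod_ge_0 d).
  assert (He1 : 0 < eps / (2 * (Cmod d + 1))) by (apply Rdiv_lt_0_compat; lra).
  assert (He2 : 0 < Rmin 1 (eps / (2 * (Cmod l + 1)))).
  { apply Rmin_pos; [lra|]. apply Rdiv_lt_0_compat; lra. }
  destruct (Hf _ He1) as (d1 & Hd1 & H1).
  destruct (Hg _ He2) as (d2 & Hd2 & H2).
  exists (Rmin d2 (d1 / (Cmod d + 1))). split.
  { apply Rmin_pos; [assumption|]. apply Rdiv_lt_0_compat; lra. }
  intros u Hu.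
  assert (Hu2 := Rlt_le_trans _ _ _ Hu (Rmin_l _ _)).
  assert (Hu1 := Rlt_le_trans _ _ _ Hu (Rmin_r _ _)).
  specialize (H2 u Hu2).
  assert (Hm1 := Rmin_l 1 (eps / (2 * (Cmod l + 1)))).
  assert (Hm2 := Rmin_r 1 (eps / (2 * (Cmod l + 1)))).
  assert (Pu := Cmod_ge_0 (u - z)).
  assert (G : Cmod (g u - g z) <= (Cmod d + 1) * Cmod (u - z)).
  { replace (g u - g z)%C with ((g u - g z - (u - z) * d) + (u - z) * d)%C by ring.
    eapply Rle_trans; [apply Cmod_triangle|]. rewrite Cmod_mult. nra. }
  assert (Hg1 : Cmod (g u - g z) < d1).
  { eapply Rle_lt_trans; [exact G|].
    apply Rmult_lt_compat_l with (r := Cmod d + 1) in Hu1; [|lra].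
    replace ((Cmod d + 1) * (d1 / (Cmod d + 1))) with d1 in Hu1 by (field; lra). exact Hu1. }
  specialize (H1 _ Hg1).
  replace (f (g u) - f (g z) - (u - z) * (d * l))%C with
   ((f (g u) - f (g z) - (g u - g z) * l) + (g u - g z - (u - z) * d) * l)%C by ring.
  eapply Rle_trans; [apply Cmod_triangle|]. rewrite Cmod_mult.
  assert (K1 : Cmod (f (g u) - f (g z) - (g u - g z) * l) <= eps / 2 * Cmod (u - z)).
  { eapply Rle_trans; [exact H1|].
    eapply Rle_trans; [apply Rmult_le_compat_l; [lra | exact G]|].
    right; field; lra. }
  assert (K2 : Cmod (g u - g z - (u - z) * d) * Cmod l <= eps / 2 * Cmod (u - z)).
  { eapply Rle_trans; [apply Rmult_le_compat_r; [exact Pl | exact H2]|].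
    assert (E : eps / (2 * (Cmod l + 1)) * (Cmod l) <= eps / 2).
    { apply Rmult_le_reg_r with (2 * (Cmod l + 1)); [lra|].
      replace (eps / (2 * (Cmod l + 1)) * Cmod l * (2 * (Cmod l + 1))) with (eps * Cmod l) by (field; lra).
      nra. }
    apply Rle_trans with (1 := Rmult_le_compat_r _ _ _ Pl Hm2) in E.
    rewrite Rmult_assoc, (Rmult_comm _ (Cmod l)), <- Rmult_assoc.
    apply Rmult_le_compat_r; assumption. }
  lra.
Qed.

Lemma cderiv_Cinv (z : C) : z <> 0%C -> cderiv Cinv z (- / (z * z))%C.
Proof.
  intros Hz eps He.
  assert (Pz : 0 < Cmod z) by now apply Cmod_gt_0.
  assert (CI := proj2 (cont_C_eps Cinv z) (cont_Cinv (fun w : C => w) z (continuous_id z) Hz)).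
  destruct (CI (eps * Cmod z)) as (d & Hd & Hw); [now apply Rmult_lt_0_compat|].
  exists (Rmin d (Cmod z)). split; [now apply Rmin_pos|]. intros w Hlt.
  specialize (Hw w (Rlt_le_trans _ _ _ Hlt (Rmin_l _ _))).
  assert (L := Rlt_le_trans _ _ _ Hlt (Rmin_r _ _)).
  assert (Hw0 : w <> 0%C).
  { intros ->. replace (0 - z)%C with (- z)%C in L by ring. rewrite Cmod_opp in L. lra. }
  replace (/ w - / z - (w - z) * - / (z * z))%C with
    (- ((w - z) * (/ z * (/ w - / z))))%C by (field; split; assumption).
  rewrite Cmod_opp, !Cmod_mult, Cmod_inv by assumption.
  rewrite (Rmult_comm eps). apply Rmult_le_compat_l; [apply Cmod_ge_0|].
  apply Rmult_le_reg_l with (Cmod z); [assumption|].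
  rewrite <- Rmult_assoc, Rinv_r by lra. lra.
Qed.

Lemma cderiv_inv (f : C -> C) (z l : C) : f z <> 0%C ->
  cderiv f z l -> cderiv (fun w => / f w)%C z (l * - / (f z * f z))%C.
Proof. intros Hz H. apply (cderiv_comp Cinv f); [now apply cderiv_Cinv | assumption]. Qed.

Lemma cderiv_eq (f : C -> C) (z l m : C) : cderiv f z l -> l = m -> cderiv f z m.
Proof. now intros H <-. Qed.

Lemma cderiv_opp (f : C -> C) (z l : C) : cderiv f z l -> cderiv (fun w => - f w)%C z (- l)%C.
Proof.
  intros H. eapply cderiv_eq.
  - eapply cderiv_ext; [| exact (cderiv_mult _ _ _ _ _ (cderiv_const (- 1)%C z) H)].
    intros w; simpl; ring.
  - cbv beta; ring.
Qed.

Lemma cderiv_minus (f g : C -> C) (z l m : C) :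
  cderiv f z l -> cderiv g z m -> cderiv (fun w => f w - g w)%C z (l - m)%C.
Proof. intros Hf Hg. apply (cderiv_plus f (fun w => - g w)%C); [assumption | now apply cderiv_opp]. Qed.

Lemma cderiv_scal (c : C) (f : C -> C) (z l : C) :
  cderiv f z l -> cderiv (fun w => c * f w)%C z (c * l)%C.
Proof.
  intros H. eapply cderiv_eq.
  - exact (cderiv_mult _ _ _ _ _ (cderiv_const c z) H).
  - cbv beta; ring.
Qed.

Lemma cderiv_shift (f : C -> C) (a z l : C) :
  cderiv f (a + z)%C l -> cderiv (fun w => f (a + w)%C) z l.
Proof.
  intros H. eapply cderiv_eq.
  - apply (cderiv_comp f (fun w => a + w)%C); [exact H|].
    apply (cderiv_plus (fun _ => a) (fun w => w)); [apply cderiv_const | apply cderiv_id].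
  - cbv beta; ring.
Qed.

Lemma cderiv_pow (f : C -> C) (z l : C) (n : nat) :
  cderiv f z l -> cderiv (fun w => f w ^ n)%C z (RtoC (INR n) * f z ^ pred n * l)%C.
Proof.
  intros H. induction n.
  - simpl. eapply cderiv_eq; [apply cderiv_const|]. simpl; ring.
  - eapply cderiv_eq.
    + exact (cderiv_mult _ _ _ _ _ H IHn).
    + rewrite S_INR, RtoC_plus. simpl pred.
      destruct n; simpl; ring.
Qed.

Lemma cpath_lin (a v : C) (t : R) : cpath (fun u => a + RtoC u * v)%C t v.
Proof.
  apply cpath_eps. intros eps He. exists 1. split; [lra|]. intros u _.
  replace (a + RtoC u * v - (a + RtoC t * v) - RtoC (u - t) * v)%C with (RtoC 0)
    by (rewrite RtoC_minus; ring).
  rewrite Cmod_0. assert (Q := Rabs_pos (u - t)). nra.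
Qed.

Lemma cpath_Cexp_lin (z : C) (t : R) :
  cpath (fun u => Cexp (RtoC u * z)) t (z * Cexp (RtoC t * z))%C.
Proof.
  destruct z as [x y]. split; unfold Cexp, Re, Im; simpl.
  - auto_derive; trivial. replace (t * y + 0 * x) with (t * y) by ring. replace (t * x - 0 * y) with (t * x) by ring. replace (t * x + - (0 * y)) with (t * x) by ring. ring.
  - auto_derive; trivial. replace (t * y + 0 * x) with (t * y) by ring. replace (t * x - 0 * y) with (t * x) by ring. replace (t * x + - (0 * y)) with (t * x) by ring. ring.
Qed.

Lemma Cexp_sub_1_le (z : C) : Cmod (Cexp z - 1) <= Cmod z * exp (Cmod z).
Proof.
  assert (H := path_mvt (fun u => Cexp (RtoC u * z)) (fun t => z * Cexp (RtoC t * z))%C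
    (Cmod z * exp (Cmod z)) 0 1 Rle_0_1 (fun t _ => cpath_Cexp_lin z t)).
  cbv beta in H.
  replace (RtoC 1 * z)%C with z in H by ring.
  replace (RtoC 0 * z)%C with (RtoC 0) in H by ring.
  rewrite Cexp_0 in H.
  eapply Rle_trans; [apply H | lra].
  intros t Ht. rewrite Cmod_mult, Cmod_Cexp.
  apply Rmult_le_compat_l; [apply Cmod_ge_0|].
  assert (P := Cmod_ge_0 z).
  assert (L : Re (RtoC t * z) <= Cmod z).
  { eapply Rle_trans; [apply Rle_abs|]. eapply Rle_trans; [apply re_le_Cmod|].
    rewrite Cmod_mult, Cmod_R, Rabs_pos_eq by lra. nra. }
  destruct L as [L|L]; [left; now apply exp_increasing | right; now rewrite L].
Qed.

(** Mean value bound for [Cexp (u z) - u z], whose derivative [z (Cexp (u z) - 1)] is controlled by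
    the preceding lemma. With the functional equation, this quadratic remainder at 0 yields the
    complex derivative everywhere, without power series. *)
Lemma Cexp_sub_1_sub_le (z : C) : Cmod (Cexp z - 1 - z) <= Cmod z * Cmod z * exp (Cmod z).
Proof.
  assert (H := path_mvt (fun u => Cexp (RtoC u * z) - (0 + RtoC u * z))%C
    (fun t => z * Cexp (RtoC t * z) - z)%C (Cmod z * Cmod z * exp (Cmod z)) 0 1 Rle_0_1).
  cbv beta in H.
  replace (RtoC 1 * z)%C with z in H by ring.
  replace (RtoC 0 * z)%C with (RtoC 0) in H by ring.
  rewrite Cexp_0 in H.
  replace (Cexp z - (0 + z) - (1 - (0 + 0)))%C with (Cexp z - 1 - z)%C in H by ring.
  eapply Rle_trans; [apply H | lra].
  - intros t _. destruct (cpath_Cexp_lin z t) as [A B]. destruct (cpath_lin 0 z t) as [A' B'].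
    split; [exact (is_derive_minus _ _ _ _ _ A A') | exact (is_derive_minus _ _ _ _ _ B B')].
  - intros t Ht. replace (z * Cexp (RtoC t * z) - z)%C with (z * (Cexp (RtoC t * z) - 1))%C by ring.
    rewrite Cmod_mult, Rmult_assoc. apply Rmult_le_compat_l; [apply Cmod_ge_0|].
    eapply Rle_trans; [apply Cexp_sub_1_le|].
    assert (P := Cmod_ge_0 z).
    rewrite Cmod_mult, Cmod_R, Rabs_pos_eq by lra.
    assert (L : t * Cmod z <= Cmod z) by nra.
    apply Rmult_le_compat; [nra | left; apply exp_pos | exact L |].
    destruct L as [L|L]; [left; now apply exp_increasing | right; now rewrite L].
Qed.

Lemma cderiv_Cexp (z : C) : cderiv Cexp z (Cexp z).
Proof.
  intros eps He. assert (P := exp_pos (Re z)).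
  assert (PE : 0 < exp 1) by apply exp_pos.
  exists (Rmin 1 (eps / (exp (Re z) * exp 1))). split.
  { apply Rmin_pos; [lra|]. apply Rdiv_lt_0_compat; [lra|]. now apply Rmult_lt_0_compat. }
  intros w Hw.
  assert (H1 := Rlt_le_trans _ _ _ Hw (Rmin_l _ _)).
  assert (H2 := Rlt_le_trans _ _ _ Hw (Rmin_r _ _)).
  replace (Cexp w) with (Cexp z * Cexp (w - z))%C
    by (rewrite <- Cexp_plus; f_equal; ring).
  replace (Cexp z * Cexp (w - z) - Cexp z - (w - z) * Cexp z)%C with
    (Cexp z * (Cexp (w - z) - 1 - (w - z)))%C by ring.
  rewrite Cmod_mult, Cmod_Cexp.
  set (X := Cmod (w - z)) in *. assert (PX : 0 <= X) by apply Cmod_ge_0.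
  assert (L := Cexp_sub_1_sub_le (w - z)). fold X in L.
  assert (L2 : exp X <= exp 1) by (left; now apply exp_increasing).
  apply Rmult_lt_compat_r with (r := exp (Re z) * exp 1) in H2; [|now apply Rmult_lt_0_compat].
  replace (eps / (exp (Re z) * exp 1) * (exp (Re z) * exp 1)) with eps in H2 by (field; lra).
  eapply Rle_trans; [apply Rmult_le_compat_l; [lra | exact L]|].
  assert (X * X * exp X <= X * X * exp 1) by (apply Rmult_le_compat_l; [nra | assumption]).
  apply Rle_trans with (exp (Re z) * (X * X * exp 1)).
  - apply Rmult_le_compat_l; lra.
  - replace (exp (Re z) * (X * X * exp 1)) with (X * (exp (Re z) * exp 1) * X) by ring.
    apply Rmult_le_compat_r; lra.
Qed.

(** * Integrals and series of complex functions *)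

(** [path_mvt] on the segment from [z] to [w], after subtracting the linear map of slope [l]. With
    [l] the derivative at [z] it bounds a Taylor remainder; with [l = 0] it is a Lipschitz bound. *)
Lemma cderiv_mvt (f f' : C -> C) (z w l : C) (D : R) :
  (forall t, 0 <= t <= 1 -> cderiv f (z + RtoC t * (w - z))%C (f' (z + RtoC t * (w - z))%C)) ->
  (forall t, 0 <= t <= 1 -> Cmod (f' (z + RtoC t * (w - z))%C - l) <= D) ->
  Cmod (f w - f z - (w - z) * l) <= D * Cmod (w - z).
Proof.
  intros Hd HD.
  assert (H := path_mvt
    (fun t => f (z + RtoC t * (w - z)) - (0 + RtoC t * ((w - z) * l)))%C
    (fun t => (w - z) * f' (z + RtoC t * (w - z)) - (w - z) * l)%C
    (D * Cmod (w - z)) 0 1 Rle_0_1).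
  cbv beta in H.
  replace (z + RtoC 1 * (w - z))%C with w in H by ring.
  replace (z + RtoC 0 * (w - z))%C with z in H by ring.
  replace (f w - f z - (w - z) * l)%C with
    (f w - (0 + 1 * ((w - z) * l)) - (f z - (0 + 0 * ((w - z) * l))))%C by ring.
  eapply Rle_trans; [apply H | lra].
  - intros t Ht.
    destruct (cpath_comp f (fun u => z + RtoC u * (w - z))%C t _ _ (Hd t Ht) (cpath_lin z (w - z) t)) as [A B].
    destruct (cpath_lin 0 ((w - z) * l) t) as [A' B'].
    split; [exact (is_derive_minus _ _ _ _ _ A A') | exact (is_derive_minus _ _ _ _ _ B B')].
  - intros t Ht.
    replace ((w - z) * f' (z + RtoC t * (w - z)) - (w - z) * l)%C with
      ((f' (z + RtoC t * (w - z)) - l) * (w - z))%C by ring.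
    rewrite Cmod_mult. apply Rmult_le_compat_r; [apply Cmod_ge_0 | now apply HD].
Qed.

(** The derivative is only inspected on the segment between the two points. The deformation of
    circles and the logarithm are both obtained by exhibiting a vanishing derivative in this way. *)
Lemma cderiv_0_const (f : C -> C) (z w : C) :
  (forall t, 0 <= t <= 1 -> cderiv f (z + RtoC t * (w - z))%C 0) -> f w = f z.
Proof.
  intros H.
  assert (L := cderiv_mvt f (fun _ => 0%C) z w 0 0 H).
  assert (E : Cmod (f w - f z - (w - z) * 0) = 0).
  { apply Rle_antisym; [|apply Cmod_ge_0]. apply Rle_trans with (0 * Cmod (w - z)); [apply L | lra]. intros. replace (0 - 0)%C with (RtoC 0) by ring. rewrite Cmod_0; lra. }
  apply Cmod_eq_0 in E.
  replace (f w) with (f w - f z - (w - z) * 0 + f z)%C by ring. rewrite E; ring.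
Qed.

Lemma Cmod_segment (z w : C) (t : R) : 0 <= t <= 1 ->
  Cmod (z + RtoC t * (w - z) - z) <= Cmod (w - z).
Proof.
  intros Ht. replace (z + RtoC t * (w - z) - z)%C with (RtoC t * (w - z))%C by ring.
  rewrite Cmod_mult, Cmod_R, Rabs_pos_eq by lra. assert (P := Cmod_ge_0 (w - z)). nra.
Qed.

(** * Integrals of complex functions over real intervals *)

Definition CInt (f : R -> C) (a b : R) : C :=
  (RInt (fun t => Re (f t)) a b, RInt (fun t => Im (f t)) a b).

Definition cont_on (f : R -> C) (a b : R) : Prop :=
  forall t, a <= t <= b -> continuous f t.

Lemma cont_on_Re (f : R -> C) a b : a <= b -> cont_on f a b -> ex_RInt (fun t => Re (f t)) a b.
Proof.
  intros Hab H. apply (ex_RInt_continuous (fun t => Re (f t))). intros z Hz.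
  rewrite Rmin_left, Rmax_right in Hz by lra. apply cont_Re. now apply H.
Qed.

Lemma cont_on_Im (f : R -> C) a b : a <= b -> cont_on f a b -> ex_RInt (fun t => Im (f t)) a b.
Proof.
  intros Hab H. apply (ex_RInt_continuous (fun t => Im (f t))). intros z Hz.
  rewrite Rmin_left, Rmax_right in Hz by lra. apply cont_Im. now apply H.
Qed.

Lemma CInt_ext (f g : R -> C) a b : a <= b ->
  (forall t, a <= t <= b -> f t = g t) -> CInt f a b = CInt g a b.
Proof.
  intros Hab H. unfold CInt. f_equal; apply RInt_ext; intros t Ht;
  rewrite Rmin_left, Rmax_right in Ht by lra; rewrite H by lra; reflexivity.
Qed.

Lemma CInt_plus (f g : R -> C) a b : a <= b -> cont_on f a b -> cont_on g a b ->
  CInt (fun t => f t + g t)%C a b = (CInt f a b + CInt g a b)%C.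
Proof.
  intros Hab Hf Hg. apply C_eq; unfold CInt, Re, Im; simpl.
  - apply (RInt_plus (fun t => fst (f t)) (fun t => fst (g t)));
    [now apply (cont_on_Re f) | now apply (cont_on_Re g)].
  - apply (RInt_plus (fun t => snd (f t)) (fun t => snd (g t)));
    [now apply (cont_on_Im f) | now apply (cont_on_Im g)].
Qed.

Lemma CInt_scal (c : C) (f : R -> C) a b : a <= b -> cont_on f a b ->
  CInt (fun t => c * f t)%C a b = (c * CInt f a b)%C.
Proof.
  intros Hab Hf. assert (A := cont_on_Re f a b Hab Hf). assert (B := cont_on_Im f a b Hab Hf).
  assert (S1 : forall x, RInt (fun t => x * Re (f t)) a b = x * RInt (fun t => Re (f t)) a b).
  { intros x. exact (RInt_scal (fun t => Re (f t)) a b x A). }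
  assert (S2 : forall x, RInt (fun t => x * Im (f t)) a b = x * RInt (fun t => Im (f t)) a b).
  { intros x. exact (RInt_scal (fun t => Im (f t)) a b x B). }
  assert (E1 : forall x, ex_RInt (fun t => x * Re (f t)) a b) by (intros x; exact (ex_RInt_scal _ a b x A)).
  assert (E2 : forall x, ex_RInt (fun t => x * Im (f t)) a b) by (intros x; exact (ex_RInt_scal _ a b x B)).
  apply C_eq.
  - change (RInt (fun t => Re c * Re (f t) - Im c * Im (f t)) a b =
      Re c * RInt (fun t => Re (f t)) a b - Im c * RInt (fun t => Im (f t)) a b).
    rewrite <- S1, <- S2. exact (RInt_minus _ _ a b (E1 _) (E2 _)).
  - change (RInt (fun t => Re c * Im (f t) + Im c * Re (f t)) a b =
      Re c * RInt (fun t => Im (f t)) a b + Im c * RInt (fun t => Re (f t)) a b).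
    rewrite <- S1, <- S2. exact (RInt_plus _ _ a b (E2 _) (E1 _)).
Qed.

Lemma cont_on_scal (c : C) f a b : cont_on f a b -> cont_on (fun t => c * f t)%C a b.
Proof. intros H t Ht. apply cont_Cmult; [apply continuous_const | now apply H]. Qed.

Lemma CInt_minus (f g : R -> C) a b : a <= b -> cont_on f a b -> cont_on g a b ->
  CInt (fun t => f t - g t)%C a b = (CInt f a b - CInt g a b)%C.
Proof.
  intros Hab Hf Hg.
  rewrite (CInt_ext _ (fun t => f t + (- 1) * g t)%C) by (assumption || (intros; ring)).
  rewrite (CInt_plus f (fun t => (- 1) * g t)%C a b Hab Hf (cont_on_scal _ g a b Hg)).
  rewrite (CInt_scal _ g a b Hab Hg). ring.
Qed.

Lemma CInt_const (c : C) a b : CInt (fun _ => c) a b = (RtoC (b - a) * c)%C.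
Proof.
  unfold CInt. rewrite !RInt_const. apply C_eq; unfold Re, Im, scal; simpl; unfold mult; simpl; ring.
Qed.

(** As in [path_mvt], the integral is paired with its own value [z]: the square of [Cmod z] is the
    integral of a real inner product that is at most [Cmod z * g t]. *)
Lemma CInt_norm_le (f : R -> C) (g : R -> R) a b : a <= b -> cont_on f a b ->
  ex_RInt g a b -> (forall t, a <= t <= b -> Cmod (f t) <= g t) ->
  Cmod (CInt f a b) <= RInt g a b.
Proof.
  intros Hab Hf Hg Hle. set (z := CInt f a b).
  assert (A := cont_on_Re f a b Hab Hf). assert (B := cont_on_Im f a b Hab Hf).
  destruct (Req_dec (Cmod z) 0) as [Z|Z].
  { rewrite Z. apply RInt_ge_0; try assumption. intros x Hx.
    eapply Rle_trans; [apply Cmod_ge_0 | apply Hle; lra]. }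
  assert (P : 0 < Cmod z) by (generalize (Cmod_ge_0 z); lra).
  apply Rmult_le_reg_l with (Cmod z); [assumption|].
  rewrite Cmod_sqr.
  assert (E1 : ex_RInt (fun t => Re z * Re (f t)) a b) by exact (ex_RInt_scal _ a b _ A).
  assert (E2 : ex_RInt (fun t => Im z * Im (f t)) a b) by exact (ex_RInt_scal _ a b _ B).
  assert (E : Re z * Re z + Im z * Im z = RInt (fun t => Re z * Re (f t) + Im z * Im (f t)) a b).
  { symmetry. etransitivity; [exact (RInt_plus _ _ a b E1 E2)|].
    apply (f_equal2 Rplus); [exact (RInt_scal _ a b (Re z) A) | exact (RInt_scal _ a b (Im z) B)]. }
  rewrite E.
  assert (E3 : RInt (fun t => Cmod z * g t) a b = Cmod z * RInt g a b)
    by exact (RInt_scal g a b (Cmod z) Hg).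
  rewrite <- E3. apply RInt_le; [assumption | exact (ex_RInt_plus _ _ a b E1 E2) | exact (ex_RInt_scal _ a b _ Hg) |].
  intros t Ht. eapply Rle_trans; [apply C_inner_le|].
  apply Rmult_le_compat_l; [lra | apply Hle; lra].
Qed.

Lemma CInt_norm_const (f : R -> C) (D : R) a b : a <= b -> cont_on f a b ->
  (forall t, a <= t <= b -> Cmod (f t) <= D) -> Cmod (CInt f a b) <= (b - a) * D.
Proof.
  intros Hab Hf HD.
  eapply Rle_trans; [apply (CInt_norm_le f (fun _ => D)); try assumption; apply ex_RInt_const|].
  rewrite RInt_const. right; reflexivity.
Qed.

Lemma CInt_FTC (h dh : R -> C) a b : a <= b ->
  (forall t, a <= t <= b -> cpath h t (dh t)) -> cont_on dh a b ->
  CInt dh a b = (h b - h a)%C.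
Proof.
  intros Hab Hd Hc. apply C_eq; apply is_RInt_unique.
  - apply (is_RInt_derive (fun t => Re (h t)) (fun t => Re (dh t))); intros x Hx;
    rewrite Rmin_left, Rmax_right in Hx by lra; [now apply Hd | apply cont_Re; now apply Hc].
  - apply (is_RInt_derive (fun t => Im (h t)) (fun t => Im (dh t))); intros x Hx;
    rewrite Rmin_left, Rmax_right in Hx by lra; [now apply Hd | apply cont_Im; now apply Hc].
Qed.

(* The remainder of [F w u] at [w0] is controlled by [dF w u - dF w0 u], which is
   uniformly small in [u] by compactness of [a, b]. *)
Lemma cderiv_CInt (F dF : C -> R -> C) (a b : R) (w0 : C) (r : R) : a <= b -> 0 < r ->
  (forall w u, Cmod (w - w0) < r -> a <= u <= b -> cderiv (fun w => F w u) w (dF w u)) ->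
  (forall w, Cmod (w - w0) < r -> cont_on (F w) a b) ->
  (forall u, a <= u <= b -> continuous (fun p : C * R => dF (fst p) (snd p)) (w0, u)) ->
  cderiv (fun w => CInt (F w) a b) w0 (CInt (dF w0) a b).
Proof.
  intros Hab Hr HF HcF HdF eps Heps.
  (* The added 1 allows [a = b]. *)
  set (e := eps / (b - a + 1)).
  assert (He : 0 < e) by (apply Rdiv_lt_0_compat; lra).
  assert (Hdel : forall u, exists d : posreal, a <= u <= b ->
    forall w v, Cmod (w - w0) < d -> Rabs (v - u) < d -> Cmod (dF w v - dF w0 v) < e).
  { intros u. destruct (classic (a <= u <= b)) as [Hu|Hu].
    - assert (H2 : 0 < e / 2) by lra.
      destruct (cont_CR_eps _ _ _ (HdF u Hu) _ H2) as (d & Hd & Hw).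
      exists (mkposreal d Hd). simpl. intros _ w v H1 H3.
      assert (K1 := Hw w v H1 H3). simpl in K1.
      assert (K0 : Cmod (w0 - w0) < d).
      { replace (w0 - w0)%C with (RtoC 0) by ring. now rewrite Cmod_0. }
      assert (K2 := Hw w0 v K0 H3). simpl in K2.
      replace (dF w v - dF w0 v)%C with ((dF w v - dF w0 u) - (dF w0 v - dF w0 u))%C by ring.
      eapply Rle_lt_trans; [apply Cmod_triangle_minus|]. lra.
    - exists (mkposreal 1 Rlt_0_1). intros; contradiction. }
  set (del := fun u => proj1_sig (constructive_indefinite_description _ (Hdel u))).
  assert (Hdel' : forall u, a <= u <= b -> forall w v, Cmod (w - w0) < del u ->
    Rabs (v - u) < del u -> Cmod (dF w v - dF w0 v) < e).
  { intros u. unfold del. exact (proj2_sig (constructive_indefinite_description _ (Hdel u))). }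
  (* Compactness of the interval: every point lies within [del t] of some [t] with [d <= del t]. The
     conclusion comes under a double negation, removed by [NNPP] below. *)
  destruct (compactness_value_1d a b del) as [d Hd].
  exists (Rmin d r). split; [apply Rmin_pos; [apply cond_pos | assumption]|].
  intros w Hw.
  assert (Hw1 := Rlt_le_trans _ _ _ Hw (Rmin_l _ _)).
  assert (Hw2 := Rlt_le_trans _ _ _ Hw (Rmin_r _ _)).
  assert (U : forall v w', a <= v <= b -> Cmod (w' - w0) <= Cmod (w - w0) ->
    Cmod (dF w' v - dF w0 v) <= e).
  { intros v w' Hv Hw'. destruct (NNPP _ (Hd v Hv)) as (t & Ht & Hvt & Hdt).
    left. apply (Hdel' t Ht); [lra | assumption]. }
  assert (C0 : cont_on (F w0) a b).
  { apply HcF. replace (w0 - w0)%C with (RtoC 0) by ring. now rewrite Cmod_0. }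
  assert (Cd : cont_on (dF w0) a b).
  { intros u Hu.
    apply (continuous_comp_2 (fun _ : R => w0) (fun v : R => v) (fun w v => dF w v)).
    - apply continuous_const.
    - apply continuous_id.
    - now apply HdF. }
  assert (Cw : cont_on (F w) a b) by now apply HcF.
  assert (Cs : cont_on (fun t => (w - w0) * dF w0 t)%C a b) by now apply cont_on_scal.
  assert (Cm : cont_on (fun t => F w t - F w0 t)%C a b).
  { intros t Ht. apply cont_Cminus; [now apply Cw | now apply C0]. }
  replace (CInt (F w) a b - CInt (F w0) a b - (w - w0) * CInt (dF w0) a b)%C with
    (CInt (fun t => F w t - F w0 t - (w - w0) * dF w0 t)%C a b).
  2:{ rewrite (CInt_minus (fun t => F w t - F w0 t)%C (fun t => (w - w0) * dF w0 t)%C a b Hab Cm Cs).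
      rewrite (CInt_minus (F w) (F w0) a b Hab Cw C0).
      rewrite (CInt_scal (w - w0) (dF w0) a b Hab Cd). reflexivity. }
  apply Rle_trans with ((b - a) * (e * Cmod (w - w0))).
  - apply CInt_norm_const; [assumption | |].
    + intros t Ht. apply cont_Cminus; [now apply Cm | now apply Cs].
    + intros t Ht.
      apply (cderiv_mvt (fun w => F w t) (fun w => dF w t)).
      * intros s Hs. apply HF; [|assumption].
        eapply Rle_lt_trans; [now apply Cmod_segment | assumption].
      * intros s Hs. apply U; [assumption|]. now apply Cmod_segment.
  - rewrite <- Rmult_assoc. apply Rmult_le_compat_r; [apply Cmod_ge_0|].
    unfold e. apply Rmult_le_reg_r with (b - a + 1); [lra|].
    replace ((b - a) * (eps / (b - a + 1)) * (b - a + 1)) with ((b - a) * eps) by (field; lra). nra.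
Qed.

(** * Finite sums and series *)

Fixpoint csum (f : nat -> C) (n : nat) : C :=
  match n with O => 0%C | S k => (csum f k + f k)%C end.

(** Indices run over [k < n]. Arithmetic functions are summed as [f (S k)], so that an upper limit
    [N] covers exactly 1, ..., N and division by the index is safe. *)
Fixpoint rsum (f : nat -> R) (n : nat) : R :=
  match n with O => 0 | S k => rsum f k + f k end.

Definition cser (f : nat -> C) (l : C) : Prop :=
  forall eps, 0 < eps -> exists N, forall n, (N <= n)%nat -> Cmod (csum f n - l) < eps.

(** Total, like [Series]; it is known to be the sum only once [cser_dom] supplies a convergent
    majorant. *)
Definition CSer (f : nat -> C) : C := (Series (fun n => Re (f n)), Series (fun n => Im (f n))).

Lemma csum_ext f g n : (forall k, (k < n)%nat -> f k = g k) -> csum f n = csum g n.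
Proof. intros H. induction n; simpl; [reflexivity|]. rewrite IHn, H; auto. Qed.

Lemma rsum_ext f g n : (forall k, (k < n)%nat -> f k = g k) -> rsum f n = rsum g n.
Proof. intros H. induction n; simpl; [reflexivity|]. rewrite IHn, H; auto. Qed.

Lemma rsum_scal c f n : rsum (fun k => c * f k) n = c * rsum f n.
Proof. induction n; simpl; [ring|]. rewrite IHn; ring. Qed.

Lemma rsum_const c n : rsum (fun _ => c) n = INR n * c.
Proof. induction n; [simpl; ring|]. simpl rsum. rewrite IHn, S_INR. ring. Qed.

Lemma rsum_nonneg f n : (forall k, (k < n)%nat -> 0 <= f k) -> 0 <= rsum f n.
Proof.
  intros H. induction n; simpl; [lra|].
  apply Rplus_le_le_0_compat; [apply IHn; auto | apply H; auto].
Qed.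

Lemma csum_plus f g n : csum (fun k => f k + g k)%C n = (csum f n + csum g n)%C.
Proof. induction n; simpl; [ring|]. rewrite IHn; ring. Qed.

Lemma csum_scal c f n : csum (fun k => c * f k)%C n = (c * csum f n)%C.
Proof. induction n; simpl; [ring|]. rewrite IHn; ring. Qed.

Lemma csum_minus f g n : csum (fun k => f k - g k)%C n = (csum f n - csum g n)%C.
Proof. induction n; simpl; [ring|]. rewrite IHn; ring. Qed.

Lemma csum_norm_le f g n : (forall k, (k < n)%nat -> Cmod (f k) <= g k) -> Cmod (csum f n) <= rsum g n.
Proof.
  intros H. induction n; simpl; [rewrite Cmod_0; lra|].
  eapply Rle_trans; [apply Cmod_triangle|].
  apply Rplus_le_compat; [apply IHn; auto | apply H; auto].
Qed.

Lemma rsum_abs_le f g n : (forall k, (k < n)%nat -> Rabs (f k) <= g k) -> Rabs (rsum f n) <= rsum g n.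
Proof.
  intros H. induction n; simpl; [rewrite Rabs_R0; lra|].
  eapply Rle_trans; [apply Rabs_triang|].
  apply Rplus_le_compat; [apply IHn; auto | apply H; auto].
Qed.

Lemma csum_Re f n : Re (csum f n) = rsum (fun k => Re (f k)) n.
Proof. induction n; [reflexivity|]. simpl. rewrite <- IHn. reflexivity. Qed.

Lemma csum_Im f n : Im (csum f n) = rsum (fun k => Im (f k)) n.
Proof. induction n; [reflexivity|]. simpl. rewrite <- IHn. reflexivity. Qed.

Lemma rsum_sum_n f n : rsum f (S n) = sum_n f n.
Proof.
  induction n.
  - simpl. rewrite sum_O. ring.
  - rewrite sum_Sn, <- IHn. reflexivity.
Qed.

Lemma rsum_lim f : ex_series f -> forall eps, 0 < eps -> exists N, forall n, (N <= n)%nat ->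
  Rabs (rsum f n - Series f) < eps.
Proof.
  intros Hf eps He. apply Series_correct in Hf.
  destruct (Hf _ (locally_ball _ (mkposreal _ He))) as [N HN].
  exists (S N). intros n Hn. destruct n; [lia|].
  rewrite rsum_sum_n. apply (HN n). lia.
Qed.

Lemma Rle_of_eps (a b : R) : (forall eps, 0 < eps -> a <= b + eps) -> a <= b.
Proof.
  intros H. destruct (Rle_or_lt a b) as [|L]; [assumption|].
  specialize (H ((a - b) / 2)). lra.
Qed.

Lemma rsum_le_Series f n : (forall k, 0 <= f k) -> ex_series f -> rsum f n <= Series f.
Proof.
  intros Hp Hf. apply Rle_of_eps. intros eps He.
  destruct (rsum_lim f Hf eps He) as [N HN].
  specialize (HN (N + n)%nat ltac:(lia)).
  assert (rsum f n <= rsum f (N + n)).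
  { clear - Hp. induction N; simpl; [lra | specialize (Hp (N + n)%nat); lra]. }
  apply Rabs_def2 in HN. lra.
Qed.

Lemma ex_series_dom (a b : nat -> R) : (forall n, Rabs (a n) <= b n) -> ex_series b -> ex_series a.
Proof. intros H. apply (ex_series_le (V := R_CompleteNormedModule) a b). exact H. Qed.

Lemma cser_dom (f : nat -> C) (M : nat -> R) :
  (forall n, Cmod (f n) <= M n) -> ex_series M -> cser f (CSer f).
Proof.
  intros Hf HM eps He.
  assert (H1 : ex_series (fun n => Re (f n))).
  { apply (ex_series_dom _ M); [|assumption]. intros n.
    eapply Rle_trans; [apply re_le_Cmod | apply Hf]. }
  assert (H2 : ex_series (fun n => Im (f n))).
  { apply (ex_series_dom _ M); [|assumption]. intros n.
    eapply Rle_trans; [apply Im_le_Cmod | apply Hf]. }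
  destruct (rsum_lim _ H1 (eps / 2)) as [N1 K1]; [lra|].
  destruct (rsum_lim _ H2 (eps / 2)) as [N2 K2]; [lra|].
  exists (max N1 N2). intros n Hn.
  eapply Rle_lt_trans; [apply Cmod_le_Re_Im|].
  specialize (K1 n ltac:(lia)). specialize (K2 n ltac:(lia)).
  rewrite <- csum_Re in K1. rewrite <- csum_Im in K2.
  unfold CSer. simpl. unfold Rminus, Re, Im in *. lra.
Qed.

Lemma cser_le f l B : cser f l -> (forall n, Cmod (csum f n) <= B) -> Cmod l <= B.
Proof.
  intros H HB. apply Rle_of_eps. intros eps He. destruct (H eps He) as [N HN].
  specialize (HN N (Nat.le_refl _)). specialize (HB N).
  rewrite Cmod_minus_sym in HN. generalize (Cmod_triangle_rev l (csum f N)). lra.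
Qed.

Lemma CSer_le f M : (forall n, Cmod (f n) <= M n) -> ex_series M -> Cmod (CSer f) <= Series M.
Proof.
  intros Hf HM. apply (cser_le f); [now apply (cser_dom f M)|].
  intros n. eapply Rle_trans; [apply csum_norm_le; intros; apply Hf|].
  apply rsum_le_Series; [|assumption]. intros k. eapply Rle_trans; [apply Cmod_ge_0 | apply Hf].
Qed.

Lemma cser_unique f l m : cser f l -> cser f m -> l = m.
Proof.
  intros Hl Hm. apply Ceq_minus. apply Cmod_eq_0. apply Rle_antisym; [|apply Cmod_ge_0].
  apply Rle_of_eps. intros eps He.
  destruct (Hl (eps / 2)) as [N1 H1]; [lra|]. destruct (Hm (eps / 2)) as [N2 H2]; [lra|].
  specialize (H1 (max N1 N2) ltac:(lia)). specialize (H2 (max N1 N2) ltac:(lia)).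
  replace (l - m)%C with ((csum f (max N1 N2) - m) - (csum f (max N1 N2) - l))%C by ring.
  eapply Rle_trans; [apply Cmod_triangle_minus|]. lra.
Qed.

Lemma cser_ext f g l : (forall n, f n = g n) -> cser f l -> cser g l.
Proof.
  intros E H eps He. destruct (H eps He) as [N HN]. exists N. intros n Hn.
  rewrite (csum_ext g f) by (intros; symmetry; apply E). now apply HN.
Qed.

Lemma cser_scal c f l : cser f l -> cser (fun n => c * f n)%C (c * l)%C.
Proof.
  intros H eps He. assert (P := Cmod_ge_0 c).
  destruct (H (eps / (Cmod c + 1))) as [N HN]; [apply Rdiv_lt_0_compat; lra|].
  exists N. intros n Hn. specialize (HN n Hn). rewrite csum_scal.
  replace (c * csum f n - c * l)%C with (c * (csum f n - l))%C by ring.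
  rewrite Cmod_mult. apply Rmult_lt_compat_l with (r := Cmod c + 1) in HN; [|lra].
  replace ((Cmod c + 1) * (eps / (Cmod c + 1))) with eps in HN by (field; lra).
  generalize (Cmod_ge_0 (csum f n - l)). nra.
Qed.

Lemma cser_plus f g l m : cser f l -> cser g m -> cser (fun n => f n + g n)%C (l + m)%C.
Proof.
  intros Hl Hm eps He.
  destruct (Hl (eps / 2)) as [N1 H1]; [lra|]. destruct (Hm (eps / 2)) as [N2 H2]; [lra|].
  exists (max N1 N2). intros n Hn. specialize (H1 n ltac:(lia)). specialize (H2 n ltac:(lia)).
  rewrite csum_plus.
  replace (csum f n + csum g n - (l + m))%C with ((csum f n - l) + (csum g n - m))%C by ring.
  eapply Rle_lt_trans; [apply Cmod_triangle|]. lra.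
Qed.

Lemma cser_minus f g l m : cser f l -> cser g m -> cser (fun n => f n - g n)%C (l - m)%C.
Proof.
  intros Hl Hm.
  apply (cser_ext (fun n => f n + (- 1) * g n)%C); [intros; ring|].
  replace (l - m)%C with (l + (- 1) * m)%C by ring.
  apply cser_plus; [assumption | now apply cser_scal].
Qed.

(** A summable bound on the second derivatives makes the linearisation error of the [n]-th term at
    most [M n] times the squared distance, and these errors can be summed directly. *)
Lemma cderiv_series (f f' f'' : nat -> C -> C) (S : C -> C) (S' w0 : C) (r : R) (M : nat -> R) :
  0 < r -> ex_series M ->
  (forall n w, Cmod (w - w0) < r -> cderiv (f n) w (f' n w)) ->
  (forall n w, Cmod (w - w0) < r -> cderiv (f' n) w (f'' n w)) ->
  (forall n w, Cmod (w - w0) < r -> Cmod (f'' n w) <= M n) ->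
  (forall w, Cmod (w - w0) < r -> cser (fun n => f n w) (S w)) ->
  cser (fun n => f' n w0) S' ->
  cderiv S w0 S'.
Proof.
  intros Hr HM H1 H2 HB HS HS' eps He.
  assert (Z : Cmod (w0 - w0) < r) by (replace (w0 - w0)%C with (RtoC 0) by ring; now rewrite Cmod_0).
  assert (PM : forall n, 0 <= M n).
  { intros n. eapply Rle_trans; [apply Cmod_ge_0 | apply (HB n w0 Z)]. }
  assert (PS : 0 <= Series M).
  { apply Rle_trans with (rsum M 0); [simpl; lra | now apply rsum_le_Series]. }
  exists (Rmin r (eps / (Series M + 1))). split.
  { apply Rmin_pos; [assumption|]. apply Rdiv_lt_0_compat; lra. }
  intros w Hw.
  assert (Hw1 := Rlt_le_trans _ _ _ Hw (Rmin_l _ _)).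
  assert (Hw2 := Rlt_le_trans _ _ _ Hw (Rmin_r _ _)).
  set (X := Cmod (w - w0)) in *. assert (PX : 0 <= X) by apply Cmod_ge_0.
  (* Two mean value steps: the second derivative bounds the variation of [f' n], and this variation
     bounds the remainder of [f n]. *)
  assert (T : forall n, Cmod (f n w - f n w0 - (w - w0) * f' n w0) <= M n * X * X).
  { intros n. apply (cderiv_mvt (f n) (f' n)).
    - intros t Ht. apply H1. eapply Rle_lt_trans; [now apply Cmod_segment | assumption].
    - intros t Ht. set (v := (w0 + RtoC t * (w - w0))%C).
      assert (Hv : Cmod (v - w0) <= X) by now apply Cmod_segment.
      replace (f' n v - f' n w0)%C with (f' n v - f' n w0 - (v - w0) * 0)%C by ring.
      apply Rle_trans with (M n * Cmod (v - w0)).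
      + apply (cderiv_mvt (f' n) (f'' n)).
        * intros s Hs. apply H2. eapply Rle_lt_trans; [now apply Cmod_segment | lra].
        * intros s Hs.
          replace (f'' n (w0 + RtoC s * (v - w0)) - 0)%C with (f'' n (w0 + RtoC s * (v - w0))%C) by ring.
          apply HB. eapply Rle_lt_trans; [now apply Cmod_segment | lra].
      + now apply Rmult_le_compat_l. }
  apply Rle_trans with (Series M * X * X).
  - apply (cser_le (fun n => f n w - f n w0 - (w - w0) * f' n w0)%C).
    + apply cser_minus; [apply cser_minus; now apply HS | now apply cser_scal].
    + intros n. eapply Rle_trans; [apply csum_norm_le; intros; apply T|].
      rewrite (rsum_ext _ (fun k => (X * X) * M k)) by (intros; ring).
      rewrite rsum_scal.
      assert (rsum M n <= Series M) by now apply rsum_le_Series.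
      nra.
  - apply Rmult_le_compat_r; [assumption|].
    apply Rmult_lt_compat_r with (r := Series M + 1) in Hw2; [|lra].
    replace (eps / (Series M + 1) * (Series M + 1)) with eps in Hw2 by (field; lra). nra.
Qed.

(** * Complex powers of positive reals *)

Lemma Cmod_Rcpow (x : R) (s : C) : Cmod (Rcpow x s) = Rpower x (Re s).
Proof.
  unfold Rcpow, Rpower. rewrite Cmod_Cexp. f_equal. unfold Re; simpl; ring.
Qed.

Lemma Rcpow_1 (x : R) : 0 < x -> Rcpow x 1 = RtoC x.
Proof.
  intros Hx. unfold Rcpow. replace (1 * RtoC (ln x))%C with (RtoC (ln x)) by ring.
  unfold Cexp. apply C_eq; unfold Re, Im; simpl; rewrite ?cos_0, ?sin_0, ?exp_ln by assumption; ring.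
Qed.

Lemma Rcpow_1_l (s : C) : Rcpow 1 s = 1%C.
Proof.
  unfold Rcpow. rewrite ln_1. replace (s * 0)%C with (RtoC 0) by ring. apply Cexp_0.
Qed.

Lemma Rcpow_mult_l (x y : R) (s : C) : 0 < x -> 0 < y -> Rcpow (x * y) s = (Rcpow x s * Rcpow y s)%C.
Proof.
  intros Hx Hy. unfold Rcpow. rewrite <- Cexp_plus, ln_mult, RtoC_plus by assumption. f_equal; ring.
Qed.

Lemma cderiv_Rcpow (x : R) (s : C) : cderiv (fun s => Rcpow x s) s (RtoC (ln x) * Rcpow x s)%C.
Proof.
  unfold Rcpow. apply (cderiv_comp Cexp (fun s => s * RtoC (ln x))%C).
  - apply cderiv_Cexp.
  - eapply cderiv_eq; [exact (cderiv_mult _ _ _ _ _ (cderiv_id s) (cderiv_const (RtoC (ln x)) s))|].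
    cbv beta; ring.
Qed.

(** * Cauchy's formula and Taylor coefficients *)

Definition cis (t : R) : C := (cos t, sin t).

Lemma Cmod_cis t : Cmod (cis t) = 1.
Proof.
  assert (H := Cmod_sqr (cis t)). unfold cis, Re, Im in H; simpl in H.
  assert (T := sin2_cos2 t). unfold Rsqr in T. assert (Q := Cmod_ge_0 (cis t)).
  unfold cis in *. nra.
Qed.

Lemma cpath_cis t : cpath cis t (Ci * cis t)%C.
Proof.
  split; unfold cis, Ci, Re, Im; simpl; auto_derive; trivial; ring.
Qed.

Lemma cont_cis t : continuous cis t.
Proof. apply (cpath_cont _ _ _ (cpath_cis t)). Qed.

Lemma cis_2PI : cis (2 * PI) = cis 0.
Proof. unfold cis. now rewrite cos_2PI, sin_2PI, cos_0, sin_0. Qed.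

Lemma PI2_pos : 0 <= 2 * PI.
Proof. generalize PI_RGT_0; lra. Qed.

Lemma circle_neq (p : C) (q : R) t : Cmod p < q -> (RtoC q * cis t - p <> 0)%C.
Proof.
  intros H E. apply Ceq_minus in E. rewrite <- E, Cmod_mult, Cmod_cis, Cmod_R in H.
  generalize (Rle_abs q); lra.
Qed.

Lemma circle_dist (p : C) (q : R) t : Cmod p < q -> Cmod (RtoC q * cis t - p) <= 2 * q.
Proof.
  intros H. eapply Rle_trans; [apply Cmod_triangle_minus|].
  rewrite Cmod_mult, Cmod_cis, Cmod_R, Rabs_pos_eq; [lra|].
  generalize (Cmod_ge_0 p); lra.
Qed.

(** The Cauchy form [dz / (z - p)] on the circle of radius [q], written in the angle and divided by
    [i dt]. *)
Definition ckernel (p : C) (q : R) (t : R) : C := (RtoC q * cis t / (RtoC q * cis t - p))%C.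

Lemma cont_circle {U : UniformSpace} (q : R) (f : U -> R) x :
  continuous f x -> continuous (fun y => RtoC q * cis (f y))%C x.
Proof.
  intros H. apply cont_Cmult; [apply continuous_const|].
  apply (continuous_comp f cis); [exact H | apply cont_cis].
Qed.

Lemma cont_ckernel p q t : Cmod p < q -> continuous (ckernel p q) t.
Proof.
  intros H. apply cont_Cdiv.
  - apply (cont_circle q (fun t => t)). apply continuous_id.
  - apply cont_Cminus; [|apply continuous_const].
    apply (cont_circle q (fun t => t)). apply continuous_id.
  - now apply circle_neq.
Qed.

(* The derivative in [l] of the integral is a total derivative in the angle. *)
Lemma circle_deform (f f' : C -> C) (p : C) (q l1 l2 r : R) :
  Cmod p < q -> 0 <= l1 <= l2 -> 0 < r ->
  (forall l t z, l1 <= l <= l2 -> Cmod (z - (p + RtoC l * (RtoC q * cis t - p))) < r ->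
     cderiv f z (f' z) /\ continuous f' z) ->
  CInt (fun t => f (p + RtoC l1 * (RtoC q * cis t - p)) * ckernel p q t)%C 0 (2 * PI) =
  CInt (fun t => f (p + RtoC l2 * (RtoC q * cis t - p)) * ckernel p q t)%C 0 (2 * PI).
Proof.
  intros Hp Hl Hr Hf.
  assert (P := Cmod_ge_0 p). assert (Hq : 0 < q) by lra.
  (* The deformation parameter is taken complex, so that differentiation under the integral and
     constancy along a segment apply to [J]. *)
  set (J := fun w : C => CInt (fun t => f (p + w * (RtoC q * cis t - p)) * ckernel p q t)%C 0 (2 * PI)).
  change (J (RtoC l1) = J (RtoC l2)). symmetry. apply cderiv_0_const.
  intros s Hs.
  set (l := l1 + s * (l2 - l1)).
  assert (Hl' : l1 <= l <= l2) by (unfold l; split; nra).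
  replace (RtoC l1 + RtoC s * (RtoC l2 - RtoC l1))%C with (RtoC l)
    by (unfold l; rewrite RtoC_plus, RtoC_mult, RtoC_minus; ring).
  (* The factor [RtoC q * cis t - p] produced by the chain rule cancels the denominator of
     [ckernel]. *)
  set (dF := fun (w : C) (t : R) => (f' (p + w * (RtoC q * cis t - p)) * (RtoC q * cis t))%C).
  assert (Hr2 : 0 < r / (2 * q)) by (apply Rdiv_lt_0_compat; lra).
  assert (Near : forall w t, Cmod (w - RtoC l) < r / (2 * q) ->
    Cmod ((p + w * (RtoC q * cis t - p)) - (p + RtoC l * (RtoC q * cis t - p))) < r).
  { intros w t Hw.
    replace ((p + w * (RtoC q * cis t - p)) - (p + RtoC l * (RtoC q * cis t - p)))%C
      with ((w - RtoC l) * (RtoC q * cis t - p))%C by ring.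
    rewrite Cmod_mult. assert (D := circle_dist p q t Hp).
    assert (Q := Cmod_ge_0 (w - RtoC l)).
    apply Rmult_lt_compat_r with (r := 2 * q) in Hw; [|lra].
    replace (r / (2 * q) * (2 * q)) with r in Hw by (field; lra).
    eapply Rle_lt_trans; [apply Rmult_le_compat_l; [assumption | exact D] | assumption]. }
  assert (Lc : forall t : R, Cmod (RtoC l - RtoC l) < r / (2 * q)).
  { intros _. replace (RtoC l - RtoC l)%C with (RtoC 0) by ring. now rewrite Cmod_0. }
  assert (Cl : cont_on (dF (RtoC l)) 0 (2 * PI)).
  { intros t _. unfold dF.
    assert (Cc : continuous (fun t => RtoC q * cis t)%C t) by (apply (cont_circle q (fun t => t)); apply continuous_id).
    apply cont_Cmult; [|exact Cc].
    apply (continuous_comp (fun t => p + RtoC l * (RtoC q * cis t - p))%C f').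
    - apply cont_Cplus; [apply continuous_const|]. apply cont_Cmult; [apply continuous_const|].
      apply cont_Cminus; [exact Cc | apply continuous_const].
    - apply (Hf l t); [assumption|]. apply Near. now apply Lc. }
  apply cderiv_eq with (CInt (dF (RtoC l)) 0 (2 * PI)).
  - apply (cderiv_CInt (fun w t => f (p + w * (RtoC q * cis t - p)) * ckernel p q t)%C dF
      0 (2 * PI) (RtoC l) (r / (2 * q)) PI2_pos Hr2).
    + intros w t Hw _. destruct (Hf l t _ Hl' (Near w t Hw)) as [Hd _].
      eapply cderiv_eq.
      * apply cderiv_mult; [|apply cderiv_const].
        apply (cderiv_comp f (fun w => p + w * (RtoC q * cis t - p))%C); [exact Hd|].
        apply cderiv_plus; [apply cderiv_const|].
        apply cderiv_mult; [apply cderiv_id | apply cderiv_const].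
      * cbv beta. unfold dF, ckernel. field. now apply circle_neq.
    + intros w Hw t _. apply cont_Cmult; [|now apply cont_ckernel].
      destruct (Hf l t _ Hl' (Near w t Hw)) as [Hd _].
      apply (continuous_comp (fun t => p + w * (RtoC q * cis t - p))%C f).
      * apply cont_Cplus; [apply continuous_const|]. apply cont_Cmult; [apply continuous_const|].
        apply cont_Cminus; [apply (cont_circle q (fun t => t)); apply continuous_id | apply continuous_const].
      * exact (cderiv_cont _ _ _ Hd).
    + intros t _. unfold dF.
      assert (Cc : continuous (fun x : C * R => RtoC q * cis (snd x))%C (RtoC l, t)).
      { apply (cont_circle q (fun x : C * R => snd x)). apply continuous_snd. }
      apply cont_Cmult; [|exact Cc].
      apply (continuous_comp (fun x : C * R => p + fst x * (RtoC q * cis (snd x) - p))%C f').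
      * apply cont_Cplus; [apply continuous_const|].
        apply cont_Cmult; [apply continuous_fst|].
        apply cont_Cminus; [exact Cc | apply continuous_const].
      * apply (Hf l t); [assumption|]. apply Near. now apply Lc.
  (* For nonzero [l], [dF] is [1 / (l * Ci)] times the angular derivative of [f] along the curve,
     which integrates to 0 by periodicity. For [l = 0] this division is impossible, but then [f'] is
     taken at the fixed point [p] and only [cis] is integrated. *)
  - destruct (Req_dec l 0) as [Z|Z].
    + rewrite (CInt_ext _ (fun t => (f' p * RtoC q / Ci) * (Ci * cis t))%C).
      * rewrite CInt_scal.
        -- rewrite (CInt_FTC cis); [| apply PI2_pos | intros; apply cpath_cis |].
           ++ rewrite cis_2PI. ring.
           ++ intros t _. apply cont_Cmult; [apply continuous_const | apply cont_cis].
        -- apply PI2_pos.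
        -- intros t _. apply cont_Cmult; [apply continuous_const | apply cont_cis].
      * apply PI2_pos.
      * intros t _. unfold dF. rewrite Z.
        replace (p + 0 * (RtoC q * cis t - p))%C with p by ring. field. apply Ci_nz.
    + assert (Zc : RtoC l <> 0%C) by (intros E; apply Z; injection E; auto).
      rewrite (CInt_ext _ (fun t => / (RtoC l * Ci) * (RtoC l * Ci * dF (RtoC l) t))%C).
      * assert (Cm : cont_on (fun t => RtoC l * Ci * dF (RtoC l) t)%C 0 (2 * PI)) by now apply cont_on_scal.
        rewrite CInt_scal; [| apply PI2_pos | exact Cm].
        rewrite (CInt_FTC (fun t => f (p + RtoC l * (RtoC q * cis t - p))%C) _ _ _ PI2_pos).
        -- rewrite cis_2PI. ring.
        -- intros t _.
           assert (G : cpath (fun t => p + RtoC l * (RtoC q * cis t - p))%C t (RtoC l * RtoC q * (Ci * cis t))%C).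
           { assert (Haff : cderiv (fun z => p + RtoC l * (RtoC q * z - p))%C (cis t) (RtoC l * RtoC q)%C).
             { eapply cderiv_eq.
               - apply cderiv_plus; [apply cderiv_const|]. apply cderiv_scal.
                 apply cderiv_minus; [|apply cderiv_const]. apply cderiv_scal. apply cderiv_id.
               - ring. }
             assert (K := cpath_comp _ _ _ _ _ Haff (cpath_cis t)).
             replace (RtoC l * RtoC q * (Ci * cis t))%C with (Ci * cis t * (RtoC l * RtoC q))%C by ring.
             exact K. }
           destruct (Hf l t _ Hl' (Near (RtoC l) t (Lc t))) as [Hd _].
           assert (K := cpath_comp _ _ _ _ _ Hd G).
           unfold dF.
           replace (RtoC l * Ci * (f' (p + RtoC l * (RtoC q * cis t - p)) * (RtoC q * cis t)))%C with
             (RtoC l * RtoC q * (Ci * cis t) * f' (p + RtoC l * (RtoC q * cis t - p)))%C by ring.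
           exact K.
        -- exact Cm.
      * apply PI2_pos.
      * intros t _. field. split; [apply Ci_nz | exact Zc].
Qed.

Lemma Cmod_circle q t : 0 <= q -> Cmod (RtoC q * cis t) = q.
Proof. intros. rewrite Cmod_mult, Cmod_cis, Cmod_R, Rabs_pos_eq; lra. Qed.

Lemma ckernel_0 q t : 0 < q -> ckernel 0 q t = 1%C.
Proof.
  intros Hq. unfold ckernel.
  assert (N := circle_neq 0 q t). rewrite Cmod_0 in N. specialize (N Hq).
  replace (RtoC q * cis t - 0)%C with (RtoC q * cis t)%C in * by ring.
  now apply Cinv_r.
Qed.

(** The case [p = 0] of the deformation, where the kernel is 1. Only an annulus enters, so [f] may
    be singular inside, as happens for the integrands [g z / z ^ k]. *)
Lemma circle_indep (f f' : C -> C) (r1 r2 m R0 : R) :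
  0 <= m < r1 -> r1 <= r2 < R0 ->
  (forall z, m < Cmod z < R0 -> cderiv f z (f' z) /\ continuous f' z) ->
  CInt (fun t => f (RtoC r1 * cis t)%C) 0 (2 * PI) = CInt (fun t => f (RtoC r2 * cis t)%C) 0 (2 * PI).
Proof.
  intros Hr1 Hr2 Hf.
  assert (H := circle_deform f f' 0 r1 1 (r2 / r1) (Rmin (r1 - m) (R0 - r2))).
  assert (L : 1 <= r2 / r1).
  { apply Rmult_le_reg_r with r1; [lra|]. replace (r2 / r1 * r1) with r2 by (field; lra). lra. }
  rewrite Cmod_0 in H. specialize (H ltac:(lra) ltac:(lra)).
  assert (P : 0 < Rmin (r1 - m) (R0 - r2)) by (apply Rmin_pos; lra).
  specialize (H P).
  rewrite (CInt_ext (fun t => f (RtoC r1 * cis t)%C) (fun t => f (0 + 1 * (RtoC r1 * cis t - 0)) * ckernel 0 r1 t)%C).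
  - rewrite H.
    + apply CInt_ext; [apply PI2_pos|]. intros t _. rewrite ckernel_0 by lra.
      rewrite Cmult_1_r. f_equal. rewrite RtoC_div by lra. field.
      intros E; injection E; lra.
    + intros l t z Hl Hz. apply Hf.
      assert (M1 := Rmin_l (r1 - m) (R0 - r2)). assert (M2 := Rmin_r (r1 - m) (R0 - r2)).
      replace (0 + RtoC l * (RtoC r1 * cis t - 0))%C with (RtoC (l * r1) * cis t)%C in Hz by (rewrite RtoC_mult; ring).
      assert (Q : Cmod (RtoC (l * r1) * cis t) = l * r1) by (apply Cmod_circle; nra).
      assert (T1 := Cmod_triangle_rev z (RtoC (l * r1) * cis t)).
      assert (T2 := Cmod_triangle_rev (RtoC (l * r1) * cis t) z).
      rewrite Cmod_minus_sym in T2. rewrite Q in *.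
      assert (B1 : r1 <= l * r1) by nra.
      assert (B2 : l * r1 <= r2).
      { destruct Hl as [_ Hl]. apply Rmult_le_compat_r with (r := r1) in Hl; [|lra].
        replace (r2 / r1 * r1) with r2 in Hl by (field; lra). exact Hl. }
      lra.
  - apply PI2_pos.
  - intros t _. rewrite ckernel_0 by lra. rewrite Cmult_1_r. f_equal. ring.
Qed.

(* The integral does not depend on the radius, and the kernel tends to 1 as the radius grows. *)
Lemma CInt_ckernel (p : C) (q : R) : Cmod p < q ->
  CInt (ckernel p q) 0 (2 * PI) = RtoC (2 * PI).
Proof.
  intros Hp. assert (P := Cmod_ge_0 p).
  apply Ceq_minus, Cmod_eq_0. apply Rle_antisym; [|apply Cmod_ge_0].
  apply Rle_of_eps. intros eps He.
  set (f := fun z : C => (z / (z - p))%C).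
  (* On the circle of radius [L] the kernel differs from 1 by at most [Cmod p / (L - Cmod p)]; this
     radius makes the integral of the difference at most [eps]. *)
  set (L := q + 2 * PI * (Cmod p + 1) / eps).
  assert (PP := PI_RGT_0).
  assert (PL : 0 < 2 * PI * (Cmod p + 1) / eps).
  { apply Rdiv_lt_0_compat; [|assumption]. apply Rmult_lt_0_compat; lra. }
  assert (HpL : Cmod p < L) by (unfold L; lra).
  change (ckernel p q) with (fun t => f (RtoC q * cis t)%C).
  rewrite (circle_indep f (fun z => 1 * / (z - p) + z * ((1 - 0) * - / ((z - p) * (z - p))))%C
             q L (Cmod p) (L + 1)); [| lra | unfold L; lra |].
  - assert (CL : cont_on (fun t => f (RtoC L * cis t)%C) 0 (2 * PI)) by (intros t _; now apply (cont_ckernel p L)).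
    assert (E : (CInt (fun t => f (RtoC L * cis t)) 0 (2 * PI) - RtoC (2 * PI))%C =
      CInt (fun t => f (RtoC L * cis t) - 1)%C 0 (2 * PI)).
    { rewrite (CInt_minus _ (fun _ => 1%C)); [| apply PI2_pos | exact CL | intros t _; apply continuous_const].
      rewrite CInt_const. rewrite Rminus_0_r. ring. }
    rewrite E.
    eapply Rle_trans.
    + apply (CInt_norm_const _ (Cmod p / (L - Cmod p))); [apply PI2_pos | |].
      * intros t Ht. apply cont_Cminus; [now apply CL | apply continuous_const].
      * intros t _. unfold f.
        assert (N := circle_neq p L t HpL).
        replace (RtoC L * cis t / (RtoC L * cis t - p) - 1)%C with (p / (RtoC L * cis t - p))%C by (field; exact N).
        rewrite Cmod_div by exact N. apply Rmult_le_compat_l; [assumption|].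
        apply Rinv_le_contravar; [lra|].
        generalize (Cmod_triangle_rev (RtoC L * cis t) p). rewrite Cmod_circle; lra.
    + rewrite Rminus_0_r, Rplus_0_l.
      apply Rmult_le_reg_r with (L - Cmod p); [lra|].
      replace (2 * PI * (Cmod p / (L - Cmod p)) * (L - Cmod p)) with (2 * PI * Cmod p) by (field; lra).
      apply Rle_trans with (eps * (2 * PI * (Cmod p + 1) / eps)).
      * replace (eps * (2 * PI * (Cmod p + 1) / eps)) with (2 * PI * (Cmod p + 1)) by (field; lra). nra.
      * apply Rmult_le_compat_l; [lra|]. unfold L; lra.
  - intros z Hz.
    assert (N : (z - p <> 0)%C).
    { intros E. apply Ceq_minus in E. rewrite E in Hz. lra. }
    assert (Hz' : cderiv (fun z => z - p)%C z (1 - 0)%C)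
      by (apply cderiv_minus; [apply cderiv_id | apply cderiv_const]).
    split.
    + apply (cderiv_mult (fun z => z) (fun z => / (z - p))%C); [apply cderiv_id|].
      exact (cderiv_inv (fun z => z - p)%C z _ N Hz').
    + assert (Cz : continuous (fun z : C => z - p)%C z).
      { apply cont_Cminus; [apply continuous_id | apply continuous_const]. }
      apply cont_Cplus.
      * apply cont_Cmult; [apply continuous_const|]. now apply (cont_Cinv (fun z : C => z - p)%C).
      * apply cont_Cmult; [apply continuous_id|]. apply cont_Cmult; [apply continuous_const|].
        apply cont_Copp. apply (cont_Cinv (fun z : C => (z - p) * (z - p))%C).
        -- now apply cont_Cmult.
        -- now apply Cmult_neq_0.
Qed.

(** The circle is contracted to the point [w]: at parameter 0 the integrand is the constant [f w]
    times the kernel, whose integral is known. *)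
Lemma cauchy_formula (f f' : C -> C) (w : C) (r R0 : R) :
  Cmod w < r < R0 ->
  (forall z, Cmod z < R0 -> cderiv f z (f' z) /\ continuous f' z) ->
  CInt (fun t => f (RtoC r * cis t) * ckernel w r t)%C 0 (2 * PI) = (RtoC (2 * PI) * f w)%C.
Proof.
  intros Hr Hf. assert (P := Cmod_ge_0 w).
  assert (H := circle_deform f f' w r 0 1 (R0 - r) ltac:(lra) ltac:(lra) ltac:(lra)).
  rewrite (CInt_ext _ (fun t => f (w + 1 * (RtoC r * cis t - w)) * ckernel w r t)%C).
  - rewrite <- H.
    + rewrite (CInt_ext _ (fun t => f w * ckernel w r t)%C).
      * rewrite CInt_scal; [| apply PI2_pos | intros t _; now apply cont_ckernel].
        rewrite CInt_ckernel by lra. ring.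
      * apply PI2_pos.
      * intros t _. do 2 f_equal. ring.
    + intros l t z Hl Hz. apply Hf.
      assert (T := Cmod_triangle_rev z (w + RtoC l * (RtoC r * cis t - w))).
      assert (T2 : Cmod (w + RtoC l * (RtoC r * cis t - w)) <= r).
      { replace (w + RtoC l * (RtoC r * cis t - w))%C with
          (RtoC (1 - l) * w + RtoC l * (RtoC r * cis t))%C by (rewrite RtoC_minus; ring).
        eapply Rle_trans; [apply Cmod_triangle|].
        rewrite Cmod_mult, (Cmod_mult (RtoC l)), Cmod_circle, !Cmod_R, !Rabs_pos_eq by lra. nra. }
      lra.
  - apply PI2_pos.
  - intros t _. do 2 f_equal. ring.
Qed.

Lemma circle_mean (f f' : C -> C) (r R0 : R) :
  0 < r < R0 ->
  (forall z, Cmod z < R0 -> cderiv f z (f' z) /\ continuous f' z) ->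
  CInt (fun t => f (RtoC r * cis t)%C) 0 (2 * PI) = (RtoC (2 * PI) * f 0)%C.
Proof.
  intros Hr Hf. rewrite <- (cauchy_formula f f' 0 r R0); [| rewrite Cmod_0; lra | assumption].
  apply CInt_ext; [apply PI2_pos|]. intros t _. rewrite ckernel_0 by lra. ring.
Qed.

Lemma CInt_conj f a b : a <= b -> cont_on f a b -> CInt (fun t => Cconj (f t)) a b = Cconj (CInt f a b).
Proof.
  intros Hab Hf. apply C_eq; [reflexivity|].
  exact (RInt_opp (fun t => Im (f t)) a b (cont_on_Im f a b Hab Hf)).
Qed.

Lemma cont_Cconj {U : UniformSpace} (f : U -> C) x : continuous f x -> continuous (fun y => Cconj (f y)) x.
Proof.
  intros H. apply cont_C_intro.
  - exact (cont_Re f x H).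
  - apply (continuous_opp (fun y => Im (f y))). now apply cont_Im.
Qed.

(** * Taylor coefficients: Borel-Caratheodory and a three circles estimate *)

Section Coefficients.
Variables (g g' : C -> C) (R0 : R).
Hypothesis g_hol : forall z, Cmod z < R0 -> cderiv g z (g' z) /\ continuous g' z.
Hypothesis g_0 : g 0 = 0%C.

(** For a radius between 0 and [R0] this is [2 * PI] times the [k]-th Taylor coefficient of [g] at
    0. *)
Definition ccoef (k : nat) (r : R) : C :=
  CInt (fun t => g (RtoC r * cis t) * / (RtoC r * cis t) ^ k)%C 0 (2 * PI).

Lemma cont_g_circle r t : 0 < r < R0 -> continuous (fun t => g (RtoC r * cis t)%C) t.
Proof.
  intros Hr. apply (continuous_comp (fun t => RtoC r * cis t)%C g).
  - apply (cont_circle r (fun t => t)); apply continuous_id.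
  - apply (cderiv_cont g _ (g' (RtoC r * cis t)%C)). apply g_hol. rewrite Cmod_circle; lra.
Qed.

Lemma circle_pow_neq r t k : 0 < r -> ((RtoC r * cis t) ^ k <> 0)%C.
Proof.
  intros Hr. apply Cpow_nz. intros E. assert (H := Cmod_circle r t ltac:(lra)).
  rewrite E, Cmod_0 in H. lra.
Qed.

Lemma cont_circle_pow r t k : continuous (fun t => (RtoC r * cis t) ^ k)%C t.
Proof. apply cont_Cpow. apply (cont_circle r (fun t => t)); apply continuous_id. Qed.

Lemma cont_circle_pow_inv r t k : 0 < r -> continuous (fun t => / (RtoC r * cis t) ^ k)%C t.
Proof.
  intros Hr. apply (cont_Cinv (fun t => (RtoC r * cis t) ^ k)%C);
  [apply cont_circle_pow | now apply circle_pow_neq].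
Qed.

(** Lets one and the same coefficient be estimated on the small or on the large circle. *)
Lemma ccoef_indep k r1 r2 : 0 < r1 <= r2 -> r2 < R0 -> ccoef k r1 = ccoef k r2.
Proof.
  intros H1 H2. unfold ccoef.
  set (dz := fun z : C => (RtoC (INR k) * z ^ pred k * 1)%C).
  apply (circle_indep (fun z => g z * / z ^ k)%C
    (fun z => g' z * / z ^ k + g z * (dz z * - / (z ^ k * z ^ k)))%C r1 r2 0 R0); [lra | lra |].
  intros z Hz.
  assert (Nz : z <> 0%C) by (intros ->; rewrite Cmod_0 in Hz; lra).
  assert (Nk : (z ^ k <> 0)%C) by now apply Cpow_nz.
  destruct (g_hol z) as [Hd Hc]; [lra|]. split.
  - apply (cderiv_mult g (fun z => / z ^ k)%C); [assumption|].
    exact (cderiv_inv (fun z => z ^ k)%C z (dz z) Nk (cderiv_pow (fun z => z) z _ k (cderiv_id z))).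
  - assert (Cz : forall j, continuous (fun z : C => z ^ j)%C z).
    { intros j. apply cont_Cpow. apply continuous_id. }
    apply cont_Cplus.
    + apply cont_Cmult; [assumption|]. now apply (cont_Cinv (fun z : C => z ^ k)%C).
    + apply cont_Cmult; [exact (cderiv_cont _ _ _ Hd)|].
      apply cont_Cmult.
      * apply cont_Cmult; [|apply continuous_const]. apply cont_Cmult; [apply continuous_const | apply Cz].
      * apply cont_Copp. apply (cont_Cinv (fun z : C => z ^ k * z ^ k)%C).
        -- apply cont_Cmult; apply Cz.
        -- now apply Cmult_neq_0.
Qed.

(** On a circle about 0 reciprocals are scaled conjugates, so integrals against negative powers
    become conjugates of mean values of holomorphic functions. *)
Lemma Cinv_circle_pow r t k : 0 < r ->
  (/ (RtoC r * cis t) ^ k = RtoC (/ (r ^ k * r ^ k)) * Cconj ((RtoC r * cis t) ^ k))%C.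
Proof.
  intros Hr. set (u := ((RtoC r * cis t) ^ k)%C).
  assert (Nu : (u <> 0)%C) by now apply circle_pow_neq.
  assert (M : Cmod u = r ^ k) by (unfold u; rewrite Cmod_pow, Cmod_circle; lra).
  assert (Prk : r ^ k <> 0) by (apply pow_nonzero; lra).
  assert (K := Cmod2_conj u). rewrite M in K.
  replace (r ^ k * r ^ k) with ((r ^ k) ^ 2) by ring.
  rewrite RtoC_inv, K by (apply pow_nonzero; assumption).
  field. split; [|exact Nu]. intros E. apply Nu. rewrite <- (Cconj_conj u), E. apply C_eq; simpl; unfold Re, Im; simpl; ring.
Qed.

(* Borel-Caratheodory: only the real part of [g] enters, because the coefficients of
   the conjugate of [g] against negative powers vanish. *)
Lemma ccoef_bound (A r : R) (k : nat) : 0 < r < R0 -> 0 <= A ->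
  (forall t, Re (g (RtoC r * cis t)%C) <= A) ->
  Cmod (ccoef k r) <= 4 * PI * A / r ^ k.
Proof.
  intros Hr HA Hg. assert (PP := PI_RGT_0).
  assert (Prk : 0 < r ^ k) by (apply pow_lt; lra).
  assert (Cg : forall t, continuous (fun t => g (RtoC r * cis t)%C) t) by (intros; now apply cont_g_circle).
  assert (G0 : CInt (fun t => g (RtoC r * cis t)%C) 0 (2 * PI) = 0%C).
  { rewrite (circle_mean g g' r R0 Hr g_hol), g_0. ring. }
  (* The coefficient of index 0 is [2 * PI * g 0 = 0]; the vanishing integrals [U0] and [V0] below
     require a positive index. *)
  destruct k as [|k].
  { unfold ccoef. rewrite (CInt_ext _ (fun t => g (RtoC r * cis t)%C)); [| apply PI2_pos | intros; simpl; field; apply C1_nz].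
    rewrite G0, Cmod_0. simpl. unfold Rdiv. rewrite Rinv_1. nra. }
  set (u := fun t => ((RtoC r * cis t) ^ S k)%C).
  assert (Cu : forall t, continuous u t) by (intros t; apply cont_circle_pow).
  assert (Cui : forall t, continuous (fun t => / u t)%C t) by (intros t; apply cont_circle_pow_inv; lra).
  set (c := / (r ^ S k * r ^ S k)).
  assert (U0 : CInt (fun t => / u t)%C 0 (2 * PI) = 0%C).
  { rewrite (CInt_ext _ (fun t => RtoC c * Cconj (u t))%C); [| apply PI2_pos | intros t _; apply Cinv_circle_pow; lra].
    rewrite CInt_scal; [| apply PI2_pos | intros t _; now apply cont_Cconj].
    rewrite CInt_conj; [| apply PI2_pos | intros t _; apply Cu].
    unfold u. rewrite (circle_mean (fun z => z ^ S k)%C (fun z => RtoC (INR (S k)) * z ^ pred (S k) * 1)%C r R0 Hr).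
    - simpl (0 ^ S k)%C. apply C_eq; unfold Re, Im; simpl; ring.
    - intros z _. split; [apply (cderiv_pow (fun z => z)); apply cderiv_id|].
      apply cont_Cmult; [|apply continuous_const]. apply cont_Cmult; [apply continuous_const|].
      apply cont_Cpow; apply continuous_id. }
  assert (V0 : CInt (fun t => Cconj (g (RtoC r * cis t)) * / u t)%C 0 (2 * PI) = 0%C).
  { rewrite (CInt_ext _ (fun t => RtoC c * Cconj (g (RtoC r * cis t) * u t))%C); [| apply PI2_pos |].
    - rewrite CInt_scal; [| apply PI2_pos | intros t _; apply cont_Cconj; now apply cont_Cmult].
      rewrite CInt_conj; [| apply PI2_pos | intros t _; now apply cont_Cmult].
      unfold u. rewrite (circle_mean (fun z => g z * z ^ S k)%C
        (fun z => g' z * z ^ S k + g z * (RtoC (INR (S k)) * z ^ pred (S k) * 1))%C r R0 Hr).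
      + rewrite g_0. apply C_eq; unfold Re, Im; simpl; ring.
      + intros z Hz. destruct (g_hol z Hz) as [Hd Hc]. split.
        * apply (cderiv_mult g (fun z => z ^ S k)%C); [assumption|]. apply (cderiv_pow (fun z => z)); apply cderiv_id.
        * apply cont_Cplus.
          -- apply cont_Cmult; [assumption|]. apply cont_Cpow; apply continuous_id.
          -- apply cont_Cmult; [exact (cderiv_cont _ _ _ Hd)|].
             apply cont_Cmult; [|apply continuous_const]. apply cont_Cmult; [apply continuous_const|].
             apply cont_Cpow; apply continuous_id.
    - intros t _. unfold u. rewrite Cinv_circle_pow by lra. fold c. rewrite Cmult_conj. ring. }
  (* [A - Re g] is nonnegative on the circle, so it is its own modulus, and its integral is
     [2 * PI * A] because [g 0 = 0]. *)
  set (h := fun t => (RtoC (A - Re (g (RtoC r * cis t))) * / u t)%C).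
  assert (Ch : cont_on h 0 (2 * PI)).
  { intros t _. apply cont_Cmult; [|apply Cui]. apply cont_RtoC.
    apply cont_Rminus; [apply continuous_const|]. apply cont_Re. apply Cg. }
  (* By [V0] the function [g] may be replaced by [g + Cconj g], that is by [2 Re g]; by [U0]
     constants may be subtracted, which leaves [- 2 (A - Re g)]. *)
  assert (E : ccoef (S k) r = (- 2 * CInt h 0 (2 * PI))%C).
  { rewrite <- CInt_scal; [| apply PI2_pos | exact Ch].
    rewrite (CInt_ext _ (fun t => (g (RtoC r * cis t) * / u t + Cconj (g (RtoC r * cis t)) * / u t) + (- 2 * RtoC A) * / u t)%C);
      [| apply PI2_pos |].
    - rewrite CInt_plus; [| apply PI2_pos | |].
      + rewrite CInt_plus; [| apply PI2_pos | |].
        * rewrite V0, CInt_scal, U0; [| apply PI2_pos | intros t _; apply Cui].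
          change (ccoef (S k) r) with (CInt (fun t => g (RtoC r * cis t) * / u t)%C 0 (2 * PI)). ring.
        * intros t _. apply cont_Cmult; [apply Cg | apply Cui].
        * intros t _. apply cont_Cmult; [apply cont_Cconj, Cg | apply Cui].
      + intros t _. apply cont_Cplus; (apply cont_Cmult; [|apply Cui]); [apply Cg | apply cont_Cconj, Cg].
      + intros t _. apply cont_Cmult; [apply continuous_const | apply Cui].
    - intros t _. unfold h. rewrite RtoC_minus, re_alt. field.
      unfold u. apply circle_pow_neq; lra. }
  rewrite E, Cmod_mult, Cmod_R, (Rabs_left (- 2)) by lra.
  replace (- -2) with 2 by ring.
  replace (4 * PI * A / r ^ S k) with (2 * (2 * PI * A / r ^ S k)) by (field; lra).
  apply Rmult_le_compat_l; [lra|].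
  assert (ER : ex_RInt (fun t => Re (g (RtoC r * cis t)%C)) 0 (2 * PI)).
  { apply (cont_on_Re (fun t => g (RtoC r * cis t)%C)); [apply PI2_pos | intros t _; apply Cg]. }
  assert (EA : ex_RInt (fun t => A - Re (g (RtoC r * cis t)%C)) 0 (2 * PI)).
  { apply (ex_RInt_minus (fun _ => A)); [apply ex_RInt_const | exact ER]. }
  eapply Rle_trans.
  - apply (CInt_norm_le h (fun t => / r ^ S k * (A - Re (g (RtoC r * cis t)%C)))); [apply PI2_pos | exact Ch | |].
    + exact (ex_RInt_scal _ _ _ _ EA).
    + intros t _. unfold h, u. rewrite Cmod_mult, Cmod_inv by (apply circle_pow_neq; lra).
      rewrite Cmod_pow, Cmod_circle, Cmod_R, Rabs_pos_eq by (try lra; specialize (Hg t); lra). lra.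
  - assert (S1 : RInt (fun t => / r ^ S k * (A - Re (g (RtoC r * cis t)%C))) 0 (2 * PI)
      = / r ^ S k * RInt (fun t => A - Re (g (RtoC r * cis t)%C)) 0 (2 * PI)) by exact (RInt_scal _ _ _ _ EA).
    rewrite S1.
    assert (S2 : RInt (fun t => A - Re (g (RtoC r * cis t)%C)) 0 (2 * PI) =
      RInt (fun _ => A) 0 (2 * PI) - RInt (fun t => Re (g (RtoC r * cis t)%C)) 0 (2 * PI))
      by exact (RInt_minus (fun _ => A) _ _ _ (ex_RInt_const _ _ _) ER).
    assert (S3 : RInt (fun _ : R => A) 0 (2 * PI) = 2 * PI * A).
    { rewrite RInt_const. unfold scal; simpl; unfold mult; simpl. ring. }
    rewrite S2, S3.
    apply (f_equal Re) in G0. unfold CInt, Re in G0; simpl in G0. unfold Re in *. rewrite G0.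
    right. field. lra.
Qed.

(** For [z] on the circle the kernel is [1 / (1 - w / z)]; removing [N] terms of its geometric
    series leaves [(w / z) ^ N] times the kernel, which gives the remainder integrand [rem N]. *)
Lemma cauchy_taylor (w : C) (r M : R) (N : nat) : Cmod w < r < R0 ->
  (forall t, 0 <= t <= 2 * PI -> Cmod (g (RtoC r * cis t)%C) <= M) ->
  Cmod (RtoC (2 * PI) * g w - csum (fun k => w ^ k * ccoef k r)%C N) <=
  2 * PI * (M * ((Cmod w / r) ^ N * (r / (r - Cmod w)))).
Proof.
  intros Hr HM. assert (P := Cmod_ge_0 w).
  assert (Nz : forall t, (RtoC r * cis t <> 0)%C).
  { intros t E. assert (H := Cmod_circle r t ltac:(lra)). rewrite E, Cmod_0 in H. lra. }
  assert (Hr' : 0 < r < R0) by lra.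
  set (rem := fun n t => (g (RtoC r * cis t) * ((w / (RtoC r * cis t)) ^ n * ckernel w r t))%C).
  assert (Cw : forall n t, continuous (fun t => (w / (RtoC r * cis t)) ^ n)%C t).
  { intros n t. apply cont_Cpow. apply cont_Cdiv; [apply continuous_const | | apply Nz].
    apply (cont_circle r (fun t => t)); apply continuous_id. }
  assert (Cr : forall n, cont_on (rem n) 0 (2 * PI)).
  { intros n t _. apply cont_Cmult; [now apply cont_g_circle|]. apply cont_Cmult; [apply Cw|].
    apply cont_ckernel; lra. }
  assert (E : (RtoC (2 * PI) * g w - csum (fun k => w ^ k * ccoef k r)%C N)%C = CInt (rem N) 0 (2 * PI)).
  { induction N as [|n IH].
    - rewrite <- (cauchy_formula g g' w r R0 Hr g_hol). simpl csum.
      replace (CInt (fun t => g (RtoC r * cis t) * ckernel w r t)%C 0 (2 * PI) - 0)%C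
        with (CInt (fun t => g (RtoC r * cis t) * ckernel w r t)%C 0 (2 * PI)) by ring.
      apply CInt_ext; [apply PI2_pos|]. intros t _. unfold rem; simpl; ring.
    - simpl csum.
      replace (RtoC (2 * PI) * g w - (csum (fun k => w ^ k * ccoef k r)%C n + w ^ n * ccoef n r))%C with
        ((RtoC (2 * PI) * g w - csum (fun k => w ^ k * ccoef k r)%C n) - w ^ n * ccoef n r)%C by ring.
      rewrite IH. unfold ccoef.
      assert (Cc : cont_on (fun t => g (RtoC r * cis t) * / (RtoC r * cis t) ^ n)%C 0 (2 * PI)).
      { intros t _. apply cont_Cmult; [now apply cont_g_circle | apply cont_circle_pow_inv; lra]. }
      rewrite <- CInt_scal; [| apply PI2_pos | exact Cc].
      rewrite <- CInt_minus; [| apply PI2_pos | apply Cr | now apply cont_on_scal].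
      apply CInt_ext; [apply PI2_pos|]. intros t _. unfold rem, ckernel.
      assert (Nw := circle_neq w r t ltac:(lra)).
      assert (Np := circle_pow_neq r t n ltac:(lra)).
      specialize (Nz t).
      generalize dependent (g (RtoC r * cis t)%C). generalize dependent (RtoC r * cis t)%C.
      intros z Nz' Nw Np gz. unfold Cdiv. rewrite !Cpow_mult_l, !Cpow_inv by exact Nz'.
      rewrite !Cpow_S. field. repeat split; assumption. }
  rewrite E.
  eapply Rle_trans.
  - apply (CInt_norm_const _ (M * ((Cmod w / r) ^ N * (r / (r - Cmod w))))); [apply PI2_pos | apply Cr |].
    intros t Ht. unfold rem. rewrite !Cmod_mult, Cmod_pow, Cmod_div by apply Nz.
    rewrite Cmod_circle by lra.
    assert (Q1 : 0 <= Cmod w / r) by (apply Rdiv_le_0_compat; lra).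
    assert (Q2 : 0 <= (Cmod w / r) ^ N) by now apply pow_le.
    apply Rmult_le_compat; [apply Cmod_ge_0 | apply Rmult_le_pos; [assumption | apply Cmod_ge_0] | now apply HM |].
    apply Rmult_le_compat_l; [assumption|].
    unfold ckernel. rewrite Cmod_div by (apply circle_neq; lra). rewrite Cmod_circle by lra.
    apply Rmult_le_compat_l; [lra|]. apply Rinv_le_contravar; [lra|].
    generalize (Cmod_triangle_rev (RtoC r * cis t) w). rewrite Cmod_circle; lra.
  - right; ring.
Qed.

Lemma pow_le_1_lim (q : R) (M : R) : 0 <= q < 1 -> forall eps, 0 < eps -> exists N, forall n, (N <= n)%nat -> M * q ^ n < eps.
Proof.
  intros Hq eps He.
  destruct (pow_lt_1_zero q) with (y := eps / (Rabs M + 1)) as [N HN].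
  - rewrite Rabs_pos_eq; lra.
  - apply Rdiv_lt_0_compat; [lra|]. generalize (Rabs_pos M); lra.
  - exists N. intros n Hn. specialize (HN n Hn).
    assert (Q : 0 <= q ^ n) by (apply pow_le; lra). rewrite Rabs_pos_eq in HN by assumption.
    assert (PM := Rabs_pos M). assert (LM := Rle_abs M).
    apply Rmult_lt_compat_l with (r := Rabs M + 1) in HN; [|lra].
    replace ((Rabs M + 1) * (eps / (Rabs M + 1))) with eps in HN by (field; lra). nra.
Qed.

(** Plays the part of Hadamard's three circles theorem. The first [K] coefficients see only [A1], at
    the price of powers of [rho / r1]; the others see [A2], but with the factor [(rho / r2) ^ K]. In
    the application [A2] grows like a logarithm while [A1] is constant, so a fixed large [K] is
    affordable. *)
Lemma three_circles (A1 A2 r1 r2 rho : R) (K : nat) (w : C) :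
  0 < r1 <= r2 -> rho < r2 < R0 -> Cmod w <= rho -> 0 <= A1 -> 0 <= A2 ->
  (forall t, Re (g (RtoC r1 * cis t)%C) <= A1) ->
  (forall t, Re (g (RtoC r2 * cis t)%C) <= A2) ->
  Cmod (g w) <= 2 * A1 * rsum (fun k => (rho / r1) ^ k) K + 2 * A2 * ((rho / r2) ^ K / (1 - rho / r2)).
Proof.
  intros Hr1 Hr2 Hw HA1 HA2 H1 H2. assert (P := Cmod_ge_0 w). assert (PP := PI_RGT_0).
  assert (Hc : forall t, 0 <= t <= 2 * PI -> continuity_pt (fun t => Cmod (g (RtoC r2 * cis t)%C)) t).
  { intros t _. apply continuity_pt_filterlim. apply (cont_Cmod (fun t => g (RtoC r2 * cis t)%C)). apply cont_g_circle; lra. }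
  destruct (continuity_ab_maj _ 0 (2 * PI) PI2_pos Hc) as (tm & HM & _).
  (* [M] only controls the Taylor remainder and disappears as the number of terms grows. *)
  set (M := Cmod (g (RtoC r2 * cis tm)%C)) in *.
  set (q := rho / r2).
  assert (Hq : 0 <= q < 1).
  { unfold q. split; [apply Rdiv_le_0_compat; lra|].
    apply Rmult_lt_reg_r with r2; [lra|]. replace (rho / r2 * r2) with rho by (field; lra). lra. }
  assert (Hw2 : Cmod w / r2 <= q).
  { unfold q. apply Rmult_le_compat_r; [left; apply Rinv_0_lt_compat; lra | assumption]. }
  assert (Hw0 : 0 <= Cmod w / r2) by (apply Rdiv_le_0_compat; lra).
  assert (T1 : forall k, Cmod (w ^ k * ccoef k r2) <= 4 * PI * A1 * (rho / r1) ^ k).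
  { intros k. rewrite Cmod_mult, Cmod_pow. rewrite <- (ccoef_indep k r1 r2) by lra.
    assert (B := ccoef_bound A1 r1 k ltac:(lra) HA1 H1).
    assert (Prk : 0 < r1 ^ k) by (apply pow_lt; lra).
    replace (4 * PI * A1 * (rho / r1) ^ k) with (rho ^ k * (4 * PI * A1 / r1 ^ k))
      by (unfold Rdiv; rewrite Rpow_mult_distr, pow_inv; ring).
    apply Rmult_le_compat; [now apply pow_le | apply Cmod_ge_0 | now apply pow_incr | exact B]. }
  assert (T2 : forall k, Cmod (w ^ k * ccoef k r2) <= 4 * PI * A2 * q ^ k).
  { intros k. rewrite Cmod_mult, Cmod_pow.
    assert (B := ccoef_bound A2 r2 k ltac:(lra) HA2 H2).
    assert (Prk : 0 < r2 ^ k) by (apply pow_lt; lra). unfold q.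
    replace (4 * PI * A2 * (rho / r2) ^ k) with (rho ^ k * (4 * PI * A2 / r2 ^ k))
      by (unfold Rdiv; rewrite Rpow_mult_distr, pow_inv; ring).
    apply Rmult_le_compat; [now apply pow_le | apply Cmod_ge_0 | now apply pow_incr | exact B]. }
  (* The terms beyond [K] are kept in the closed form of a finite geometric sum, so that the
     induction on [j] closes. *)
  assert (S : forall j, Cmod (csum (fun k => w ^ k * ccoef k r2)%C (j + K)) <=
    4 * PI * A1 * rsum (fun k => (rho / r1) ^ k) K + 4 * PI * A2 * (q ^ K * (1 - q ^ j) / (1 - q))).
  { induction j as [|j IH].
    - change (0 + K)%nat with K. eapply Rle_trans; [apply csum_norm_le; intros; apply T1|].
      rewrite (rsum_scal (4 * PI * A1) (fun k => (rho / r1) ^ k)).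
      change (q ^ 0) with 1.
      generalize (rsum (fun k => (rho / r1) ^ k) K) (q ^ K). clearbody q. intros x y.
      right. field. lra.
    - change (S j + K)%nat with (S (j + K)). simpl csum. eapply Rle_trans; [apply Cmod_triangle|].
      eapply Rle_trans; [apply Rplus_le_compat; [exact IH | apply T2]|].
      rewrite pow_add. change (q ^ S j) with (q * q ^ j).
      generalize (rsum (fun k => (rho / r1) ^ k) K) (q ^ K) (q ^ j). clearbody q. intros x y z.
      right. field. lra. }
  apply Rmult_le_reg_l with (2 * PI); [lra|].
  apply Rle_of_eps. intros eps He.
  destruct (pow_le_1_lim q (2 * PI * (M * (r2 / (r2 - Cmod w)))) Hq eps He) as [N HN].
  specialize (HN (N + K)%nat ltac:(lia)).
  assert (Tay := cauchy_taylor w r2 M (N + K) ltac:(lra) HM).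
  assert (PM : 0 <= M) by apply Cmod_ge_0.
  assert (Qw : (Cmod w / r2) ^ (N + K) <= q ^ (N + K)) by now apply pow_incr.
  assert (PR : 0 <= r2 / (r2 - Cmod w)) by (apply Rdiv_le_0_compat; lra).
  assert (Rm : 2 * PI * (M * ((Cmod w / r2) ^ (N + K) * (r2 / (r2 - Cmod w)))) <= eps).
  { left. eapply Rle_lt_trans; [|exact HN].
    replace (2 * PI * (M * (r2 / (r2 - Cmod w))) * q ^ (N + K)) with
      (2 * PI * (M * (q ^ (N + K) * (r2 / (r2 - Cmod w))))) by ring.
    apply Rmult_le_compat_l; [lra|]. apply Rmult_le_compat_l; [assumption|].
    now apply Rmult_le_compat_r. }
  specialize (S N).
  assert (T := Cmod_triangle_rev (RtoC (2 * PI) * g w) (csum (fun k => w ^ k * ccoef k r2)%C (N + K))).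
  rewrite Cmod_mult, Cmod_R, Rabs_pos_eq in T by lra.
  assert (QK : 0 <= q ^ K) by (apply pow_le; lra).
  assert (QN : 0 <= q ^ N) by (apply pow_le; lra).
  assert (F : 4 * PI * A2 * (q ^ K * (1 - q ^ N) / (1 - q)) <= 4 * PI * A2 * (q ^ K / (1 - q))).
  { apply Rmult_le_compat_l; [apply Rmult_le_pos; lra|].
    apply Rmult_le_compat_r; [left; apply Rinv_0_lt_compat; lra|]. nra. }
  fold q. lra.
Qed.

End Coefficients.

(** * Logarithms and sums of real powers *)

(** [G w] is the integral of [Z' / Z] along the segment from [s0] to [s0 + w]. Differentiating it
    under the integral sign asks for a continuous derivative of [Z' / Z], hence the second
    derivative of [Z] in the hypotheses. *)
Lemma log_exists (Z Z' Z'' : C -> C) (s0 : C) (R0 : R) : 0 < R0 ->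
  (forall z, Cmod (z - s0) < R0 -> cderiv Z z (Z' z)) ->
  (forall z, Cmod (z - s0) < R0 -> cderiv Z' z (Z'' z)) ->
  (forall z, Cmod (z - s0) < R0 -> continuous Z'' z) ->
  (forall z, Cmod (z - s0) < R0 -> Z z <> 0%C) ->
  exists G G' : C -> C,
    (forall w, Cmod w < R0 -> cderiv G w (G' w) /\ continuous G' w) /\
    G 0 = 0%C /\
    (forall w, Cmod w < R0 -> Z (s0 + w)%C = (Z s0 * Cexp (G w))%C).
Proof.
  intros HR HZ HZ' HZ'' Hn.
  set (phi := fun z => (Z' z * / Z z)%C).
  set (phi' := fun z => (Z'' z * / Z z + Z' z * (Z' z * - / (Z z * Z z)))%C).
  assert (Sh : forall w, Cmod w < R0 -> Cmod (s0 + w - s0) < R0).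
  { intros w Hw. replace (s0 + w - s0)%C with w by ring. exact Hw. }
  assert (Hphi : forall z, Cmod (z - s0) < R0 -> cderiv phi z (phi' z)).
  { intros z Hz. apply (cderiv_mult Z' (fun z => / Z z)%C); [now apply HZ'|].
    apply cderiv_inv; [now apply Hn | now apply HZ]. }
  assert (Hphi' : forall z, Cmod (z - s0) < R0 -> continuous phi' z).
  { intros z Hz. assert (CZ := cderiv_cont _ _ _ (HZ z Hz)). assert (CZ' := cderiv_cont _ _ _ (HZ' z Hz)).
    assert (N := Hn z Hz). apply cont_Cplus.
    - apply cont_Cmult; [now apply HZ'' | now apply cont_Cinv].
    - apply cont_Cmult; [assumption|]. apply cont_Cmult; [assumption|]. apply cont_Copp.
      apply (cont_Cinv (fun z => Z z * Z z)%C); [now apply cont_Cmult | now apply Cmult_neq_0]. }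
  set (F := fun (w : C) (u : R) => phi (s0 + RtoC u * w)%C).
  set (dF := fun (w : C) (u : R) => (RtoC u * phi' (s0 + RtoC u * w))%C).
  assert (Hu : forall w u, Cmod w < R0 -> 0 <= u <= 1 -> Cmod (RtoC u * w) < R0).
  { intros w u Hw Hu. rewrite Cmod_mult, Cmod_R, Rabs_pos_eq by lra.
    generalize (Cmod_ge_0 w). nra. }
  assert (DF : forall w u, Cmod w < R0 -> 0 <= u <= 1 -> cderiv (fun w => F w u) w (dF w u)).
  { intros w u Hw Hu'. unfold F, dF.
    apply (cderiv_comp phi (fun w => s0 + RtoC u * w)%C).
    - apply Hphi, Sh. now apply Hu.
    - eapply cderiv_eq.
      + apply cderiv_plus; [apply cderiv_const|]. apply cderiv_scal. apply cderiv_id.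
      + ring. }
  assert (CF : forall w, Cmod w < R0 -> cont_on (F w) 0 1).
  { intros w Hw u Hu'. apply (continuous_comp (fun u => s0 + RtoC u * w)%C phi).
    - exact (cpath_cont _ _ _ (cpath_lin s0 w u)).
    - apply (cderiv_cont phi _ _ (Hphi _ (Sh _ (Hu w u Hw Hu')))). }
  assert (CdF : forall w, Cmod w < R0 -> cont_on (dF w) 0 1).
  { intros w Hw u Hu'. apply cont_Cmult; [apply cont_RtoC; apply continuous_id|].
    apply (continuous_comp (fun u => s0 + RtoC u * w)%C phi').
    - exact (cpath_cont _ _ _ (cpath_lin s0 w u)).
    - apply Hphi', Sh. now apply Hu. }
  set (G := fun w : C => (w * CInt (F w) 0 1)%C).
  assert (HG : forall w, Cmod w < R0 -> cderiv G w (phi (s0 + w)%C)).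
  { intros w Hw.
    assert (DI : cderiv (fun w => CInt (F w) 0 1) w (CInt (dF w) 0 1)).
    { apply (cderiv_CInt F dF 0 1 w (R0 - Cmod w)); [lra | lra | | |].
      - intros v u Hv Hu'. apply DF; [|assumption].
        generalize (Cmod_triangle_rev v w). lra.
      - intros v Hv. apply CF. generalize (Cmod_triangle_rev v w). lra.
      - intros u Hu'. unfold dF.
        assert (Cu : continuous (fun p : C * R => RtoC (snd p)) (w, u)).
        { apply cont_RtoC. apply continuous_snd. }
        apply cont_Cmult; [exact Cu|].
        apply (continuous_comp (fun p : C * R => s0 + RtoC (snd p) * fst p)%C phi').
        + apply cont_Cplus; [apply continuous_const|]. apply cont_Cmult; [exact Cu | apply continuous_fst].
        + apply Hphi', Sh. now apply Hu. }
    eapply cderiv_eq; [exact (cderiv_mult _ _ _ _ _ (cderiv_id w) DI)|].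
    cbv beta. rewrite Cmult_1_l.
    rewrite <- CInt_scal; [| lra | now apply CdF].
    rewrite <- CInt_plus; [| lra | now apply CF | apply cont_on_scal; now apply CdF].
    (* [F w u + w * dF w u] is the derivative in [u] of [u * phi (s0 + u * w)], so the derivative of
       [G] collapses to [phi (s0 + w)]. *)
    transitivity (RtoC 1 * phi (s0 + RtoC 1 * w) - RtoC 0 * phi (s0 + RtoC 0 * w))%C.
    - apply (CInt_FTC (fun u => RtoC u * phi (s0 + RtoC u * w))%C); [lra | |].
      + intros u Hu'.
        assert (K : cderiv (fun z => z * phi (s0 + z * w))%C (0 + RtoC u * 1)%C
          (F w u + w * dF w u)%C).
        { replace (0 + RtoC u * 1)%C with (RtoC u) by ring.
          eapply cderiv_eq.
          - apply cderiv_mult; [apply cderiv_id|].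
            apply (cderiv_comp phi (fun z => s0 + z * w)%C).
            + apply Hphi, Sh. now apply Hu.
            + apply cderiv_plus; [apply cderiv_const|].
              apply cderiv_mult; [apply cderiv_id | apply cderiv_const].
          - unfold F, dF. cbv beta. ring. }
        assert (K2 := cpath_comp _ (fun u => 0 + RtoC u * 1)%C u _ _ K (cpath_lin 0 1 u)).
        cbv beta in K2. rewrite Cmult_1_l in K2.
        destruct K2 as [A B]. split.
        * eapply is_derive_ext; [|exact A]. intros v; cbv beta.
          replace (0 + RtoC v * 1)%C with (RtoC v) by ring. reflexivity.
        * eapply is_derive_ext; [|exact B]. intros v; cbv beta.
          replace (0 + RtoC v * 1)%C with (RtoC v) by ring. reflexivity.
      + intros u Hu'. apply cont_Cplus; [now apply CF|]. apply (cont_on_scal w (dF w) 0 1); [now apply CdF | assumption].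
    - replace (RtoC 1 * w)%C with w by ring. ring. }
  exists G, (fun w => phi (s0 + w)%C). split; [|split].
  - intros w Hw. split; [now apply HG|].
    apply (continuous_comp (fun w : C => s0 + w)%C phi).
    + apply cont_Cplus; [apply continuous_const | apply continuous_id].
    + exact (cderiv_cont _ _ _ (Hphi _ (Sh w Hw))).
  - unfold G. ring.
  - intros w Hw.
    (* The product of [Z] with the exponential of [- G] has zero derivative, hence keeps its value
       at the centre. *)
    assert (E : (Z (s0 + w) * Cexp (- G w))%C = (Z (s0 + 0) * Cexp (- G 0))%C).
    { apply (cderiv_0_const (fun w => Z (s0 + w) * Cexp (- G w))%C).
      intros t Ht. replace (0 + RtoC t * (w - 0))%C with (RtoC t * w)%C by ring.
      assert (Hv := Hu w t Hw Ht). set (v := (RtoC t * w)%C) in *.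
      assert (N := Hn _ (Sh v Hv)).
      eapply cderiv_eq.
      - apply cderiv_mult.
        + apply cderiv_shift. apply HZ. now apply Sh.
        + apply (cderiv_comp Cexp (fun w => - G w)%C); [apply cderiv_Cexp|].
          apply cderiv_opp. now apply HG.
      - cbv beta. unfold phi. field. exact N. }
    assert (G0 : G 0 = 0%C) by (unfold G; ring).
    rewrite G0 in E. replace (s0 + 0)%C with s0 in E by ring.
    replace (- 0)%C with (RtoC 0) in E by ring. rewrite Cexp_0, Cexp_opp in E.
    assert (NE := Cexp_neq_0 (G w)).
    replace (Z s0) with (Z (s0 + w) * / Cexp (G w))%C by (rewrite E; ring).
    field. exact NE.
Qed.

(** * Real powers and their series *)

Lemma Rpower_pos x y : 0 < Rpower x y.
Proof. apply exp_pos. Qed.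

Lemma Rpower_le_base x y c : 0 < x <= y -> 0 <= c -> Rpower x c <= Rpower y c.
Proof. intros H Hc. now apply Rle_Rpower_l. Qed.

Lemma Rpower_le_base_neg x y c : 0 < x <= y -> c <= 0 -> Rpower y c <= Rpower x c.
Proof.
  intros H Hc. replace c with (- (- c)) by ring. rewrite !(Rpower_Ropp _ (- c)).
  apply Rinv_le_contravar; [apply Rpower_pos|]. apply Rle_Rpower_l; lra.
Qed.

Lemma Rpower_le_exp x c d : 1 <= x -> c <= d -> Rpower x c <= Rpower x d.
Proof. intros H Hc. now apply Rle_Rpower. Qed.

Lemma Rpower_1_l c : Rpower 1 c = 1.
Proof. unfold Rpower. rewrite ln_1, Rmult_0_r. apply exp_0. Qed.

Lemma Rpower_mvt (x y c : R) : 0 < x < y ->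
  exists z, x < z < y /\ Rpower y c - Rpower x c = c * Rpower z (c - 1) * (y - x).
Proof.
  intros H.
  destruct (MVT_cor2 (fun t => Rpower t c) (fun t => c * Rpower t (c - 1)) x y) as (z & E & Hz); [lra | |].
  - intros t Ht. apply derivable_pt_lim_power. lra.
  - exists z. split; [lra|]. exact E.
Qed.

(** A discrete integral test: the right side telescopes when summed. *)
Lemma Rpower_telescope (x p : R) : 0 < x -> 1 < p ->
  (p - 1) * Rpower (x + 1) (- p) <= Rpower x (1 - p) - Rpower (x + 1) (1 - p).
Proof.
  intros Hx Hp. destruct (Rpower_mvt x (x + 1) (1 - p)) as (z & Hz & E); [lra|].
  replace (x + 1 - x) with 1 in E by ring.
  replace (1 - p - 1) with (- p) in E by ring.
  assert (L : Rpower (x + 1) (- p) <= Rpower z (- p)) by (apply Rpower_le_base_neg; lra).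
  nra.
Qed.

Definition npow (p : R) (n : nat) : R := Rpower (INR (S n)) (- p).

Lemma npow_pos p n : 0 < npow p n.
Proof. apply Rpower_pos. Qed.

Lemma INR_S_pos n : 0 < INR (S n).
Proof. apply lt_0_INR. lia. Qed.

Lemma INR_S_ge_1 n : 1 <= INR (S n).
Proof. rewrite S_INR. generalize (pos_INR n). lra. Qed.

Lemma rsum_npow_shift_le p m n : 1 < p -> (p - 1) * rsum (fun k => npow p (k + S m)) n <= Rpower (INR (S m)) (1 - p).
Proof.
  intros Hp.
  assert (H : (p - 1) * rsum (fun k => npow p (k + S m)) n <= Rpower (INR (S m)) (1 - p) - Rpower (INR (S (n + m))) (1 - p)).
  { induction n; simpl rsum; [change (0 + m)%nat with m; lra|].
    rewrite Rmult_plus_distr_l.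
    assert (T := Rpower_telescope (INR (S (n + m))) p (INR_S_pos _) Hp).
    unfold npow at 2.
    replace (INR (S (n + S m))) with (INR (S (n + m)) + 1) by (rewrite <- S_INR; f_equal; lia).
    replace (INR (S (S n + m))) with (INR (S (n + m)) + 1) by (rewrite <- S_INR; f_equal; lia).
    lra. }
  generalize (Rpower_pos (INR (S (n + m))) (1 - p)). lra.
Qed.

Lemma ex_series_pos_bounded (a : nat -> R) (B : R) :
  (forall n, 0 <= a n) -> (forall n, rsum a n <= B) -> ex_series a.
Proof.
  intros Ha HB.
  assert (H : ex_finite_lim_seq (sum_n a)).
  { apply (ex_finite_lim_seq_incr _ B).
    - intros n. rewrite sum_Sn. unfold plus; simpl. specialize (Ha (S n)). lra.
    - intros n. rewrite <- rsum_sum_n. apply HB. }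
  destruct H as [l Hl]. exists l. exact Hl.
Qed.

Lemma rsum_shift f n : rsum f (S n) = f O + rsum (fun k => f (S k)) n.
Proof. induction n; simpl; [ring|]. simpl in IHn. rewrite IHn. ring. Qed.

Lemma ex_series_npow p : 1 < p -> ex_series (npow p).
Proof.
  intros Hp. apply (ex_series_pos_bounded _ (1 + / (p - 1))).
  - intros n. left. apply npow_pos.
  - intros n. apply Rle_trans with (rsum (npow p) (S n)).
    + simpl. generalize (npow_pos p n). lra.
    + rewrite rsum_shift. unfold npow at 1. simpl INR. rewrite Rpower_1_l.
      apply Rplus_le_compat_l.
      assert (H := rsum_npow_shift_le p 0 n Hp). simpl INR in H. rewrite Rpower_1_l in H.
      rewrite (rsum_ext _ (fun k => npow p (k + 1))) by (intros; f_equal; lia).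
      apply Rmult_le_reg_l with (p - 1); [lra|]. rewrite Rinv_r by lra. lra.
Qed.

(** From [u <= exp u] at [u = eta * ln x]: a power of the logarithm costs only a small power of
    [x]. *)
Lemma ln_pow_le (x eta : R) (j : nat) : 1 <= x -> 0 < eta -> ln x ^ j <= (/ eta) ^ j * Rpower x (eta * INR j).
Proof.
  intros Hx He.
  assert (L : 0 <= ln x) by (rewrite <- ln_1; destruct Hx as [Hx| <-]; [left; apply ln_increasing; lra | lra]).
  assert (K : ln x <= / eta * Rpower x eta).
  { apply Rmult_le_reg_l with eta; [assumption|].
    rewrite <- Rmult_assoc, Rinv_r by lra. rewrite Rmult_1_l. unfold Rpower.
    generalize (exp_ineq1_le (eta * ln x)). lra. }
  eapply Rle_trans; [apply pow_incr; split; [exact L | exact K]|].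
  rewrite Rpow_mult_distr. right. f_equal.
  rewrite <- Rpower_pow by apply Rpower_pos. now rewrite Rpower_mult.
Qed.

Lemma ex_series_log_npow (p : R) (j : nat) : 1 < p ->
  ex_series (fun n => ln (INR n + 2) ^ j * npow p n).
Proof.
  (* [eta * INR j] is at most half of [p - 1], so absorbing the logarithms still leaves an exponent
     [q > 1]; taking [S j] avoids a division by 0 for [j = 0]. *)
  intros Hp. set (eta := (p - 1) / (2 * INR (S j))).
  assert (PS := INR_S_pos j).
  assert (He : 0 < eta) by (unfold eta; apply Rdiv_lt_0_compat; lra).
  set (q := (p + 1) / 2).
  apply (ex_series_dom _ (fun n => (/ eta) ^ j * Rpower 2 q * npow q n)).
  2:{ apply (ex_series_scal (V := R_NormedModule)). apply ex_series_npow. unfold q; lra. }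
  intros n. assert (Pn := pos_INR n).
  assert (L : 0 <= ln (INR n + 2)) by (rewrite <- ln_1; left; apply ln_increasing; lra).
  rewrite Rabs_pos_eq by (apply Rmult_le_pos; [now apply pow_le | left; apply npow_pos]).
  assert (K := ln_pow_le (INR n + 2) eta j ltac:(lra) He).
  assert (Pe : 0 < (/ eta) ^ j) by (apply pow_lt, Rinv_0_lt_compat, He).
  eapply Rle_trans; [apply Rmult_le_compat_r; [left; apply npow_pos | exact K]|].
  rewrite !Rmult_assoc. apply Rmult_le_compat_l; [lra|].
  assert (E1 : Rpower (INR n + 2) (eta * INR j) <= Rpower (2 * INR (S n)) (p - q)).
  { apply Rle_trans with (Rpower (INR n + 2) (p - q)).
    - apply Rpower_le_exp; [lra|]. unfold eta, q.
      apply Rmult_le_reg_r with (2 * INR (S j)); [lra|].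
      replace ((p - 1) / (2 * INR (S j)) * INR j * (2 * INR (S j))) with ((p - 1) * INR j) by (field; lra).
      rewrite S_INR. generalize (pos_INR j). nra.
    - apply Rpower_le_base; [|unfold q; lra]. rewrite S_INR. lra. }
  eapply Rle_trans; [apply Rmult_le_compat_r; [left; apply npow_pos | exact E1]|].
  rewrite <- Rpower_mult_distr by (try apply INR_S_pos; lra).
  unfold npow. rewrite Rmult_assoc, <- Rpower_plus.
  replace (p - q + - p) with (- q) by ring.
  apply Rmult_le_compat_r; [left; apply Rpower_pos|].
  apply Rpower_le_exp; unfold q; lra.
Qed.

(** * Analytic continuation of zeta *)

(* Bernoulli polynomials up to normalisation: successive primitives of mean zero on [0, 1]. *)
Fixpoint bern (k : nat) (u : R) : R :=
  match k with
  | O => u - / 2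
  | S j => RInt (bern j) 0 u - RInt (fun v => RInt (bern j) 0 v) 0 1
  end.

Lemma is_derive_primitive (f : R -> R) u : (forall v, continuous f v) ->
  is_derive (fun u => RInt f 0 u) u (f u).
Proof.
  intros H. apply (is_derive_RInt f _ 0); [|apply H].
  apply filter_forall. intros y. apply (RInt_correct (V := R_CompleteNormedModule) f).
  apply (ex_RInt_continuous f). intros; apply H.
Qed.

Lemma bern_cont k u : continuous (bern k) u.
Proof.
  revert u. induction k; intros u.
  - apply cont_Rminus; [apply continuous_id | apply continuous_const].
  - simpl. apply cont_Rminus; [|apply continuous_const].
    apply (ex_derive_continuous (fun u => RInt (bern k) 0 u)).
    exists (bern k u). now apply is_derive_primitive.
Qed.

Lemma bern_deriv k u : is_derive (bern (S k)) u (bern k u).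
Proof.
  simpl. replace (bern k u) with (bern k u - 0) by ring.
  apply (is_derive_minus (fun u => RInt (bern k) 0 u) (fun _ => RInt (fun v => RInt (bern k) 0 v) 0 1)).
  - apply is_derive_primitive, bern_cont.
  - apply (is_derive_const (V := R_NormedModule)).
Qed.

Lemma bern_mean k : RInt (bern k) 0 1 = 0.
Proof.
  destruct k.
  - apply is_RInt_unique.
    replace 0 with ((fun u => u * u / 2 - u / 2) 1 - (fun u => u * u / 2 - u / 2) 0) at 2 by (simpl; field).
    apply (is_RInt_derive (fun u => u * u / 2 - u / 2)).
    + intros x _. unfold bern. auto_derive; trivial. field.
    + intros x _. apply bern_cont.
  - assert (E : ex_RInt (fun v => RInt (bern k) 0 v) 0 1).
    { apply (ex_RInt_continuous (fun v => RInt (bern k) 0 v)). intros z _.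
      apply (ex_derive_continuous (fun u => RInt (bern k) 0 u)).
      exists (bern k z). apply is_derive_primitive, bern_cont. }
    set (c := RInt (fun v => RInt (bern k) 0 v) 0 1) in *.
    transitivity (RInt (fun v => RInt (bern k) 0 v) 0 1 - RInt (fun _ => c) 0 1).
    + exact (RInt_minus _ (fun _ => c) 0 1 E (ex_RInt_const _ _ _)).
    + rewrite RInt_const. unfold scal; simpl; unfold mult; simpl. fold c. ring.
Qed.

(** Mean zero of [bern k] is exactly what makes its primitive agree at both ends; the boundary terms
    of the later integrations by parts then telescope in [n]. *)
Lemma bern_1_0 k : bern (S k) 1 = bern (S k) 0.
Proof. simpl. rewrite bern_mean, RInt_point. reflexivity. Qed.

Lemma bern_bounded k : exists B, 0 <= B /\ forall u, 0 <= u <= 1 -> Rabs (bern k u) <= B.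
Proof.
  destruct (continuity_ab_maj (fun u => Rabs (bern k u)) 0 1) as (m & H & _); [lra | |].
  - intros c _. apply continuity_pt_filterlim. apply (continuous_comp (bern k) Rabs).
    + apply bern_cont.
    + apply continuous_Rabs.
  - exists (Rabs (bern k m)). split; [apply Rabs_pos | exact H].
Qed.

(** The Euler-Maclaurin remainder integrand on [[n + 1, n + 2]], with [x = INR (S n) + u]: a
    Bernoulli function of the fractional part against [x ^ (- s - k - 1)]. The power [j] of the
    logarithm counts derivatives in [s], up to sign. *)
Definition zint (k j n : nat) (s : C) (u : R) : C :=
  (RtoC (bern k u * ln (INR (S n) + u) ^ j) * Rcpow (INR (S n) + u) (- (s + RtoC (INR (S k)))))%C.

Definition zterm (k j n : nat) (s : C) : C := CInt (zint k j n s) 0 1.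

Lemma cont_ln {U : UniformSpace} (f : U -> R) x : continuous f x -> 0 < f x -> continuous (fun y => ln (f y)) x.
Proof.
  intros H P. apply (continuous_comp f ln); [assumption|].
  apply continuity_pt_filterlim. apply derivable_continuous_pt. exists (/ f x). now apply derivable_pt_lim_ln.
Qed.

Lemma cont_Rpow {U : UniformSpace} (f : U -> R) n x : continuous f x -> continuous (fun y => f y ^ n) x.
Proof.
  intros H. induction n; simpl; [apply continuous_const | now apply cont_Rmult].
Qed.

Lemma cont_Rcpow {U : UniformSpace} (f : U -> R) (g : U -> C) x :
  continuous f x -> continuous g x -> 0 < f x -> continuous (fun y => Rcpow (f y) (g y)) x.
Proof.
  intros Hf Hg P. unfold Rcpow. apply cont_Cexp. apply cont_Cmult; [assumption|].
  apply cont_RtoC. now apply cont_ln.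
Qed.

Lemma zint_joint k j n s u : 0 <= u ->
  continuous (fun p : C * R => zint k j n (fst p) (snd p)) (s, u).
Proof.
  intros Hu. assert (P := INR_S_pos n). unfold zint.
  assert (Cx : continuous (fun p : C * R => INR (S n) + snd p) (s, u)).
  { apply cont_Rplus; [apply continuous_const | apply continuous_snd]. }
  apply cont_Cmult.
  - apply cont_RtoC. apply cont_Rmult.
    + apply (continuous_comp (fun p : C * R => snd p) (bern k)); [apply continuous_snd | apply bern_cont].
    + apply cont_Rpow. apply cont_ln; [exact Cx | cbn [snd]; lra].
  - apply cont_Rcpow; [exact Cx | | cbn [snd]; lra].
    apply cont_Copp. apply cont_Cplus; [apply continuous_fst | apply continuous_const].
Qed.

Lemma zint_cont k j n s : cont_on (zint k j n s) 0 1.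
Proof.
  intros u Hu.
  apply (continuous_comp_2 (fun _ : R => s) (fun v : R => v) (fun s v => zint k j n s v)).
  - apply continuous_const.
  - apply continuous_id.
  - apply zint_joint; lra.
Qed.

Lemma zterm_deriv k j n s : cderiv (zterm k j n) s (- zterm k (S j) n s)%C.
Proof.
  apply cderiv_eq with (CInt (fun u => (- 1) * zint k (S j) n s u)%C 0 1).
  - apply (cderiv_CInt (zint k j n) (fun s u => (- 1) * zint k (S j) n s u)%C 0 1 s 1); [lra | lra | | |].
    + intros w u _ Hu. unfold zint.
      eapply cderiv_eq.
      * apply cderiv_scal.
        apply (cderiv_comp (fun s => Rcpow (INR (S n) + u) s) (fun s => - (s + RtoC (INR (S k))))%C).
        -- apply cderiv_Rcpow.
        -- apply cderiv_opp. apply cderiv_plus; [apply cderiv_id | apply cderiv_const].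
      * cbv beta. change (ln (INR (S n) + u) ^ S j) with (ln (INR (S n) + u) * ln (INR (S n) + u) ^ j). rewrite !RtoC_mult. ring.
    + intros w _. apply zint_cont.
    + intros u Hu. apply cont_Cmult; [apply continuous_const | apply zint_joint; lra].
  - rewrite CInt_scal; [| lra | apply zint_cont]. unfold zterm. ring.
Qed.

Lemma Rpower_base_ge (x u c : R) : 0 < x -> 0 <= u -> 0 <= c -> Rpower (x + u) (- c) <= Rpower x (- c).
Proof. intros. apply Rpower_le_base_neg; lra. Qed.

(** Stated with a lower bound [p] for the exponent, so that one majorant serves a whole disc in
    [zser_deriv]. *)
Lemma zterm_bound k B : (forall u, 0 <= u <= 1 -> Rabs (bern k u) <= B) ->
  forall j n s p, 0 <= p -> p <= Re s + INR (S k) ->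
  Cmod (zterm k j n s) <= B * (ln (INR n + 2) ^ j * npow p n).
Proof.
  intros HB j n s p Hp Hs.
  replace (B * (ln (INR n + 2) ^ j * npow p n)) with ((1 - 0) * (B * (ln (INR n + 2) ^ j * npow p n))) by ring.
  apply CInt_norm_const; [lra | apply zint_cont |].
  intros u Hu. unfold zint. rewrite Cmod_mult, Cmod_R, Rabs_mult, Cmod_Rcpow, Rmult_assoc.
  assert (P := INR_S_ge_1 n).
  assert (B0 : 0 <= B) by (eapply Rle_trans; [apply Rabs_pos | apply (HB u Hu)]).
  assert (L0 : 0 <= ln (INR (S n) + u)).
  { rewrite <- ln_1. destruct (Req_dec (INR (S n) + u) 1) as [->|N]; [lra|].
    left. apply ln_increasing; lra. }
  assert (L1 : ln (INR (S n) + u) <= ln (INR n + 2)).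
  { rewrite S_INR. destruct (Req_dec u 1) as [->|N]; [right; f_equal; ring|].
    left. apply ln_increasing; [rewrite S_INR in P; lra | lra]. }
  apply Rmult_le_compat; [apply Rabs_pos | | now apply HB |].
  - apply Rmult_le_pos; [apply Rabs_pos | left; apply Rpower_pos].
  - apply Rmult_le_compat; [apply Rabs_pos | left; apply Rpower_pos | |].
    + rewrite Rabs_pos_eq by now apply pow_le. now apply pow_incr.
    + replace (Re (- (s + RtoC (INR (S k))))) with (- (Re s + INR (S k))) by (unfold Re; simpl; ring).
      apply Rle_trans with (Rpower (INR (S n)) (- (Re s + INR (S k)))).
      * apply Rpower_base_ge; lra.
      * apply Rpower_le_exp; lra.
Qed.

(** Converges for [Re s > - INR k], where the exponent [Re s + INR (S k)] exceeds 1: each level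
    gains a strip of width 1. *)
Definition zser (k j : nat) (s : C) : C := CSer (fun n => zterm k j n s).

Lemma zser_dom k j s : - INR k < Re s -> exists M, ex_series M /\ forall n, Cmod (zterm k j n s) <= M n.
Proof.
  intros Hs. destruct (bern_bounded k) as (B & B0 & HB).
  set (p := Re s + INR (S k)). assert (Hp : 1 < p) by (unfold p; rewrite S_INR; lra).
  exists (fun n => B * (ln (INR n + 2) ^ j * npow p n)). split.
  - apply (ex_series_scal (V := R_NormedModule)). now apply ex_series_log_npow.
  - intros n. apply zterm_bound; [exact HB | lra | unfold p; lra].
Qed.

Lemma zser_cser k j s : - INR k < Re s -> cser (fun n => zterm k j n s) (zser k j s).
Proof.
  intros Hs. destruct (zser_dom k j s Hs) as (M & HM & HB). now apply (cser_dom _ M).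
Qed.

Lemma zser_deriv k j s : - INR k < Re s -> cderiv (zser k j) s (- zser k (S j) s)%C.
Proof.
  intros Hs. destruct (bern_bounded k) as (B & B0 & HB).
  set (r := (Re s + INR k) / 2). assert (Hr : 0 < r) by (unfold r; lra).
  assert (Near : forall w, Cmod (w - s) < r -> r - INR k < Re w).
  { intros w Hw. assert (K := re_le_Cmod (w - s)).
    replace (Re (w - s)) with (Re w - Re s) in K by (unfold Re; simpl; ring).
    assert (A : - (Re w - Re s) <= Rabs (Re w - Re s)) by (rewrite <- Rabs_Ropp; apply Rle_abs).
    unfold r in *. lra. }
  apply (cderiv_series (fun n => zterm k j n) (fun n w => - zterm k (S j) n w)%C
    (fun n w => - - zterm k (S (S j)) n w)%C (zser k j) _ s r
    (fun n => B * (ln (INR n + 2) ^ S (S j) * npow (1 + r) n)) Hr).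
  - apply (ex_series_scal (V := R_NormedModule)). apply ex_series_log_npow. lra.
  - intros n w _. apply zterm_deriv.
  - intros n w _. apply cderiv_opp. apply zterm_deriv.
  - intros n w Hw. rewrite !Cmod_opp. apply zterm_bound; [exact HB | lra |].
    specialize (Near w Hw). rewrite S_INR. lra.
  - intros w Hw. apply zser_cser. specialize (Near w Hw). lra.
  - apply (cser_ext (fun n => (- 1) * zterm k (S j) n s)%C); [intros; ring|].
    replace (- zser k (S j) s)%C with ((- 1) * zser k (S j) s)%C by ring.
    apply cser_scal. now apply zser_cser.
Qed.

Lemma cpath_Rcpow (x u : R) (s : C) : 0 < x + u ->
  cpath (fun u => Rcpow (x + u) s) u (s * Rcpow (x + u) (s - 1))%C.
Proof.
  intros H. unfold Rcpow.
  assert (K : cpath (fun u => s * RtoC (ln (x + u)))%C u (s * RtoC (/ (x + u)))%C).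
  { split; unfold Re, Im; simpl; auto_derive; try (repeat split; lra); field; lra. }
  assert (E := cpath_comp Cexp _ u _ _ (cderiv_Cexp _) K). cbv beta in E.
  replace (s * Cexp ((s - 1) * RtoC (ln (x + u))))%C with
    (s * RtoC (/ (x + u)) * Cexp (s * RtoC (ln (x + u))))%C; [exact E|].
  replace ((s - 1) * RtoC (ln (x + u)))%C with (s * RtoC (ln (x + u)) + - (1 * RtoC (ln (x + u))))%C by ring.
  rewrite Cexp_plus, Cexp_opp. fold (Rcpow (x + u) 1). rewrite Rcpow_1 by exact H.
  rewrite RtoC_inv by lra. ring.
Qed.

Lemma cpath_mult_real (f : R -> R) (g : R -> C) u df dg :
  is_derive f u df -> cpath g u dg -> cpath (fun u => RtoC (f u) * g u)%C u (RtoC df * g u + RtoC (f u) * dg)%C.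
Proof.
  intros Hf [A B].
  assert (K1 := is_derive_mult f (fun u => Re (g u)) u _ _ Hf A Rmult_comm).
  assert (K2 := is_derive_mult f (fun u => Im (g u)) u _ _ Hf B Rmult_comm).
  split.
  - eapply is_derive_ext; [|eapply (fun H => eq_ind _ (fun l => is_derive _ u l) K1 _ H)].
    + intros t. unfold Re, mult; simpl. unfold mult; simpl. ring.
    + unfold plus, mult, Re, Im; simpl. unfold mult; simpl. ring.
  - eapply is_derive_ext; [|eapply (fun H => eq_ind _ (fun l => is_derive _ u l) K2 _ H)].
    + intros t. unfold Im, mult; simpl. unfold mult; simpl. ring.
    + unfold plus, mult, Re, Im; simpl. unfold mult; simpl. ring.
Qed.

(** One integration by parts, with [bern (S k)] as primitive of [bern k]. By [bern_1_0] both
    boundary values carry the same factor, so their sum over [n] will telescope. *)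
Lemma zterm_step k n s :
  zterm k 0 n s = (RtoC (bern (S k) 1) * (Rcpow (INR (S (S n))) (- (s + RtoC (INR (S k)))) - Rcpow (INR (S n)) (- (s + RtoC (INR (S k)))))
    + (s + RtoC (INR (S k))) * zterm (S k) 0 n s)%C.
Proof.
  assert (P := INR_S_pos n). set (a := (s + RtoC (INR (S k)))%C).
  set (h := fun u => (RtoC (bern (S k) u) * Rcpow (INR (S n) + u) (- a))%C).
  assert (C1 := zint_cont k 0 n s). assert (C2 := zint_cont (S k) 0 n s).
  assert (E : CInt (fun u => zint k 0 n s u + (- a) * zint (S k) 0 n s u)%C 0 1 = (h 1 - h 0)%C).
  { apply CInt_FTC; [lra | |].
    - intros u Hu.
      assert (K := cpath_mult_real (bern (S k)) (fun u => Rcpow (INR (S n) + u) (- a)) u _ _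
        (bern_deriv k u) (cpath_Rcpow (INR (S n)) u (- a) ltac:(lra))).
      replace (zint k 0 n s u + - a * zint (S k) 0 n s u)%C with
        (RtoC (bern k u) * Rcpow (INR (S n) + u) (- a) +
          RtoC (bern (S k) u) * (- a * Rcpow (INR (S n) + u) (- a - 1)))%C; [exact K|].
      unfold zint. rewrite !pow_O, !Rmult_1_r.
      replace (- (s + RtoC (INR (S (S k)))))%C with (- a - 1)%C by (unfold a; rewrite (S_INR (S k)), RtoC_plus; ring).
      fold a. ring.
    - intros u Hu. apply cont_Cplus; [now apply C1 | now apply (cont_on_scal _ _ 0 1 C2)]. }
  rewrite CInt_plus, CInt_scal in E; [| lra | exact C2 | lra | exact C1 | now apply cont_on_scal].
  fold (zterm k 0 n s) in E. fold (zterm (S k) 0 n s) in E.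
  unfold h in E. rewrite <- bern_1_0 in E.
  replace (INR (S n) + 1) with (INR (S (S n))) in E by (rewrite (S_INR (S n)); ring).
  rewrite Rplus_0_r in E.
  replace (zterm k 0 n s) with (zterm k 0 n s + - a * zterm (S k) 0 n s + a * zterm (S k) 0 n s)%C by ring.
  rewrite E. ring.
Qed.

Lemma Rcpow_lim (a : C) : 0 < Re a -> forall eps, 0 < eps -> exists N, forall n, (N <= n)%nat ->
  Cmod (Rcpow (INR (S n)) (- a)) < eps.
Proof.
  intros Ha eps He.
  destruct (INR_unbounded (Rpower eps (- / Re a))) as [N HN].
  exists N. intros n Hn. rewrite Cmod_Rcpow.
  replace (Re (- a)) with (- Re a) by (unfold Re; simpl; ring).
  assert (L : Rpower eps (- / Re a) < INR (S n)).
  { apply Rlt_trans with (1 := HN). apply lt_INR. lia. }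
  rewrite Rpower_Ropp.
  replace eps with (/ / eps) by (field; lra).
  apply Rinv_lt_contravar.
  - apply Rmult_lt_0_compat; [now apply Rinv_0_lt_compat | apply Rpower_pos].
  - replace (/ eps) with (Rpower (Rpower eps (- / Re a)) (Re a)).
    + apply Rlt_Rpower_l; [assumption|]. split; [apply Rpower_pos | exact L].
    + rewrite Rpower_mult. replace (- / Re a * Re a) with (- (1)) by (field; lra).
      rewrite Rpower_Ropp, Rpower_1 by assumption. reflexivity.
Qed.

Lemma csum_telescope (f : nat -> C) n : csum (fun k => f (S k) - f k)%C n = (f n - f O)%C.
Proof. induction n; simpl; [ring|]. rewrite IHn. ring. Qed.

(** The boundary terms of [zterm_step] telescope to the one at [n = 0]. The right side makes sense
    even for [Re s > - INR (S k)], which is how the half-plane is enlarged. *)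
Lemma zser_step k s : - INR k < Re s ->
  zser k 0 s = (- RtoC (bern (S k) 1) + (s + RtoC (INR (S k))) * zser (S k) 0 s)%C.
Proof.
  intros Hs. set (a := (s + RtoC (INR (S k)))%C).
  assert (Ha : 0 < Re a) by (unfold a; rewrite S_INR; unfold Re in *; simpl; lra).
  apply (cser_unique (fun n => zterm k 0 n s)); [now apply zser_cser|].
  apply (cser_ext (fun n => RtoC (bern (S k) 1) * (Rcpow (INR (S (S n))) (- a) - Rcpow (INR (S n)) (- a))
    + a * zterm (S k) 0 n s)%C); [intros n; symmetry; apply zterm_step|].
  apply cser_plus.
  - replace (- RtoC (bern (S k) 1))%C with (RtoC (bern (S k) 1) * (- 1))%C by ring.
    apply cser_scal. intros eps He. destruct (Rcpow_lim a Ha eps He) as [N HN].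
    exists N. intros n Hn. rewrite (csum_telescope (fun n => Rcpow (INR (S n)) (- a))).
    simpl (INR 1). rewrite Rcpow_1_l.
    replace (Rcpow (INR (S n)) (- a) - 1 - (-1))%C with (Rcpow (INR (S n)) (- a)) by ring. now apply HN.
  - apply cser_scal. apply zser_cser. rewrite S_INR. lra.
Qed.

(* [wcont k m] unrolls the recurrence of [zser_step] [m] times from level [k]; it is
   defined for [Re s > - (k + m)] and does not depend on [m] there. *)
Fixpoint wcont (k m : nat) (s : C) : C :=
  match m with
  | O => zser k 0 s
  | S m' => (- RtoC (bern (S k) 1) + (s + RtoC (INR (S k))) * wcont (S k) m' s)%C
  end.

Lemma wcont_S k m s : - INR (k + m) < Re s -> wcont k (S m) s = wcont k m s.
Proof.
  revert k. induction m; intros k Hs.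
  - simpl. symmetry. apply zser_step. now rewrite Nat.add_0_r in Hs.
  - change (wcont k (S (S m)) s) with (- RtoC (bern (S k) 1) + (s + RtoC (INR (S k))) * wcont (S k) (S m) s)%C.
    rewrite IHm; [reflexivity|]. replace (S k + m)%nat with (k + S m)%nat by lia. exact Hs.
Qed.

Lemma wcont_add k m i s : - INR (k + m) < Re s -> wcont k (m + i) s = wcont k m s.
Proof.
  intros Hs. induction i; [now rewrite Nat.add_0_r|].
  rewrite Nat.add_succ_r, wcont_S; [exact IHi|].
  apply Rle_lt_trans with (2 := Hs). apply Ropp_le_contravar, le_INR. lia.
Qed.

Lemma wcont_deriv k m s : - INR (k + m) < Re s -> exists l, cderiv (wcont k m) s l.
Proof.
  revert k. induction m; intros k Hs.
  - rewrite Nat.add_0_r in Hs. eexists. apply (zser_deriv k 0 s Hs).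
  - destruct (IHm (S k)) as [l Hl].
    + replace (S k + m)%nat with (k + S m)%nat by lia. exact Hs.
    + eexists. apply cderiv_plus; [apply cderiv_const|]. apply cderiv_mult; [|exact Hl].
      apply cderiv_plus; [apply cderiv_id | apply cderiv_const].
Qed.

(** * Definition of zeta and its Dirichlet series *)

Definition zlevel (s : C) : nat := Z.to_nat (up (Rabs (Re s))).

Lemma zlevel_gt s : Rabs (Re s) < INR (zlevel s).
Proof.
  unfold zlevel. destruct (archimed (Rabs (Re s))) as [H _].
  rewrite INR_IZR_INZ, Z2Nat.id; [lra|].
  apply le_IZR. generalize (Rabs_pos (Re s)). lra.
Qed.

(** Euler summation: the last term continues [s] times the integral of [({x} - 1/2) * x ^ (- s - 1)]
    over [x >= 1]. The number of unrolling steps depends on [s]; [wcont_zlevel] shows that this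
    dependence is only apparent. *)
Definition zeta (s : C) : C := (/ (s - 1) + / 2 - s * wcont 0 (zlevel s) s)%C.

Lemma wcont_zlevel s m : Rabs (Re s) < INR m -> wcont 0 (zlevel s) s = wcont 0 m s.
Proof.
  intros Hm. assert (Hz := zlevel_gt s).
  assert (A : - Re s <= Rabs (Re s)) by (rewrite <- Rabs_Ropp; apply Rle_abs).
  destruct (Nat.le_ge_cases m (zlevel s)) as [L|L].
  - replace (zlevel s) with (m + (zlevel s - m))%nat by lia. apply wcont_add. simpl. lra.
  - replace m with (zlevel s + (m - zlevel s))%nat by lia. symmetry. apply wcont_add. simpl. lra.
Qed.

Lemma zeta_deriv (s : C) : s <> 1%C -> exists l, cderiv zeta s l.
Proof.
  (* One level more than at [s] covers all points at distance less than 1, so near [s] the number of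
     steps can be frozen. *)
  intros Hs. set (m := S (zlevel s)).
  assert (Hz := zlevel_gt s).
  assert (A : - Re s <= Rabs (Re s)) by (rewrite <- Rabs_Ropp; apply Rle_abs).
  destruct (wcont_deriv 0 m s) as [l Hl].
  { change (0 + m)%nat with m. unfold m. rewrite S_INR. lra. }
  assert (N : (s - 1 <> 0)%C) by (intros E; apply Hs; now apply Ceq_minus).
  assert (D : cderiv (fun s => / (s - 1))%C s ((1 - 0) * - / ((s - 1) * (s - 1)))%C).
  { apply (cderiv_inv (fun s => s - 1)%C); [exact N|]. apply cderiv_minus; [apply cderiv_id | apply cderiv_const]. }
  eexists.
  apply (cderiv_ext_loc (fun s => / (s - 1) + / 2 - s * wcont 0 m s)%C _ _ _ 1); [lra | |].
  - intros w Hw. unfold zeta. rewrite (wcont_zlevel w m); [reflexivity|].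
    assert (K := re_le_Cmod (w - s)). replace (Re (w - s)) with (Re w - Re s) in K by (unfold Re; simpl; ring).
    generalize (Rabs_triang_inv (Re w) (Re s)). unfold m. rewrite S_INR. lra.
  - apply cderiv_minus.
    + apply cderiv_plus; [exact D | apply cderiv_const].
    + apply cderiv_mult; [apply cderiv_id | exact Hl].
Qed.

Lemma zeta_right (s : C) : 0 < Re s -> zeta s = (/ (s - 1) + / 2 - s * zser 0 0 s)%C.
Proof.
  intros Hs. unfold zeta.
  change (zlevel s) with (0 + zlevel s)%nat. rewrite wcont_add by (simpl; lra). reflexivity.
Qed.

Definition nterm (s : C) (n : nat) : C := Rcpow (INR (S n)) (- s).

(** The trapezoidal rule on [[n + 1, n + 2]], obtained from the explicit primitive [h] of the
    integrand. *)
Lemma zterm_0 n (s : C) : (s <> 1)%C ->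
  (s * zterm 0 0 n s)%C = (- / 2 * (nterm s (S n) + nterm s n)
     + (nterm (s - 1) (S n) - nterm (s - 1) n) / (1 - s))%C.
Proof.
  intros Hs. assert (P := INR_S_pos n).
  assert (N : (1 - s <> 0)%C) by (intros E; apply Hs; symmetry; now apply Ceq_minus).
  set (h := fun u => (RtoC (/ 2 - u) * Rcpow (INR (S n) + u) (- s) + / (1 - s) * Rcpow (INR (S n) + u) (1 - s))%C).
  assert (C1 := zint_cont 0 0 n s).
  unfold zterm. rewrite <- CInt_scal; [| lra | exact C1].
  transitivity (h 1 - h 0)%C.
  - apply CInt_FTC; [lra | | now apply cont_on_scal].
    intros u Hu.
    assert (D : is_derive (fun u => / 2 - u) u (- (1))) by (auto_derive; trivial; ring).
    destruct (cpath_mult_real (fun u => / 2 - u) (fun u => Rcpow (INR (S n) + u) (- s)) u _ _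
        D (cpath_Rcpow (INR (S n)) u (- s) ltac:(lra))) as [A1 B1].
    destruct (cpath_comp (fun z => / (1 - s) * z)%C (fun u => Rcpow (INR (S n) + u) (1 - s)) u _ _
        (cderiv_scal (/ (1 - s)) (fun z => z) _ _ (cderiv_id _)) (cpath_Rcpow (INR (S n)) u (1 - s) ltac:(lra))) as [A2 B2].
    assert (K : cpath h u ((RtoC (- (1)) * Rcpow (INR (S n) + u) (- s) +
      RtoC (/ 2 - u) * (- s * Rcpow (INR (S n) + u) (- s - 1))) +
      ((1 - s) * Rcpow (INR (S n) + u) (1 - s - 1)) * (/ (1 - s) * 1))%C).
    { split; [exact (is_derive_plus _ _ _ _ _ A1 A2) | exact (is_derive_plus _ _ _ _ _ B1 B2)]. }
    replace (s * zint 0 0 n s u)%C with ((RtoC (- (1)) * Rcpow (INR (S n) + u) (- s) +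
      RtoC (/ 2 - u) * (- s * Rcpow (INR (S n) + u) (- s - 1))) +
      ((1 - s) * Rcpow (INR (S n) + u) (1 - s - 1)) * (/ (1 - s) * 1))%C; [exact K|].
    unfold zint. rewrite pow_O, Rmult_1_r. simpl bern. simpl (INR 1).
    replace (- (s + 1))%C with (- s - 1)%C by ring. replace (1 - s - 1)%C with (- s)%C by ring.
    rewrite RtoC_opp, !RtoC_minus. field. exact N.
  - unfold h, nterm. rewrite Rplus_0_r.
    replace (INR (S n) + 1) with (INR (S (S n))) by (rewrite (S_INR (S n)); ring).
    replace (- (s - 1))%C with (1 - s)%C by ring.
    replace (/ 2 - 1) with (- / 2) by field. rewrite Rminus_0_r, RtoC_opp, RtoC_inv by lra. field.
    exact N.
Qed.

Lemma cser_nterm (s : C) : 1 < Re s -> cser (nterm s) (zeta s).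
Proof.
  intros Hs.
  assert (Ns : s <> 1%C) by (intros ->; simpl in Hs; lra).
  assert (N : (1 - s <> 0)%C) by (intros E; apply Ns; symmetry; now apply Ceq_minus).
  assert (N' : (s - 1 <> 0)%C) by (intros E; apply Ns; now apply Ceq_minus).
  (* The halves of the trapezoidal rule pair up to the full partial sum and the powers with exponent
     [1 - s] telescope; the two boundary terms left at [n] tend to 0 for [Re s > 1]. *)
  assert (Hsum : forall n, csum (fun n => s * zterm 0 0 n s)%C n =
    (- csum (nterm s) n + / 2 - / 2 * nterm s n + (nterm (s - 1) n - 1) / (1 - s))%C).
  { induction n.
    - simpl. unfold nterm. simpl (INR 1). rewrite !Rcpow_1_l. field. exact N.
    - simpl csum. rewrite IHn, zterm_0 by exact Ns. field. exact N. }
  rewrite zeta_right by lra.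
  assert (CZ := cser_scal s _ _ (zser_cser 0 0 s ltac:(simpl; lra))).
  intros eps He.
  destruct (CZ (eps / 3)) as [N1 H1]; [lra|].
  destruct (Rcpow_lim s) with (eps := eps / 3) as [N2 H2]; [lra | lra |].
  assert (P1 : 0 < Cmod (1 - s)) by now apply Cmod_gt_0.
  destruct (Rcpow_lim (s - 1)) with (eps := eps / 3 * Cmod (1 - s)) as [N3 H3].
  { unfold Re in *; simpl; lra. }
  { apply Rmult_lt_0_compat; lra. }
  exists (max N1 (max N2 N3)). intros n Hn.
  specialize (H1 n ltac:(lia)). specialize (H2 n ltac:(lia)). specialize (H3 n ltac:(lia)).
  fold (nterm s n) in H2. fold (nterm (s - 1) n) in H3.
  rewrite Hsum in H1.
  replace (csum (nterm s) n - (/ (s - 1) + / 2 - s * zser 0 0 s))%C with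
    (- (- csum (nterm s) n + / 2 - / 2 * nterm s n + (nterm (s - 1) n - 1) / (1 - s) - s * zser 0 0 s)
      - / 2 * nterm s n + nterm (s - 1) n / (1 - s))%C.
  2:{ field. repeat split; assumption. }
  eapply Rle_lt_trans; [apply Cmod_triangle|].
  eapply Rle_lt_trans; [apply Rplus_le_compat_r, Cmod_triangle_minus|].
  rewrite Cmod_opp, Cmod_mult, Cmod_div by exact N.
  assert (Q : Cmod (/ 2) = / 2) by (rewrite <- RtoC_inv, Cmod_R, Rabs_pos_eq; lra).
  rewrite Q.
  assert (K3 : Cmod (nterm (s - 1) n) / Cmod (1 - s) < eps / 3).
  { apply Rmult_lt_reg_r with (Cmod (1 - s)); [assumption|].
    unfold Rdiv at 1. rewrite Rmult_assoc, Rinv_l by lra. lra. }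
  generalize (Cmod_ge_0 (nterm s n)). lra.
Qed.

(** * The Moebius function *)

Lemma mod_eqb_divide (d n : nat) : (0 < d)%nat -> (n mod d =? 0)%nat = true <-> Nat.divide d n.
Proof.
  intros Hd. rewrite Nat.eqb_eq. split; intros H.
  - apply Nat.Lcm0.mod_divide. exact H.
  - apply Nat.Lcm0.mod_divide. exact H.
Qed.

(** * Least prime factors *)

Fixpoint lpf_from (fuel d n : nat) : nat :=
  match fuel with
  | O => d
  | S f => if (n mod d =? 0)%nat then d else lpf_from f (S d) n
  end.

Definition lpf (n : nat) : nat := lpf_from n 2 n.

Definition is_lpf (p n : nat) : Prop :=
  (2 <= p)%nat /\ Nat.divide p n /\ (forall e, (2 <= e)%nat -> Nat.divide e n -> (p <= e)%nat).

Lemma lpf_spec n : (2 <= n)%nat -> is_lpf (lpf n) n.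
Proof.
  intros Hn. unfold lpf.
  assert (H : forall f d, (2 <= d <= n)%nat -> (n <= d + f)%nat ->
    (forall e, (2 <= e < d)%nat -> ~ Nat.divide e n) -> is_lpf (lpf_from f d n) n).
  { induction f; intros d Hd Hf Hlow.
    - assert (d = n) as -> by lia. simpl. split; [lia|split].
      + apply Nat.divide_refl.
      + intros e He Hde. destruct (Nat.le_gt_cases n e); [assumption|].
        exfalso. apply (Hlow e); [lia | assumption].
    - simpl. destruct (n mod d =? 0)%nat eqn:E.
      + apply mod_eqb_divide in E; [|lia]. split; [lia|split; [assumption|]].
        intros e He Hde. destruct (Nat.le_gt_cases d e); [assumption|].
        exfalso. apply (Hlow e); [lia | assumption].
      + assert (ND : ~ Nat.divide d n).
        { intros Hd'. apply mod_eqb_divide in Hd'; [congruence | lia]. }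
        assert (d <> n) by (intros ->; apply ND, Nat.divide_refl).
        apply IHf; [lia | lia |]. intros e He.
        destruct (Nat.eq_dec e d) as [->|]; [assumption|]. apply Hlow. lia. }
  apply H; [lia | lia |]. intros e He. lia.
Qed.

Lemma is_lpf_unique p q n : is_lpf p n -> is_lpf q n -> p = q.
Proof.
  intros (A1 & A2 & A3) (B1 & B2 & B3). apply Nat.le_antisymm; auto.
Qed.

(** A common divisor above 1 of [p] and [e] also divides [n], so by minimality it is at least [p],
    hence equal to [p]. This is how primality of [p] enters without being mentioned. *)
Lemma is_lpf_coprime p n e : is_lpf p n -> ~ Nat.divide p e -> Nat.gcd p e = 1%nat.
Proof.
  intros (H1 & H2 & H3) Hp.
  destruct (Nat.gcd_divide_l p e) as [x Hx].
  assert (G1 := Nat.gcd_divide_l p e). assert (G2 := Nat.gcd_divide_r p e).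
  set (g := Nat.gcd p e) in *.
  destruct (Nat.le_gt_cases 2 g) as [L|L].
  - assert (p <= g)%nat by (apply H3; [assumption | now apply Nat.divide_trans with p]).
    assert (g <= p)%nat by (apply Nat.divide_pos_le; [lia | assumption]).
    exfalso. apply Hp. now replace p with g by lia.
  - assert (g <> 0)%nat by lia. lia.
Qed.

(** Fuel replaces well-founded recursion, and [n] is enough of it because [n / lpf n < n]. The
    second test detects a square of the least prime factor. The value at 0 is a default. *)
Fixpoint mu_fuel (f n : nat) : R :=
  match f with
  | O => 1
  | S f' => if (n <=? 1)%nat then 1
            else if ((n / lpf n) mod lpf n =? 0)%nat then 0 else - mu_fuel f' (n / lpf n)
  end.

Definition mu (n : nat) : R := mu_fuel n n.

Lemma div_lpf_lt n : (2 <= n)%nat -> (n / lpf n < n)%nat.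
Proof.
  intros Hn. destruct (lpf_spec n Hn) as (H & _). apply Nat.div_lt; lia.
Qed.

Lemma mu_fuel_indep f g n : (n <= f)%nat -> (n <= g)%nat -> mu_fuel f n = mu_fuel g n.
Proof.
  revert g n. induction f; intros g n Hf Hg.
  - assert (n = 0%nat) as -> by lia. now destruct g.
  - destruct g; [assert (n = 0%nat) as -> by lia; reflexivity|].
    simpl. destruct (n <=? 1)%nat eqn:E; [reflexivity|].
    apply Nat.leb_gt in E. destruct (_ =? 0)%nat; [reflexivity|].
    assert (K := div_lpf_lt n E). rewrite (IHf g); [reflexivity | lia | lia].
Qed.

Lemma mu_1 : mu 1 = 1.
Proof. reflexivity. Qed.

Lemma mu_step n : (2 <= n)%nat ->
  mu n = if ((n / lpf n) mod lpf n =? 0)%nat then 0 else - mu (n / lpf n).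
Proof.
  intros Hn. assert (K := div_lpf_lt n Hn). unfold mu at 1.
  replace (mu_fuel n n) with (mu_fuel (S (n - 1)) n) by (f_equal; lia).
  simpl mu_fuel.
  destruct (n <=? 1)%nat eqn:E; [apply Nat.leb_le in E; lia|].
  destruct (_ =? 0)%nat; [reflexivity|].
  f_equal. apply mu_fuel_indep; lia.
Qed.

Lemma mu_abs_le n : Rabs (mu n) <= 1.
Proof.
  induction n as [n IH] using lt_wf_ind.
  destruct (Nat.le_gt_cases 2 n) as [L|L].
  - rewrite mu_step by assumption. destruct (_ =? 0)%nat; [rewrite Rabs_R0; lra|].
    rewrite Rabs_Ropp. apply IH. now apply div_lpf_lt.
  - destruct n as [|[|n]]; [| |lia]; unfold mu; simpl; rewrite Rabs_R1; lra.
Qed.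

Lemma mu_lpf_mult p e : (1 <= e)%nat -> is_lpf p (p * e) ->
  mu (p * e) = if (e mod p =? 0)%nat then 0 else - mu e.
Proof.
  intros He Hp. assert (H2 := Hp). destruct H2 as (H2 & _).
  assert (Hn : (2 <= p * e)%nat) by nia.
  rewrite mu_step by assumption.
  rewrite (is_lpf_unique _ _ _ (lpf_spec _ Hn) Hp).
  rewrite Nat.mul_comm, Nat.div_mul by lia. reflexivity.
Qed.

(** * Sums over divisors and Moebius inversion *)

Lemma rsum_plus f g n : rsum (fun k => f k + g k) n = rsum f n + rsum g n.
Proof. induction n; simpl; [ring|]. rewrite IHn; ring. Qed.

Lemma rsum_0 f n : (forall k, (k < n)%nat -> f k = 0) -> rsum f n = 0.
Proof. intros H. induction n; simpl; [reflexivity|]. rewrite IHn, H by auto. ring. Qed.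

Lemma rsum_add f m n : rsum f (m + n) = rsum f m + rsum (fun k => f (m + k)%nat) n.
Proof.
  induction n; simpl; [rewrite Nat.add_0_r; ring|].
  rewrite Nat.add_succ_r. simpl. rewrite IHn. ring.
Qed.

Lemma rsum_extend f m n : (m <= n)%nat -> (forall k, (m <= k)%nat -> f k = 0) -> rsum f n = rsum f m.
Proof.
  intros H H0. replace n with (m + (n - m))%nat by lia. rewrite rsum_add.
  rewrite (rsum_0 (fun k => f (m + k)%nat)); [ring|]. intros; apply H0; lia.
Qed.

Lemma rsum_multiples (g : nat -> R) p n : (2 <= p)%nat ->
  rsum (fun i => if (S i mod p =? 0)%nat then g (S i) else 0) (p * n) = rsum (fun e => g (p * S e)%nat) n.
Proof.
  intros Hp. induction n; [rewrite Nat.mul_0_r; reflexivity|].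
  replace (p * S n)%nat with (p * n + p)%nat by lia. rewrite rsum_add, IHn. simpl rsum at 3. f_equal.
  assert (HF : forall F, rsum F p = rsum F (p - 1) + F (p - 1)%nat).
  { intros F. replace p with (S (p - 1)) at 1 by lia. reflexivity. }
  rewrite HF, rsum_0.
  - replace (S (p * n + (p - 1)))%nat with (p * S n)%nat by lia.
    assert (E : ((p * S n) mod p = 0)%nat) by (rewrite Nat.mul_comm; apply Nat.Div0.mod_mul).
    rewrite E. simpl (0 =? 0)%nat. cbv iota. ring.
  - intros k Hk. replace (S (p * n + k))%nat with (S k + n * p)%nat by lia.
    rewrite Nat.Div0.mod_add, Nat.mod_small by lia. reflexivity.
Qed.

Definition divsum (f : nat -> R) (n : nat) : R :=
  rsum (fun i => if (n mod S i =? 0)%nat then f (S i) else 0) n.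

(* Divisors [d] and [p d] with [p] prime to [d] cancel, where [p] is the least prime factor of [n]. *)
Lemma divsum_mu n : (2 <= n)%nat -> divsum mu n = 0.
Proof.
  intros Hn. set (p := lpf n). assert (Hp : is_lpf p n) by now apply lpf_spec.
  assert (Hp' := Hp). destruct Hp' as (P1 & P2 & P3).
  set (g := fun d => if (n mod d =? 0)%nat then mu d else 0).
  assert (Big : forall d, (n < d)%nat -> g d = 0).
  { intros d Hd. unfold g. rewrite Nat.mod_small by assumption.
    destruct (n =? 0)%nat eqn:E; [apply Nat.eqb_eq in E; lia | reflexivity]. }
  unfold divsum. change (rsum (fun i => g (S i)) n = 0).
  (* Summing up to [p * n] adds only zeros and makes the multiples [p * e] in range correspond
     exactly to the [e <= n]. *)
  rewrite <- (rsum_extend _ n (p * n)); [| nia | intros k Hk; apply Big; lia].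
  rewrite (rsum_ext _ (fun i => (if (S i mod p =? 0)%nat then 0 else g (S i)) +
    (if (S i mod p =? 0)%nat then g (S i) else 0))).
  2:{ intros k _. destruct (S k mod p =? 0)%nat; ring. }
  rewrite rsum_plus, rsum_multiples by assumption.
  rewrite (rsum_extend _ n (p * n)); [| nia |].
  2:{ intros k Hk. destruct (S k mod p =? 0)%nat; [reflexivity | apply Big; lia]. }
  rewrite <- rsum_plus. apply rsum_0. intros i Hi. set (e := S i).
  assert (He : (1 <= e)%nat) by (unfold e; lia).
  assert (Lp : Nat.divide (p * e) n -> is_lpf p (p * e)).
  { intros Hd. split; [assumption|split].
    - now exists e; lia.
    - intros d Hd1 Hd2. apply P3; [assumption | now apply Nat.divide_trans with (p * e)%nat]. }
  destruct (e mod p =? 0)%nat eqn:E.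
  - unfold g. destruct (n mod (p * e) =? 0)%nat eqn:F; [|ring].
    apply mod_eqb_divide in F; [|nia].
    rewrite mu_lpf_mult, E by auto. ring.
  - assert (Np : ~ Nat.divide p e).
    { intros Hd. apply mod_eqb_divide in Hd; [congruence | lia]. }
    (* Since [p] is prime to [e], Gauss's lemma shows that [p * e] divides [n] as soon as [e] does;
       the terms of [e] and [p * e] are then both present, with opposite signs. *)
    assert (Q : (n mod (p * e) =? 0)%nat = (n mod e =? 0)%nat).
    { apply eq_true_iff_eq. rewrite !mod_eqb_divide by nia. split.
      - intros Hd. apply Nat.divide_trans with (p * e)%nat; [now exists p | assumption].
      - intros [y Hy]. destruct P2 as [z Hz].
        assert (Hpy : Nat.divide p y).
        { apply (Nat.gauss p e y); [exists z; lia | now apply (is_lpf_coprime p n)]. }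
        destruct Hpy as [t Ht]. exists t. subst y. lia. }
    unfold g. rewrite Q. destruct (n mod e =? 0)%nat eqn:F; [|ring].
    apply mod_eqb_divide in Q; [|nia].
    rewrite mu_lpf_mult, E by auto. ring.
Qed.

Lemma div_S n d : (0 < d)%nat ->
  (S n / d = n / d + (if (S n mod d =? 0)%nat then 1 else 0))%nat.
Proof.
  intros Hd.
  assert (E1 := Nat.div_mod_eq n d). assert (B1 := Nat.mod_upper_bound n d ltac:(lia)).
  assert (E2 := Nat.div_mod_eq (S n) d). assert (B2 := Nat.mod_upper_bound (S n) d ltac:(lia)).
  destruct (S n mod d =? 0)%nat eqn:E.
  - apply Nat.eqb_eq in E. rewrite E in E2. nia.
  - apply Nat.eqb_neq in E. nia.
Qed.

(** Pairs with product at most [N], grouped by their product. Passing from [N] to [S N] adds exactly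
    the pairs with product [S N], by [div_S]. *)
Lemma csum_regroup (F : nat -> nat -> C) N :
  csum (fun i => csum (fun j => F (S i) (S j)) (N / S i)) N =
  csum (fun k => csum (fun i => if (S k mod S i =? 0)%nat then F (S i) (S k / S i)%nat else 0%C) (S k)) N.
Proof.
  induction N; [reflexivity|].
  transitivity (csum (fun i => csum (fun j => F (S i) (S j)) (N / S i) +
    (if (S N mod S i =? 0)%nat then F (S i) (S N / S i)%nat else 0))%C (S N)).
  - apply csum_ext. intros i Hi. rewrite (div_S N (S i)) by lia.
    destruct (S N mod S i =? 0)%nat eqn:E.
    + rewrite Nat.add_1_r. reflexivity.
    + rewrite Nat.add_0_r. ring.
  - rewrite csum_plus.
    change (csum (fun k => csum (fun i => if (S k mod S i =? 0)%nat then F (S i) (S k / S i)%nat else 0%C) (S k)) (S N))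
      with (csum (fun k => csum (fun i => if (S k mod S i =? 0)%nat then F (S i) (S k / S i)%nat else 0%C) (S k)) N
       + csum (fun i => if (S N mod S i =? 0)%nat then F (S i) (S N / S i)%nat else 0%C) (S N))%C.
    f_equal. rewrite <- IHN.
    change (csum (fun i => csum (fun j => F (S i) (S j)) (N / S i)) N +
      csum (fun j => F (S N) (S j)) (N / S N) = csum (fun i => csum (fun j => F (S i) (S j)) (N / S i)) N)%C.
    rewrite (Nat.div_small N (S N)) by lia. simpl. ring.
Qed.

Lemma csum_RtoC f n : csum (fun k => RtoC (f k)) n = RtoC (rsum f n).
Proof. induction n; simpl; [reflexivity|]. rewrite IHn, RtoC_plus. reflexivity. Qed.

Lemma rsum_regroup (F : nat -> nat -> R) N :
  rsum (fun i => rsum (fun j => F (S i) (S j)) (N / S i)) N =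
  rsum (fun k => rsum (fun i => if (S k mod S i =? 0)%nat then F (S i) (S k / S i)%nat else 0) (S k)) N.
Proof.
  apply RtoC_inj. rewrite <- !csum_RtoC.
  rewrite (csum_ext (fun k => RtoC (rsum (fun j => F (S k) (S j)) (N / S k)))
    (fun i => csum (fun j => RtoC (F (S i) (S j))) (N / S i))) by (intros; symmetry; apply csum_RtoC).
  rewrite (csum_regroup (fun d e => RtoC (F d e))). apply csum_ext. intros k _.
  rewrite <- csum_RtoC. apply csum_ext. intros i _. now destruct (_ =? 0)%nat.
Qed.

Lemma csum_0 (f : nat -> C) n : (forall k, (k < n)%nat -> f k = 0%C) -> csum f n = 0%C.
Proof. intros H. induction n; simpl; [reflexivity|]. rewrite IHn, H by auto. ring. Qed.

Lemma csum_shift f n : csum f (S n) = (f O + csum (fun k => f (S k)) n)%C.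
Proof. induction n; simpl; [ring|]. simpl in IHn. rewrite IHn. ring. Qed.

(** Grouping by the product leaves the divisor sums of [mu], which vanish except at 1. The identity
    is exact at every finite [N], so no product of infinite series has to be rearranged. *)
Lemma mu_nterm_sum (s : C) N : (1 <= N)%nat ->
  csum (fun i => RtoC (mu (S i)) * nterm s i * csum (nterm s) (N / S i))%C N = 1%C.
Proof.
  intros HN.
  rewrite (csum_ext _ (fun i => csum (fun j => RtoC (mu (S i)) * Rcpow (INR (S i)) (- s) * Rcpow (INR (S j)) (- s))%C (N / S i)))
    by (intros i _; rewrite <- csum_scal; reflexivity).
  rewrite (csum_regroup (fun d e => RtoC (mu d) * Rcpow (INR d) (- s) * Rcpow (INR e) (- s))%C).
  rewrite (csum_ext _ (fun k => nterm s k * RtoC (divsum mu (S k)))%C).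
  - destruct N; [lia|]. rewrite csum_shift, (csum_0 (fun k => nterm s (S k) * RtoC (divsum mu (S (S k))))%C).
    + unfold nterm. simpl (INR 1). rewrite Rcpow_1_l. assert (D1 : divsum mu 1 = 1) by (unfold divsum; simpl; rewrite mu_1; ring).
      rewrite D1. ring.
    + intros k _. rewrite divsum_mu by lia. ring.
  - intros k _. unfold divsum. rewrite <- csum_RtoC, <- csum_scal. apply csum_ext. intros i Hi.
    destruct (S k mod S i =? 0)%nat eqn:E; [|ring].
    apply mod_eqb_divide in E; [|lia]. destruct E as [q Hq].
    assert (Q : (S k / S i = q)%nat) by (rewrite Hq; apply Nat.div_mul; lia).
    rewrite Q. unfold nterm. rewrite Hq, mult_INR.
    assert (0 < q)%nat by (destruct q; lia).
    rewrite Rcpow_mult_l; [ring | now apply lt_0_INR | apply INR_S_pos].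
Qed.

(** * The Dirichlet series of mu as inverse of zeta *)

Lemma cser_tail f l M n : cser f l -> (forall k, Cmod (f k) <= M k) -> ex_series M ->
  Cmod (l - csum f n) <= Series M - rsum M n.
Proof.
  intros Hl HM HS. apply Rle_of_eps. intros eps He.
  destruct (Hl eps He) as [N HN]. specialize (HN (n + N)%nat ltac:(lia)).
  assert (P : forall k, 0 <= M k) by (intros k; eapply Rle_trans; [apply Cmod_ge_0 | apply HM]).
  assert (A : Cmod (csum f (n + N) - csum f n) <= rsum M (n + N) - rsum M n).
  { clear - HM. induction N.
    - rewrite Nat.add_0_r. replace (csum f n - csum f n)%C with (RtoC 0) by ring. rewrite Cmod_0. lra.
    - rewrite Nat.add_succ_r. simpl.
      replace (csum f (n + N) + f (n + N)%nat - csum f n)%C with (csum f (n + N) - csum f n + f (n + N)%nat)%C by ring.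
      eapply Rle_trans; [apply Cmod_triangle|]. specialize (HM (n + N)%nat). lra. }
  assert (B := rsum_le_Series M (n + N) P HS).
  replace (l - csum f n)%C with ((csum f (n + N) - csum f n) - (csum f (n + N) - l))%C by ring.
  eapply Rle_trans; [apply Cmod_triangle_minus|]. lra.
Qed.

Lemma Cmod_nterm s n : Cmod (nterm s n) = npow (Re s) n.
Proof.
  unfold nterm, npow. rewrite Cmod_Rcpow. reflexivity.
Qed.

Definition muterm (s : C) (n : nat) : C := (RtoC (mu (S n)) * nterm s n)%C.

Lemma Cmod_muterm s n : Cmod (muterm s n) <= npow (Re s) n.
Proof.
  unfold muterm. rewrite Cmod_mult, Cmod_R, Cmod_nterm.
  generalize (mu_abs_le (S n)) (npow_pos (Re s) n). nra.
Qed.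

(** Comparison with the finite identity [mu_nterm_sum]: the error is the sum of [muterm s i] times
    the tail of zeta beyond [N / S i]. *)
Lemma zeta_mu (s : C) : 1 < Re s -> cser (muterm s) (CSer (muterm s)) /\ (zeta s * CSer (muterm s) = 1)%C.
Proof.
  intros Hs. set (M := npow (Re s)).
  assert (HM : ex_series M) by now apply ex_series_npow.
  assert (PM : forall k, 0 <= M k) by (intros; left; apply npow_pos).
  assert (CM : cser (muterm s) (CSer (muterm s))) by (apply (cser_dom _ M); [apply Cmod_muterm | exact HM]).
  split; [exact CM|].
  assert (CZ := cser_nterm s Hs).
  apply (cser_unique (fun n => zeta s * muterm s n)%C); [now apply cser_scal|].
  intros eps He.
  set (T := Series M).
  assert (PT : 0 <= T) by (apply Rle_trans with (rsum M 0); [simpl; lra | now apply rsum_le_Series]).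
  destruct (rsum_lim M HM (eps / (2 * T + 1))) as [K0 HK]; [apply Rdiv_lt_0_compat; lra|].
  set (K := S K0). specialize (HK K ltac:(unfold K; lia)).
  set (t := T - rsum M K).
  assert (Ht : 0 <= t < eps / (2 * T + 1)).
  { unfold t. assert (L := rsum_le_Series M K PM HM). fold T in HK, L. apply Rabs_def2 in HK. lra. }
  (* For [N >= K * K] the indices [i < K] have [N / S i >= K], hence a tail of at most [t]. For the
     other indices the tail is at most [T] and the sum of [M i] is at most [t]. Together this is at
     most [2 * T * t]. *)
  exists (K * K)%nat. intros N HN. rewrite csum_scal.
  rewrite <- (mu_nterm_sum s N) by (unfold K in *; nia).
  rewrite <- csum_scal, <- csum_minus.
  assert (Tl : forall k, Cmod (zeta s - csum (nterm s) k) <= T - rsum M k).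
  { intros k. apply cser_tail; [exact CZ | intros; right; apply Cmod_nterm | exact HM]. }
  apply Rle_lt_trans with (rsum (fun i => t * M i + T * (if (i <? K)%nat then 0 else M i)) N).
  - apply csum_norm_le. intros i Hi.
    replace (zeta s * muterm s i - RtoC (mu (S i)) * nterm s i * csum (nterm s) (N / S i))%C
      with (muterm s i * (zeta s - csum (nterm s) (N / S i)))%C by (unfold muterm; ring).
    rewrite Cmod_mult.
    assert (A1 := Cmod_muterm s i). fold M in A1.
    assert (A2 := Tl (N / S i)%nat).
    assert (Mo : forall a b, (a <= b)%nat -> rsum M a <= rsum M b).
    { intros a b Hab. replace b with (a + (b - a))%nat by lia. rewrite rsum_add.
      assert (0 <= rsum (fun k => M (a + k)%nat) (b - a)) by (apply rsum_nonneg; auto). lra. }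
    destruct (i <? K)%nat eqn:E.
    + apply Nat.ltb_lt in E.
      assert (KN : (K <= N / S i)%nat).
      { apply Nat.div_le_lower_bound; [lia|]. nia. }
      specialize (Mo _ _ KN).
      replace (t * M i + T * 0) with (M i * t) by ring.
      apply Rmult_le_compat; [apply Cmod_ge_0 | apply Cmod_ge_0 | exact A1 | unfold t; lra].
    + assert (R0 : 0 <= rsum M (N / S i)) by (apply rsum_nonneg; auto).
      apply Rle_trans with (M i * T).
      * apply Rmult_le_compat; [apply Cmod_ge_0 | apply Cmod_ge_0 | exact A1 | lra].
      * specialize (PM i). nra.
  - rewrite rsum_plus, !rsum_scal.
    assert (S1 : rsum M N <= T) by now apply rsum_le_Series.
    assert (S2 : rsum (fun i => if (i <? K)%nat then 0 else M i) N = rsum M N - rsum M K).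
    { replace N with (K + (N - K))%nat by nia. rewrite !rsum_add.
      rewrite rsum_0.
      - rewrite (rsum_ext (fun k => if (K + k <? K)%nat then 0 else M (K + k)%nat) (fun k => M (K + k)%nat)); [ring|].
        intros k _. destruct (K + k <? K)%nat eqn:E; [apply Nat.ltb_lt in E; lia | reflexivity].
      - intros k Hk. apply Nat.ltb_lt in Hk. now rewrite Hk. }
    rewrite S2.
    assert (B1 : t * rsum M N <= t * T) by (apply Rmult_le_compat_l; lra).
    assert (B2 : T * (rsum M N - rsum M K) <= T * t) by (apply Rmult_le_compat_l; unfold t; lra).
    assert (B3 : t * (2 * T + 1) < eps).
    { destruct Ht as [_ Ht]. apply Rmult_lt_compat_r with (r := 2 * T + 1) in Ht; [|lra].
      replace (eps / (2 * T + 1) * (2 * T + 1)) with eps in Ht by (field; lra). exact Ht. }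
    lra.
Qed.

(** The Moebius series is an inverse of zeta, which gives non-vanishing and the bound at once,
    without an Euler product. *)
Lemma zeta_lower (s : C) : 1 < Re s -> zeta s <> 0%C /\ Cmod (/ zeta s) <= Series (npow (Re s)).
Proof.
  intros Hs. destruct (zeta_mu s Hs) as [H1 H2].
  assert (N : zeta s <> 0%C).
  { intros E. rewrite E, Cmult_0_l in H2. apply C1_nz. now symmetry. }
  split; [exact N|].
  replace (/ zeta s)%C with (CSer (muterm s)).
  - apply CSer_le; [apply Cmod_muterm | now apply ex_series_npow].
  - replace (CSer (muterm s)) with (/ zeta s * (zeta s * CSer (muterm s)))%C by (field; exact N).
    rewrite H2. ring.
Qed.

Lemma zeta_upper (s : C) : 1 < Re s -> Cmod (zeta s) <= Series (npow (Re s)).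
Proof.
  intros Hs. apply (cser_le (nterm s)); [now apply cser_nterm|].
  intros n. eapply Rle_trans; [apply (csum_norm_le _ (npow (Re s))); intros; right; apply Cmod_nterm|].
  apply rsum_le_Series; [intros; left; apply npow_pos | now apply ex_series_npow].
Qed.

(** * Growth of 1 / Z under the Riemann hypothesis *)

Lemma cderiv_is_derive (f : C -> C) (z l : C) : cderiv f z l ->
  is_derive (K := C_AbsRing) (V := C_NormedModule) f z l.
Proof.
  intros H. split.
  - apply (is_linear_scal_l (K := C_AbsRing) (V := C_NormedModule) l).
  - intros x Hx. apply (is_filter_lim_locally_unique (V := AbsRing_NormedModule C_AbsRing)) in Hx. subst x.
    intros eps. destruct (H eps (cond_pos eps)) as (d & Hd & Hw).
    exists (mkposreal _ Hd). intros w Hb. apply Hw. exact Hb.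
Qed.

Lemma cser_is_series (f : nat -> C) (l : C) : cser f l ->
  is_series (K := C_AbsRing) (V := C_NormedModule) f l.
Proof.
  intros H P [e He]. destruct (H e (cond_pos e)) as [N HN].
  exists N. intros n Hn. apply He.
  assert (E : forall n, sum_n (G := C_AbelianMonoid) f n = csum f (S n)).
  { intros m. induction m.
    - rewrite sum_O. simpl. ring.
    - rewrite sum_Sn, IHm. reflexivity. }
  specialize (HN (S n) ltac:(lia)). rewrite <- E in HN.
  split.
  - eapply Rle_lt_trans; [|exact HN]. exact (re_le_Cmod (sum_n (G := C_AbelianMonoid) f n - l)).
  - eapply Rle_lt_trans; [|exact HN]. exact (Im_le_Cmod (sum_n (G := C_AbelianMonoid) f n - l)).
Qed.

(** Makes the Riemann hypothesis applicable to the [zeta] constructed here; this is the reason for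
    continuing it beyond [Re s > 0]. *)
Lemma zeta_is_riemann_zeta : is_riemann_zeta zeta.
Proof.
  split.
  - intros s Hs. destruct (zeta_deriv s Hs) as [l Hl]. exists l. now apply cderiv_is_derive.
  - intros s Hs. apply cser_is_series. exact (cser_nterm s Hs).
Qed.

(* [(s - 1) * zeta s], without its removable singularity. *)
Definition Zf (s : C) : C := (1 + (s - 1) / 2 - s * (s - 1) * zser 0 0 s)%C.
Definition Zf' (s : C) : C := (/ 2 - (2 * s - 1) * zser 0 0 s + s * (s - 1) * zser 0 1 s)%C.
Definition Zf'' (s : C) : C :=
  (- 2 * zser 0 0 s + 2 * (2 * s - 1) * zser 0 1 s - s * (s - 1) * zser 0 2 s)%C.

Lemma zser0_deriv j (s : C) : 0 < Re s -> cderiv (zser 0 j) s (- zser 0 (S j) s)%C.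
Proof. intros Hs. apply zser_deriv. simpl. lra. Qed.

Lemma cderiv_s_s1 (s : C) : cderiv (fun s => s * (s - 1))%C s (2 * s - 1)%C.
Proof.
  eapply cderiv_eq.
  - apply cderiv_mult; [apply cderiv_id|]. apply cderiv_minus; [apply cderiv_id | apply cderiv_const].
  - cbv beta; ring.
Qed.

Lemma Zf_deriv (s : C) : 0 < Re s -> cderiv Zf s (Zf' s).
Proof.
  intros Hs. unfold Zf. eapply cderiv_eq.
  - apply cderiv_minus.
    + apply cderiv_plus; [apply cderiv_const|].
      apply (cderiv_mult (fun s => s - 1)%C (fun _ => / 2)%C); [|apply cderiv_const].
      apply cderiv_minus; [apply cderiv_id | apply cderiv_const].
    + apply (cderiv_mult (fun s => s * (s - 1))%C (zser 0 0)); [apply cderiv_s_s1 | now apply zser0_deriv].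
  - cbv beta. unfold Zf'. ring.
Qed.

Lemma Zf'_deriv (s : C) : 0 < Re s -> cderiv Zf' s (Zf'' s).
Proof.
  intros Hs. unfold Zf'. eapply cderiv_eq.
  - apply cderiv_plus.
    + apply cderiv_minus; [apply cderiv_const|].
      apply (cderiv_mult (fun s => 2 * s - 1)%C (zser 0 0)); [|now apply zser0_deriv].
      apply cderiv_minus; [apply cderiv_scal; apply cderiv_id | apply cderiv_const].
    + apply (cderiv_mult (fun s => s * (s - 1))%C (zser 0 1)); [apply cderiv_s_s1 | now apply zser0_deriv].
  - cbv beta. unfold Zf''. ring.
Qed.

Lemma Zf''_cont (s : C) : 0 < Re s -> continuous Zf'' s.
Proof.
  intros Hs.
  assert (Ck : forall j, continuous (zser 0 j) s) by (intros j; exact (cderiv_cont _ _ _ (zser0_deriv j s Hs))).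
  assert (C1 : continuous (fun s : C => 2 * s - 1)%C s).
  { apply cont_Cminus; [|apply continuous_const]. apply cont_Cmult; [apply continuous_const | apply continuous_id]. }
  unfold Zf''. apply cont_Cminus.
  - apply cont_Cplus.
    + apply cont_Cmult; [apply continuous_const | apply Ck].
    + apply cont_Cmult; [|apply Ck]. apply cont_Cmult; [apply continuous_const | exact C1].
  - apply cont_Cmult; [|apply Ck]. exact (cderiv_cont _ _ _ (cderiv_s_s1 s)).
Qed.

Lemma Zf_zeta (s : C) : 0 < Re s -> s <> 1%C -> Zf s = ((s - 1) * zeta s)%C.
Proof.
  intros Hs Hn. rewrite zeta_right by assumption. unfold Zf. field.
  intros E; apply Hn; now apply Ceq_minus.
Qed.

(** The hypothesis excludes [s = 1], where [Zf] is 1 by direct evaluation. Elsewhere a zero of [Zf]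
    is a zero of zeta, and the trivial zeros lie too far to the left. *)
Lemma Zf_nonzero : riemann_hypothesis -> forall s : C, 1 / 2 < Re s -> Zf s <> 0%C.
Proof.
  intros RH s Hs E. destruct (Ceq_dec s 1) as [->|N].
  - unfold Zf in E. replace (1 + (1 - 1) / 2 - 1 * (1 - 1) * zser 0 0 1)%C with (RtoC 1) in E by field.
    now apply C1_nz.
  - rewrite Zf_zeta in E by (assumption || lra).
    assert (Z0 : zeta s = 0%C).
    { replace (zeta s) with (/ (s - 1) * ((s - 1) * zeta s))%C.
      - rewrite E. ring.
      - field. intros E'; apply N; now apply Ceq_minus. }
    assert (K := RH zeta zeta_is_riemann_zeta s N Z0).
    assert (1 / 2 = Re s); [|lra]. symmetry. apply K.
    intros m Em. rewrite Em in Hs. change (1 / 2 < - 2 * INR (S m)) in Hs.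
    generalize (INR_S_pos m). lra.
Qed.

(** The majorant has exponent [3 / 2], the least value of [Re s + 1]. A crude polynomial bound is
    enough, because only its logarithm enters [inv_Zf_bound]. *)
Lemma Zf_upper : exists C0, 1 <= C0 /\ forall s : C, 1 / 2 <= Re s -> Cmod (Zf s) <= C0 * ((1 + Cmod s) * (1 + Cmod s)).
Proof.
  destruct (bern_bounded 0) as (B & B0 & HB).
  set (M := fun n => B * (ln (INR n + 2) ^ 0 * npow (3 / 2) n)).
  assert (HM : ex_series M).
  { apply (ex_series_scal (V := R_NormedModule)). apply ex_series_log_npow. lra. }
  assert (PM : 0 <= Series M).
  { apply Rle_trans with (rsum M 0); [simpl; lra|]. apply rsum_le_Series; [|assumption].
    intros k. unfold M. rewrite pow_O, Rmult_1_l. apply Rmult_le_pos; [assumption | left; apply npow_pos]. }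
  exists (1 + Series M). split; [lra|]. intros s Hs.
  assert (I : Cmod (zser 0 0 s) <= Series M).
  { apply CSer_le; [|assumption]. intros n. apply zterm_bound; [exact HB | lra | simpl; lra]. }
  set (X := Cmod s). assert (PX : 0 <= X) by apply Cmod_ge_0.
  assert (X1 : Cmod (s - 1) <= 1 + X).
  { eapply Rle_trans; [apply Cmod_triangle_minus|]. rewrite Cmod_1. unfold X. lra. }
  assert (PX1 := Cmod_ge_0 (s - 1)). assert (PI0 := Cmod_ge_0 (zser 0 0 s)).
  unfold Zf. eapply Rle_trans; [apply Cmod_triangle_minus|].
  assert (A1 : Cmod (1 + (s - 1) / 2) <= 1 + (1 + X) / 2).
  { eapply Rle_trans; [apply Cmod_triangle|]. rewrite Cmod_1, Cmod_div.
    - rewrite Cmod_R, Rabs_pos_eq by lra. lra.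
    - intros E; injection E; lra. }
  rewrite !Cmod_mult. fold X.
  assert (A2 : X * Cmod (s - 1) * Cmod (zser 0 0 s) <= ((1 + X) * (1 + X)) * Series M).
  { apply Rmult_le_compat; [nra | assumption | | assumption]. apply Rmult_le_compat; lra. }
  assert (HX : 1 / 2 <= X) by (generalize (re_le_Cmod s) (Rle_abs (Re s)); unfold X; lra).
  nra.
Qed.

Lemma Rpower_ge_1 x c : 1 <= x -> 0 <= c -> 1 <= Rpower x c.
Proof. intros. rewrite <- (Rpower_O x) by lra. apply Rpower_le_exp; lra. Qed.

Lemma Series_npow_mono p q : 1 < p <= q -> Series (npow q) <= Series (npow p).
Proof.
  intros H. apply Series_le; [|apply ex_series_npow; lra].
  intros n. split; [left; apply npow_pos|]. apply Rpower_le_exp; [apply INR_S_ge_1 | lra].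
Qed.

Lemma Re_le_ln (z : C) (A : R) : 0 < A -> Cmod (Cexp z) <= A -> Re z <= ln A.
Proof.
  intros HA H. rewrite Cmod_Cexp in H. rewrite <- (ln_exp (Re z)).
  destruct H as [H|H]; [left; apply ln_increasing; [apply exp_pos | exact H] | right; now rewrite H].
Qed.

Lemma inv_Zf_bound : riemann_hypothesis -> forall delta eps, 0 < delta < 1 -> 0 < eps ->
  exists C1, 0 < C1 /\ forall sigma t, 1 / 2 + delta <= sigma <= 2 ->
    Cmod (/ Zf (sigma, t)) <= C1 * Rpower (1 + Rabs t) (- 1 + eps).
Proof.
  intros RH delta eps Hd He.
  destruct Zf_upper as (C0 & HC0 & HZ).
  set (S := Series (npow (3 / 2))).
  assert (S1 : 1 <= S).
  { assert (K := rsum_le_Series (npow (3 / 2)) 1 (fun k => Rlt_le _ _ (npow_pos _ k)) (ex_series_npow (3 / 2) ltac:(lra))).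
    simpl rsum in K. unfold npow at 1 in K. simpl INR in K. rewrite Rpower_1_l in K. unfold S. lra. }
  (* [rho] is the distance from 2 to the left edge [1 / 2 + delta]; [r2] lies halfway between [rho]
     and the radius [3 / 2] at which the critical line is met. *)
  set (rho := 3 / 2 - delta). set (r2 := 3 / 2 - delta / 2). set (q := rho / r2).
  assert (Hq : 0 <= q < 1).
  { unfold q, rho, r2. split; [apply Rdiv_le_0_compat; lra|].
    apply Rmult_lt_reg_r with (3 / 2 - delta / 2); [lra|].
    unfold Rdiv at 1. rewrite Rmult_assoc, Rinv_l by lra. lra. }
  (* The coefficient of [ln (1 + Rabs t)] in the bound for the logarithm will be
     [4 * q ^ K / (1 - q)]. The choice of [K] does not depend on [t]. *)
  destruct (pow_le_1_lim q (4 / (1 - q)) Hq eps He) as [K HK]. specialize (HK K (Nat.le_refl _)).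
  (* On the small circle the quotient of values of [Zf] is at most [(X + 1 / 2) * S * S / X], hence
     at most [2 * S * S]. On the large one [1 + Cmod s <= 5 * (1 + Rabs t)], whose square gives the
     25 in [c2]. *)
  set (A1 := ln (2 * (S * S))). set (c2 := 25 * C0 * S).
  assert (HA1 : 0 <= A1) by (unfold A1; rewrite <- ln_1; left; apply ln_increasing; nra).
  assert (Hc2 : 1 < c2) by (unfold c2; nra).
  assert (Hlc2 : 0 <= ln c2) by (rewrite <- ln_1; left; apply ln_increasing; lra).
  set (H := 2 * A1 * rsum (fun k => (rho / (1 / 2)) ^ k) K + eps / 2 * ln c2).
  exists (2 * S * exp H). split; [apply Rmult_lt_0_compat; [lra | apply exp_pos]|].
  intros sigma t Hs. assert (Pt := Rabs_pos t).
  set (s0 := (2, t) : C).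
  assert (Near : forall z, Cmod (z - s0) < 3 / 2 -> 1 / 2 < Re z).
  { intros z Hz. assert (K1 := re_le_Cmod (z - s0)).
    replace (Re (z - s0)) with (Re z - 2) in K1 by (unfold s0, Re; simpl; ring).
    assert (K2 : - (Re z - 2) <= Rabs (Re z - 2)) by (rewrite <- Rabs_Ropp; apply Rle_abs). lra. }
  destruct (log_exists Zf Zf' Zf'' s0 (3 / 2)) as (G & G' & HG & G0 & HZG); [lra | | | | |].
  { intros z Hz. apply Zf_deriv. specialize (Near z Hz). lra. }
  { intros z Hz. apply Zf'_deriv. specialize (Near z Hz). lra. }
  { intros z Hz. apply Zf''_cont. specialize (Near z Hz). lra. }
  { intros z Hz. apply Zf_nonzero; [exact RH | now apply Near]. }
  set (X := Cmod (s0 - 1)).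
  assert (X1 : 1 <= X).
  { unfold X. eapply Rle_trans; [|apply re_le_Cmod]. unfold s0, Re; simpl. rewrite Rabs_pos_eq; lra. }
  assert (Xt : Rabs t <= X).
  { unfold X. eapply Rle_trans; [|apply Im_le_Cmod]. unfold s0, Im; simpl. right; f_equal; ring. }
  assert (Ns0 : Zf s0 <> 0%C) by (apply Zf_nonzero; [exact RH | unfold s0; simpl; lra]).
  (* Since [X] is at least [Rabs t] and the inverse of zeta is bounded on [Re s = 2], this is the
     source of the exponent [- 1]. *)
  assert (L0 : / Cmod (Zf s0) <= S / X).
  { rewrite Zf_zeta; [| unfold s0; simpl; lra | unfold s0; intros E; injection E; lra].
    destruct (zeta_lower s0) as [Nz Lz]; [unfold s0; simpl; lra|].
    rewrite Cmod_inv in Lz by exact Nz. rewrite Cmod_mult. fold X.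
    rewrite Rinv_mult. unfold Rdiv. rewrite Rmult_comm.
    apply Rmult_le_compat_r; [left; apply Rinv_0_lt_compat; lra|].
    eapply Rle_trans; [exact Lz|]. apply Series_npow_mono. unfold s0; simpl; lra. }
  assert (Pz0 : 0 < Cmod (Zf s0)) by now apply Cmod_gt_0.
  assert (RG : forall w B, Cmod w < 3 / 2 -> 0 < B -> Cmod (Zf (s0 + w)) * (S / X) <= B -> Re (G w) <= ln B).
  { intros w B Hw HB Hle. apply Re_le_ln; [exact HB|].
    assert (E : Cmod (Cexp (G w)) = Cmod (Zf (s0 + w)) * / Cmod (Zf s0)).
    { rewrite (HZG w Hw), Cmod_mult. field. lra. }
    rewrite E. eapply Rle_trans; [|exact Hle]. apply Rmult_le_compat_l; [apply Cmod_ge_0 | exact L0]. }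
  assert (PSX : 0 < S / X) by (apply Rdiv_lt_0_compat; lra).
  set (w := (sigma - 2, 0) : C).
  assert (Hw : Cmod w <= rho).
  { replace w with (RtoC (sigma - 2)) by reflexivity. rewrite Cmod_R, Rabs_left1 by lra. unfold rho; lra. }
  set (A2 := ln c2 + 2 * ln (1 + Rabs t)).
  assert (Hlt : 0 <= ln (1 + Rabs t)).
  { rewrite <- ln_1. destruct Pt as [Pt|Pt]; [left; apply ln_increasing; lra | rewrite <- Pt; right; f_equal; ring]. }
  assert (TC := three_circles G G' (3 / 2) HG G0 A1 A2 (1 / 2) r2 rho K w).
  assert (B : Cmod (G w) <= H + eps * ln (1 + Rabs t)).
  { eapply Rle_trans; [apply TC|].
    - unfold r2; lra.
    - unfold rho, r2; lra.
    - exact Hw.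
    - exact HA1.
    - unfold A2; lra.
    - intros u. assert (Hc : Cmod (RtoC (1 / 2) * cis u) = 1 / 2) by (apply Cmod_circle; lra).
      set (v := (RtoC (1 / 2) * cis u)%C) in *.
      apply RG; [lra | nra |].
      assert (Rz : 3 / 2 <= Re (s0 + v)).
      { assert (K1 := re_le_Cmod v). replace (Re (s0 + v)) with (2 + Re v) by (unfold s0, Re; simpl; ring).
        assert (K2 : - Re v <= Rabs (Re v)) by (rewrite <- Rabs_Ropp; apply Rle_abs). lra. }
      rewrite Zf_zeta; [| lra | intros E; rewrite E in Rz; simpl in Rz; lra].
      rewrite Cmod_mult.
      assert (U1 : Cmod (s0 + v - 1) <= X + 1 / 2).
      { replace (s0 + v - 1)%C with (s0 - 1 + v)%C by ring. eapply Rle_trans; [apply Cmod_triangle|]. unfold X; lra. }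
      assert (U2 : Cmod (zeta (s0 + v)) <= S).
      { eapply Rle_trans; [apply zeta_upper; lra|]. apply Series_npow_mono. lra. }
      apply Rle_trans with ((X + 1 / 2) * S * (S / X)).
      + apply Rmult_le_compat_r; [lra|]. apply Rmult_le_compat; try apply Cmod_ge_0; assumption.
      + apply Rmult_le_reg_r with X; [lra|].
        replace ((X + 1 / 2) * S * (S / X) * X) with ((X + 1 / 2) * (S * S)) by (field; lra). nra.
    - intros u. assert (Hc : Cmod (RtoC r2 * cis u) = r2) by (apply Cmod_circle; unfold r2; lra).
      set (v := (RtoC r2 * cis u)%C) in *.
      replace A2 with (ln (c2 * ((1 + Rabs t) * (1 + Rabs t)))).
      2:{ unfold A2. rewrite !ln_mult by nra. ring. }
      apply RG; [unfold r2 in *; lra | nra |].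
      assert (Rz : 1 / 2 <= Re (s0 + v)).
      { assert (K1 := re_le_Cmod v). replace (Re (s0 + v)) with (2 + Re v) by (unfold s0, Re; simpl; ring).
        assert (K2 : - Re v <= Rabs (Re v)) by (rewrite <- Rabs_Ropp; apply Rle_abs). unfold r2 in *; lra. }
      assert (U := HZ _ Rz).
      assert (Q : 1 + Cmod (s0 + v) <= 5 * (1 + Rabs t)).
      { assert (Cmod s0 <= 2 + Rabs t).
        { eapply Rle_trans; [apply Cmod_le_Re_Im|]. unfold s0, Re, Im; simpl. rewrite (Rabs_pos_eq 2); lra. }
        generalize (Cmod_triangle s0 v). unfold r2 in *. lra. }
      assert (SX : S / X <= S).
      { apply Rmult_le_reg_r with X; [lra|]. replace (S / X * X) with S by (field; lra). nra. }
      assert (PQ := Cmod_ge_0 (s0 + v)).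
      apply Rle_trans with (C0 * ((1 + Cmod (s0 + v)) * (1 + Cmod (s0 + v))) * S).
      + apply Rmult_le_compat; [apply Cmod_ge_0 | lra | exact U | exact SX].
      + assert (Q2 : (1 + Cmod (s0 + v)) * (1 + Cmod (s0 + v)) <= (5 * (1 + Rabs t)) * (5 * (1 + Rabs t))).
        { apply Rmult_le_compat; lra. }
        unfold c2. apply Rle_trans with (C0 * (5 * (1 + Rabs t) * (5 * (1 + Rabs t))) * S).
        * apply Rmult_le_compat_r; [lra|]. apply Rmult_le_compat_l; lra.
        * right; ring.
    - fold q. unfold H, A2.
      assert (PA : 0 <= ln c2 + 2 * ln (1 + Rabs t)) by lra.
      assert (Q4 : 2 * (q ^ K / (1 - q)) <= eps / 2).
      { replace (4 / (1 - q) * q ^ K) with (2 * (2 * (q ^ K / (1 - q)))) in HK by (field; lra). lra. }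
      assert (Q5 : (ln c2 + 2 * ln (1 + Rabs t)) * (2 * (q ^ K / (1 - q))) <= (ln c2 + 2 * ln (1 + Rabs t)) * (eps / 2)).
      { now apply Rmult_le_compat_l. }
      lra. }
  assert (Ew : (s0 + w)%C = (sigma, t)) by (apply C_eq; unfold s0, w, Re, Im; simpl; ring).
  assert (Hw2 : Cmod w < 3 / 2) by (unfold rho in Hw; lra).
  assert (EZ := HZG w Hw2). rewrite Ew in EZ.
  rewrite EZ, Cmod_inv by (apply Cmult_neq_0; [exact Ns0 | apply Cexp_neq_0]).
  rewrite Cmod_mult, Cmod_Cexp, Rinv_mult, <- exp_Ropp.
  (* Only upper bounds for [Re G] were put into [three_circles]; its conclusion bounds the modulus,
     hence also [- Re G], as the reciprocal demands. *)
  assert (E1 : exp (- Re (G w)) <= exp H * Rpower (1 + Rabs t) eps).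
  { unfold Rpower. rewrite <- exp_plus.
    assert (K1 : - Re (G w) <= H + eps * ln (1 + Rabs t)).
    { eapply Rle_trans; [|exact B]. eapply Rle_trans; [|apply re_le_Cmod].
      rewrite <- Rabs_Ropp. apply Rle_abs. }
    destruct K1 as [K1|K1]; [left; now apply exp_increasing | right; now rewrite K1]. }
  assert (SX2 : S / X <= 2 * S * Rpower (1 + Rabs t) (- 1)).
  { replace (- 1) with (- (1)) by ring. rewrite Rpower_Ropp, Rpower_1 by lra.
    apply Rmult_le_reg_r with (X * (1 + Rabs t)); [nra|].
    replace (S / X * (X * (1 + Rabs t))) with (S * (1 + Rabs t)) by (field; lra).
    replace (2 * S * / (1 + Rabs t) * (X * (1 + Rabs t))) with (2 * S * X) by (field; lra). nra. }
  rewrite Rpower_plus.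
  apply Rle_trans with ((2 * S * Rpower (1 + Rabs t) (- 1)) * (exp H * Rpower (1 + Rabs t) eps)).
  - apply Rmult_le_compat; [left; now apply Rinv_0_lt_compat | left; apply exp_pos | lra | exact E1].
  - right; ring.
Qed.

(** * Perron's formula *)

(** Integrates against [dt] and not [dz = i dt], so that a residue contributes [2 * PI] times its
    value. *)
Definition vline (f : C -> C) (c T : R) : C := CInt (fun t => f (c, t)) (- T) T.

Lemma cont_vert (c t : R) : continuous (fun t : R => ((c, t) : C)) t.
Proof. apply cont_C_intro; unfold Re, Im; simpl; [apply continuous_const | apply continuous_id]. Qed.

Lemma cont_on_vert (f : C -> C) c T : (forall t, continuous f (c, t)) -> cont_on (fun t => f (c, t)) (- T) T.
Proof.
  intros H t _. apply (continuous_comp (fun t : R => ((c, t) : C)) f); [apply cont_vert | apply H].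
Qed.

Lemma vert_add (w : C) t : (w + RtoC t * Ci)%C = (Re w, Im w + t).
Proof. apply C_eq; unfold Re, Im; simpl; ring. Qed.

(** Up to a factor [i], the derivative of the vertical integral in its abscissa is the difference of
    the values of [f] at the two end points, hence at most [2 * H] in modulus. *)
Lemma vline_shift (f f' : C -> C) (a b r T H : R) : a <= b -> 0 < r -> 0 <= T ->
  (forall z, a - r < Re z < b + r -> cderiv f z (f' z) /\ continuous f' z) ->
  (forall x, a <= x <= b -> Cmod (f (x, T)) <= H /\ Cmod (f (x, (- T)%R)) <= H) ->
  Cmod (vline f b T - vline f a T) <= 2 * H * (b - a).
Proof.
  intros Hab Hr HT Hf HH.
  set (V := fun w : C => CInt (fun t => f (w + RtoC t * Ci)%C) (- T) T).
  set (dV := fun w : C => CInt (fun t => f' (w + RtoC t * Ci)%C) (- T) T).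
  assert (HTT : - T <= T) by lra.
  assert (EV : forall x, vline f x T = V (RtoC x)).
  { intros x. unfold vline, V. apply CInt_ext; [assumption|]. intros t _. f_equal. rewrite vert_add.
    unfold Re, Im; simpl. f_equal; ring. }
  rewrite !EV.
  assert (Hst : forall w, a - r < Re w < b + r -> forall t, a - r < Re (w + RtoC t * Ci)%C < b + r).
  { intros w Hw t. rewrite vert_add. exact Hw. }
  assert (DV : forall x, a <= x <= b -> cderiv V (RtoC x) (dV (RtoC x))).
  { intros x Hx.
    assert (Nr : forall w, Cmod (w - RtoC x) < r -> a - r < Re w < b + r).
    { intros w Hw. assert (K := re_le_Cmod (w - RtoC x)).
      replace (Re (w - RtoC x)) with (Re w - x) in K by (unfold Re; simpl; ring).
      apply Rle_lt_trans with (2 := Hw) in K. apply Rabs_def2 in K. lra. }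
    apply (cderiv_CInt (fun w t => f (w + RtoC t * Ci)%C) (fun w t => f' (w + RtoC t * Ci)%C)
      (- T) T (RtoC x) r HTT Hr).
    - intros w t Hw _. eapply cderiv_eq.
      + apply (cderiv_comp f (fun w => w + RtoC t * Ci)%C); [apply Hf, Hst, Nr, Hw|].
        apply cderiv_plus; [apply cderiv_id | apply cderiv_const].
      + ring.
    - intros w Hw t _. apply (continuous_comp (fun t => w + RtoC t * Ci)%C f).
      + exact (cpath_cont _ _ _ (cpath_lin w Ci t)).
      + apply (cderiv_cont f _ (f' (w + RtoC t * Ci)%C)). apply Hf, Hst, Nr, Hw.
    - intros t _. apply (continuous_comp (fun p : C * R => fst p + RtoC (snd p) * Ci)%C f').
      + apply cont_Cplus; [apply continuous_fst|]. apply cont_Cmult; [|apply continuous_const].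
        apply cont_RtoC. apply continuous_snd.
      + apply Hf, Hst. simpl. unfold Re; simpl; lra. }
  assert (BV : forall x, a <= x <= b -> Cmod (dV (RtoC x)) <= 2 * H).
  { intros x Hx.
    assert (In : forall t, a - r < Re (RtoC x + RtoC t * Ci)%C < b + r).
    { intros t. apply Hst. unfold Re; simpl; lra. }
    assert (Cc : cont_on (fun t => f' (RtoC x + RtoC t * Ci)%C) (- T) T).
    { intros t _. apply (continuous_comp (fun t => RtoC x + RtoC t * Ci)%C f').
      - exact (cpath_cont _ _ _ (cpath_lin (RtoC x) Ci t)).
      - apply Hf, In. }
    assert (E : (Ci * dV (RtoC x))%C = (f (x, T) - f (x, (- T)%R))%C).
    { unfold dV. rewrite <- CInt_scal; [| assumption | exact Cc].
      transitivity (f (RtoC x + RtoC T * Ci) - f (RtoC x + RtoC (- T) * Ci))%C.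
      - apply (CInt_FTC (fun t => f (RtoC x + RtoC t * Ci)%C)); [assumption | | now apply cont_on_scal].
        intros t _. apply (cpath_comp f (fun t => RtoC x + RtoC t * Ci)%C); [apply Hf, In | apply cpath_lin].
      - rewrite !vert_add. do 2 f_equal; apply C_eq; unfold Re, Im; simpl; ring. }
    apply (f_equal Cmod) in E. rewrite Cmod_mult, Cmod_Ci, Rmult_1_l in E. rewrite E.
    eapply Rle_trans; [apply Cmod_triangle_minus|]. destruct (HH x Hx); lra. }
  replace (V (RtoC b) - V (RtoC a))%C with (V (RtoC b) - V (RtoC a) - (RtoC b - RtoC a) * 0)%C by ring.
  replace (b - a) with (Cmod (RtoC b - RtoC a)).
  2:{ rewrite <- RtoC_minus, Cmod_R. apply Rabs_pos_eq. lra. }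
  assert (Seg : forall u, 0 <= u <= 1 -> exists x, a <= x <= b /\ (RtoC a + RtoC u * (RtoC b - RtoC a))%C = RtoC x).
  { intros u Hu. exists (a + u * (b - a)). split; [split; nra|].
    rewrite RtoC_plus, RtoC_mult, RtoC_minus. reflexivity. }
  apply (cderiv_mvt V dV).
  - intros u Hu. destruct (Seg u Hu) as (x & Hx & ->). now apply DV.
  - intros u Hu. destruct (Seg u Hu) as (x & Hx & ->).
    replace (dV (RtoC x) - 0)%C with (dV (RtoC x)) by ring. now apply BV.
Qed.

Lemma vline_scal (c : C) f x T : 0 <= T -> (forall t, continuous f (x, t)) ->
  vline (fun z => c * f z)%C x T = (c * vline f x T)%C.
Proof. intros HT H. unfold vline. apply (CInt_scal c (fun t => f (x, t))); [lra | now apply cont_on_vert]. Qed.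

Lemma vline_plus f g x T : 0 <= T -> (forall t, continuous f (x, t)) -> (forall t, continuous g (x, t)) ->
  vline (fun z => f z + g z)%C x T = (vline f x T + vline g x T)%C.
Proof.
  intros HT Hf Hg. unfold vline. apply (CInt_plus (fun t => f (x, t)) (fun t => g (x, t))); [lra | |]; now apply cont_on_vert.
Qed.

Lemma vline_minus f g x T : 0 <= T -> (forall t, continuous f (x, t)) -> (forall t, continuous g (x, t)) ->
  vline (fun z => f z - g z)%C x T = (vline f x T - vline g x T)%C.
Proof.
  intros HT Hf Hg. unfold vline. apply (CInt_minus (fun t => f (x, t)) (fun t => g (x, t))); [lra | |]; now apply cont_on_vert.
Qed.

Lemma vline_ext (f g : C -> C) x T : 0 <= T -> (forall t, f (x, t) = g (x, t)) -> vline f x T = vline g x T.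
Proof. intros HT H. unfold vline. apply CInt_ext; [lra | intros; apply H]. Qed.

Lemma vline_norm_const f x T D : 0 <= T -> (forall t, continuous f (x, t)) ->
  (forall t, Cmod (f (x, t)) <= D) -> Cmod (vline f x T) <= 2 * T * D.
Proof.
  intros HT Hf HD. unfold vline. replace (2 * T * D) with ((T - - T) * D) by ring.
  apply CInt_norm_const; [lra | now apply cont_on_vert | intros; apply HD].
Qed.

Lemma pair_neq (c t a : R) : c <> a -> (c, t) <> RtoC a.
Proof. intros H E. apply H. now injection E. Qed.

(** [h] is a primitive of [1 / (c + i t)], and its logarithmic part is even in [t] and cancels. The
    jump of the arctangent between negative and positive [c] takes the place of a residue. *)
Lemma vline_inv (c T : R) : c <> 0 -> 0 <= T -> vline Cinv c T = RtoC (2 * atan (T / c)).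
Proof.
  intros Hc HT. unfold vline.
  set (h := fun t => ((atan (t / c), - (ln (c * c + t * t) / 2)) : C)).
  assert (Pd : forall t, 0 < c * c + t * t) by (intros t; nra).
  transitivity (h T - h (- T)%R)%C.
  - apply CInt_FTC; [lra | |].
    + intros t _. specialize (Pd t). split; unfold h, Re, Im; simpl.
      * auto_derive; trivial. field. repeat split; first [exact Hc | nra].
      * auto_derive; [nra|]. field. nra.
    + apply (cont_on_vert Cinv). intros t. apply (cont_Cinv (fun z : C => z)); [apply continuous_id|].
      now apply pair_neq.
  - unfold h. apply C_eq; unfold Re, Im; simpl.
    + replace (- T / c) with (- (T / c)) by (field; exact Hc). rewrite atan_opp. ring.
    + replace (- T * - T) with (T * T) by ring. ring.
Qed.

Lemma atan_le (u : R) : 0 <= u -> atan u <= u.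
Proof.
  intros Hu. destruct Hu as [Hu|<-]; [|rewrite atan_0; lra].
  destruct (MVT_cor2 atan (fun x => / (1 + x ^ 2)) 0 u Hu) as (c & E & Hc).
  - intros x _. apply derivable_pt_lim_atan.
  - rewrite atan_0 in E. assert (L : / (1 + c ^ 2) <= 1).
    { rewrite <- Rinv_1. apply Rinv_le_contravar; nra. }
    nra.
Qed.

Lemma atan_near (z tau k : R) : 0 < tau -> 0 < k -> tau / k <= z -> PI / 2 - k / tau <= atan z < PI / 2.
Proof.
  intros Ht Hk Hz. assert (Pz : 0 < tau / k) by (apply Rdiv_lt_0_compat; lra).
  split; [|apply atan_bound].
  assert (E := atan_inv z ltac:(lra)).
  assert (L := atan_le (/ z) ltac:(left; apply Rinv_0_lt_compat; lra)).
  assert (L2 : / z <= k / tau).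
  { replace (k / tau) with (/ (tau / k)) by (field; lra). apply Rinv_le_contravar; lra. }
  lra.
Qed.

(** The Mellin kernel of [max 0 (y - 1)]: its residues at 1 and 0 are [y] and [- 1]. The quadratic
    denominator makes vertical integrals absolutely convergent. *)
Definition pkern (y : R) (w : C) : C := (Rcpow y w * / (w * (w - 1)))%C.

Lemma cderiv_w_w1_inv (w : C) : w <> 0%C -> w <> 1%C ->
  cderiv (fun w => / (w * (w - 1)))%C w ((2 * w - 1) * - / (w * (w - 1) * (w * (w - 1))))%C.
Proof.
  intros H0 H1. apply (cderiv_inv (fun w => w * (w - 1))%C).
  - apply Cmult_neq_0; [exact H0|]. intros E; apply H1; now apply Ceq_minus.
  - apply cderiv_s_s1.
Qed.

Definition pkern' (y : R) (w : C) : C :=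
  (RtoC (ln y) * Rcpow y w * / (w * (w - 1)) + Rcpow y w * ((2 * w - 1) * - / (w * (w - 1) * (w * (w - 1)))))%C.

Lemma pkern_deriv y (w : C) : w <> 0%C -> w <> 1%C -> cderiv (pkern y) w (pkern' y w) /\ continuous (pkern' y) w.
Proof.
  intros H0 H1. split.
  - apply (cderiv_mult (fun w => Rcpow y w) (fun w => / (w * (w - 1)))%C); [apply cderiv_Rcpow | now apply cderiv_w_w1_inv].
  - assert (N : (w * (w - 1) <> 0)%C).
    { apply Cmult_neq_0; [exact H0|]. intros E; apply H1; now apply Ceq_minus. }
    assert (C1 := cderiv_cont _ _ _ (cderiv_Rcpow y w)).
    assert (C2 := cderiv_cont _ _ _ (cderiv_s_s1 w)).
    unfold pkern'. apply cont_Cplus.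
    + apply cont_Cmult; [apply cont_Cmult; [apply continuous_const | exact C1]|].
      now apply (cont_Cinv (fun w : C => w * (w - 1))%C).
    + apply cont_Cmult; [exact C1|]. apply cont_Cmult.
      * apply cont_Cminus; [|apply continuous_const]. apply cont_Cmult; [apply continuous_const | apply continuous_id].
      * apply cont_Copp. apply (cont_Cinv (fun w : C => w * (w - 1) * (w * (w - 1)))%C).
        -- now apply cont_Cmult.
        -- now apply Cmult_neq_0.
Qed.

Lemma pkern_cont y c t : c <> 0 -> c <> 1 -> continuous (pkern y) (c, t).
Proof.
  intros H0 H1. apply (cderiv_cont _ _ (pkern' y (c, t))). apply pkern_deriv; now apply pair_neq.
Qed.

Lemma pkern_bound y c t D : 0 < D -> c <> 0 -> c <> 1 -> D <= Cmod (c, t) -> D <= Cmod ((c, t) - 1) ->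
  Cmod (pkern y (c, t)) <= Rpower y c * / (D * D).
Proof.
  intros HD H0 H1 L0 L1. unfold pkern. rewrite Cmod_mult, Cmod_Rcpow.
  apply Rmult_le_compat_l; [left; apply Rpower_pos|].
  rewrite Cmod_inv, Cmod_mult.
  - apply Rinv_le_contravar; [nra|]. apply Rmult_le_compat; lra.
  - apply Cmult_neq_0; [now apply pair_neq|]. intros E. apply Ceq_minus in E. revert E. now apply pair_neq.
Qed.

Lemma Cmod_vert_Im c t : Rabs t <= Cmod (c, t).
Proof. exact (Im_le_Cmod (c, t)). Qed.

Lemma Cmod_vert_Re c t : Rabs c <= Cmod (c, t).
Proof. exact (re_le_Cmod (c, t)). Qed.

Lemma vert_minus_1 c t : ((c, t) - 1)%C = (c - 1, t).
Proof. apply C_eq; unfold Re, Im; simpl; ring. Qed.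

Lemma Rpower_le_1_exp y a b : 0 < y <= 1 -> a <= b -> Rpower y b <= Rpower y a.
Proof.
  intros Hy Hab. unfold Rpower.
  assert (L : ln y <= 0).
  { rewrite <- ln_1. destruct Hy as [H1 [H2| ->]]; [left; apply ln_increasing; lra | lra]. }
  assert (M : b * ln y <= a * ln y) by nra.
  destruct M as [M|M]; [left; now apply exp_increasing | right; now rewrite M].
Qed.

Lemma Rpower_2 y : 0 < y -> Rpower y 2 = y * y.
Proof. intros H. replace 2 with (1 + 1) by ring. rewrite Rpower_plus, Rpower_1 by assumption. reflexivity. Qed.

(* Shift to the right, where the kernel is holomorphic. *)
Lemma perron_small y tau : 0 < y <= 1 -> 1 <= tau ->
  Cmod (vline (pkern y) 2 (tau * tau)) <= 34 * (y * y) / tau.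
Proof.
  intros Hy Ht. set (T := tau * tau). assert (HT : tau <= T) by (unfold T; nra).
  assert (HT1 : 1 <= T) by lra.
  (* Moving by the height [T] itself suffices: the far edge has length [2 * T], the denominator
     there is at least [T * T], and [y <= 1] keeps the power below [y * y]. *)
  assert (Sh := vline_shift (pkern y) (pkern' y) 2 (2 + T) (1 / 2) T (y * y * / (T * T))).
  assert (B1 : forall x t, 2 <= x -> T <= Rabs t -> Cmod (pkern y (x, t)) <= y * y * / (T * T)).
  { intros x t Hx Htt. apply Rle_trans with (Rpower y x * / (T * T)).
    - apply pkern_bound; try lra.
      + eapply Rle_trans; [exact Htt | apply Cmod_vert_Im].
      + rewrite vert_minus_1. eapply Rle_trans; [exact Htt | apply Cmod_vert_Im].
    - apply Rmult_le_compat_r; [left; apply Rinv_0_lt_compat; nra|].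
      rewrite <- Rpower_2 by lra. apply Rpower_le_1_exp; lra. }
  assert (L1 : Cmod (vline (pkern y) (2 + T) T - vline (pkern y) 2 T) <= 2 * (y * y * / (T * T)) * (2 + T - 2)).
  { apply Sh; try lra.
    - intros z Hz. apply pkern_deriv; intros ->; unfold Re in Hz; simpl in Hz; lra.
    - intros x Hx. split; apply B1; try lra; [rewrite Rabs_pos_eq | rewrite Rabs_Ropp, Rabs_pos_eq]; lra. }
  assert (L2 : Cmod (vline (pkern y) (2 + T) T) <= 2 * T * (y * y * / (T * T))).
  { apply vline_norm_const; [lra | intros t; apply pkern_cont; lra |].
    intros t. apply Rle_trans with (Rpower y (2 + T) * / (T * T)).
    - apply pkern_bound; try lra.
      + eapply Rle_trans; [|apply Cmod_vert_Re]. rewrite Rabs_pos_eq; lra.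
      + rewrite vert_minus_1. eapply Rle_trans; [|apply Cmod_vert_Re]. rewrite Rabs_pos_eq; lra.
    - apply Rmult_le_compat_r; [left; apply Rinv_0_lt_compat; nra|].
      rewrite <- Rpower_2 by lra. apply Rpower_le_1_exp; lra. }
  assert (L3 := Cmod_triangle_rev (vline (pkern y) 2 T) (vline (pkern y) (2 + T) T)).
  rewrite Cmod_minus_sym in L3.
  assert (E1 : 2 * (y * y * / (T * T)) * (2 + T - 2) = 2 * (y * y) / T) by (field; lra).
  assert (E2 : 2 * T * (y * y * / (T * T)) = 2 * (y * y) / T) by (field; lra).
  assert (E3 : (y * y) / T <= (y * y) / tau).
  { apply Rmult_le_compat_l; [nra|]. apply Rinv_le_contravar; lra. }
  assert (E4 : 0 <= y * y / tau) by (apply Rdiv_le_0_compat; nra).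
  unfold Rdiv in *. lra.
Qed.

(** [RtoC L * eint L 0 w] is [(exp (L w) - 1) / w] with its removable singularity filled in; as an
    integral of exponentials it is entire without further argument. Higher [j] serve for the
    derivatives. *)
Definition eint (L : R) (j : nat) (w : C) : C :=
  CInt (fun u => RtoC (u ^ j) * Cexp (RtoC u * (RtoC L * w)))%C 0 1.

Lemma eint_deriv L j (w : C) : cderiv (eint L j) w (RtoC L * eint L (S j) w)%C.
Proof.
  assert (Cj : forall j w, cont_on (fun u => RtoC (u ^ j) * Cexp (RtoC u * (RtoC L * w)))%C 0 1).
  { intros i v u _. apply cont_Cmult.
    - apply cont_RtoC, cont_Rpow, continuous_id.
    - apply cont_Cexp. apply cont_Cmult; [apply cont_RtoC, continuous_id | apply continuous_const]. }
  apply cderiv_eq with (CInt (fun u => RtoC L * (RtoC (u ^ S j) * Cexp (RtoC u * (RtoC L * w))))%C 0 1).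
  - apply (cderiv_CInt (fun w u => RtoC (u ^ j) * Cexp (RtoC u * (RtoC L * w)))%C
      (fun w u => RtoC L * (RtoC (u ^ S j) * Cexp (RtoC u * (RtoC L * w))))%C 0 1 w 1); [lra | lra | | |].
    + intros v u _ _. eapply cderiv_eq.
      * apply cderiv_scal.
        apply (cderiv_comp Cexp (fun v => RtoC u * (RtoC L * v))%C); [apply cderiv_Cexp|].
        apply cderiv_scal, cderiv_scal, cderiv_id.
      * change (u ^ S j) with (u * u ^ j). rewrite RtoC_mult. ring.
    + intros v _. apply Cj.
    + intros u _. apply cont_Cmult; [apply continuous_const|]. apply cont_Cmult.
      * apply cont_RtoC, cont_Rpow, continuous_snd.
      * apply cont_Cexp. apply cont_Cmult; [apply cont_RtoC, continuous_snd|].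
        apply cont_Cmult; [apply continuous_const | apply continuous_fst].
  - rewrite CInt_scal; [reflexivity | lra | apply Cj].
Qed.

Lemma eint_0 L (w : C) : (w * (RtoC L * eint L 0 w))%C = (Cexp (w * RtoC L) - 1)%C.
Proof.
  assert (Cj : cont_on (fun u => RtoC (u ^ 0) * Cexp (RtoC u * (RtoC L * w)))%C 0 1).
  { intros u _. apply cont_Cmult; [apply continuous_const|].
    apply cont_Cexp. apply cont_Cmult; [apply cont_RtoC, continuous_id | apply continuous_const]. }
  replace (w * (RtoC L * eint L 0 w))%C with ((RtoC L * w) * eint L 0 w)%C by ring.
  unfold eint. rewrite <- CInt_scal; [| lra | exact Cj].
  rewrite (CInt_ext _ (fun u => (RtoC L * w) * Cexp (RtoC u * (RtoC L * w)))%C); [| lra | intros; simpl; ring].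
  rewrite (CInt_FTC (fun u => Cexp (RtoC u * (RtoC L * w)))); [| lra | intros; apply cpath_Cexp_lin |].
  - replace (RtoC 0 * (RtoC L * w))%C with (RtoC 0) by ring. rewrite Cexp_0.
    replace (RtoC 1 * (RtoC L * w))%C with (w * RtoC L)%C by ring. reflexivity.
  - intros u _. apply cont_Cmult; [apply continuous_const|].
    apply cont_Cexp. apply cont_Cmult; [apply cont_RtoC, continuous_id | apply continuous_const].
Qed.

(* The kernel minus its principal parts at 0 and 1, and these principal parts. *)
Definition pentire (y : R) (w : C) : C :=
  (RtoC y * (RtoC (ln y) * eint (ln y) 0 (- 1 + w)) - RtoC (ln y) * eint (ln y) 0 w)%C.
Definition ppole (y : R) (w : C) : C := (RtoC y * / (- 1 + w) - / w)%C.

(** Partial fractions [1 / (w (w - 1)) = 1 / (w - 1) - 1 / w], where subtracting 1 from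
    [y ^ (w - 1)] and from [y ^ w] removes the poles. *)
Lemma pkern_split y (w : C) : 0 < y -> w <> 0%C -> w <> 1%C -> pkern y w = (pentire y w + ppole y w)%C.
Proof.
  intros Hy H0 H1. assert (N : (- 1 + w <> 0)%C).
  { intros E; apply H1. replace w with (- 1 + w + 1)%C by ring. rewrite E. ring. }
  assert (N' : (w - 1 <> 0)%C) by (replace (w - 1)%C with (- 1 + w)%C by ring; exact N).
  assert (E0 : (RtoC (ln y) * eint (ln y) 0 w)%C = ((Rcpow y w - 1) / w)%C).
  { unfold Rcpow. rewrite <- eint_0. field. exact H0. }
  assert (E1 : (RtoC (ln y) * eint (ln y) 0 (- 1 + w))%C = ((Rcpow y w / RtoC y - 1) / (- 1 + w))%C).
  { replace (Rcpow y w / RtoC y)%C with (Cexp ((- 1 + w) * RtoC (ln y))).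
    - rewrite <- eint_0. field. exact N.
    - replace ((- 1 + w) * RtoC (ln y))%C with (w * RtoC (ln y) + - (1 * RtoC (ln y)))%C by ring.
      rewrite Cexp_plus, Cexp_opp. fold (Rcpow y 1). rewrite Rcpow_1 by assumption. reflexivity. }
  unfold pentire, ppole, pkern. rewrite E0, E1. field. repeat split; try assumption.
  intros E. injection E. lra.
Qed.

(** The residue theorem by hand: only [pentire] is shifted, to the line [Re w = - tau], while the
    principal parts are integrated exactly on both lines. With height [tau * tau], the horizontal
    edges of length [tau + 2] and the left edge all contribute [O (1 / tau)]. *)
Lemma perron_large y tau : 1 <= y -> 1 <= tau ->
  Cmod (vline (pkern y) 2 (tau * tau) - RtoC (2 * PI * (y - 1))) <= 34 * (y * y) / tau.
Proof.
  intros Hy Ht. set (T := tau * tau). assert (HT : tau <= T) by (unfold T; nra).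
  assert (HT1 : 1 <= T) by lra. assert (Yy : y <= y * y) by nra.
  set (dE := fun w : C => (RtoC y * (RtoC (ln y) * (RtoC (ln y) * eint (ln y) 1 (- 1 + w))) -
     RtoC (ln y) * (RtoC (ln y) * eint (ln y) 1 w))%C).
  assert (HE : forall z, cderiv (pentire y) z (dE z) /\ continuous dE z).
  { intros z. split.
    - apply cderiv_minus.
      + apply cderiv_scal, cderiv_scal. apply (cderiv_shift (eint (ln y) 0)). apply eint_deriv.
      + apply cderiv_scal. apply eint_deriv.
    - assert (Ce : forall v, continuous (eint (ln y) 1) v) by (intros v; exact (cderiv_cont _ _ _ (eint_deriv _ _ v))).
      apply cont_Cminus.
      + apply cont_Cmult; [apply continuous_const|]. apply cont_Cmult; [apply continuous_const|].
        apply cont_Cmult; [apply continuous_const|].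
        apply (continuous_comp (fun w : C => - 1 + w)%C (eint (ln y) 1)); [|apply Ce].
        apply cont_Cplus; [apply continuous_const | apply continuous_id].
      + apply cont_Cmult; [apply continuous_const|]. apply cont_Cmult; [apply continuous_const | apply Ce]. }
  assert (CE : forall z, continuous (pentire y) z) by (intros z; exact (cderiv_cont _ _ _ (proj1 (HE z)))).
  assert (Cinv1 : forall c t, c <> 1 -> continuous (fun w : C => / (- 1 + w))%C (c, t)).
  { intros c t Hc. apply (cont_Cinv (fun w : C => - 1 + w)%C).
    - apply cont_Cplus; [apply continuous_const | apply continuous_id].
    - intros E. apply (f_equal Re) in E. unfold Re in E; simpl in E. lra. }
  assert (Cinv0 : forall c t, c <> 0 -> continuous Cinv (c, t)).
  { intros c t Hc. apply (cont_Cinv (fun z : C => z)); [apply continuous_id | now apply pair_neq]. }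
  assert (CP : forall c t, c <> 0 -> c <> 1 -> continuous (ppole y) (c, t)).
  { intros c t H0 H1. apply cont_Cminus; [|now apply Cinv0].
    apply cont_Cmult; [apply continuous_const | now apply Cinv1]. }
  assert (VP : forall c, c <> 0 -> c <> 1 ->
    vline (ppole y) c T = RtoC (y * (2 * atan (T / (c - 1))) - 2 * atan (T / c))).
  { intros c H0 H1.
    assert (V1 : vline (fun w : C => / (- 1 + w))%C c T = RtoC (2 * atan (T / (c - 1)))).
    { rewrite <- vline_inv by lra. unfold vline. apply CInt_ext; [lra|]. intros t _. f_equal.
      apply C_eq; unfold Re, Im; simpl; ring. }
    rewrite RtoC_minus, RtoC_mult, <- V1, <- vline_inv by lra.
    rewrite <- (vline_scal (RtoC y) (fun w : C => / (- 1 + w))%C); [| lra | intros; now apply Cinv1].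
    rewrite <- (vline_minus (fun w : C => RtoC y * / (- 1 + w))%C Cinv); [reflexivity | lra | |].
    - intros t. apply cont_Cmult; [apply continuous_const | now apply Cinv1].
    - intros t. now apply Cinv0. }
  assert (VS : forall c, c <> 0 -> c <> 1 -> vline (pkern y) c T = (vline (pentire y) c T + vline (ppole y) c T)%C).
  { intros c H0 H1. rewrite <- vline_plus; [| lra | intros; apply CE | intros; now apply CP].
    apply vline_ext; [lra|]. intros t. apply pkern_split; [lra | now apply pair_neq | now apply pair_neq]. }
  assert (Hor : forall x t, - tau <= x <= 2 -> x <> 0 -> x <> 1 -> Rabs t = T -> Cmod (pentire y (x, t)) <= 3 * (y * y) / T).
  { intros x t Hx H0 H1 Htt.
    replace (pentire y (x, t)) with (pkern y (x, t) - ppole y (x, t))%C.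
    2:{ rewrite pkern_split; [ring | lra | now apply pair_neq | now apply pair_neq]. }
    eapply Rle_trans; [apply Cmod_triangle_minus|].
    assert (D0 : T <= Cmod (x, t)) by (rewrite <- Htt; apply Cmod_vert_Im).
    assert (D1 : T <= Cmod ((x - 1)%R, t)) by (rewrite <- Htt; apply Cmod_vert_Im).
    assert (K1 : Cmod (pkern y (x, t)) <= y * y / T).
    { apply Rle_trans with (Rpower y x * / (T * T)).
      - apply pkern_bound; try lra; rewrite ?vert_minus_1; assumption.
      - apply Rmult_le_compat; [left; apply Rpower_pos | left; apply Rinv_0_lt_compat; nra | |].
        + rewrite <- Rpower_2 by lra. apply Rpower_le_exp; lra.
        + apply Rinv_le_contravar; nra. }
    assert (K2 : Cmod (ppole y (x, t)) <= 2 * (y * y) / T).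
    { unfold ppole. eapply Rle_trans; [apply Cmod_triangle_minus|].
      rewrite Cmod_mult, Cmod_R, (Rabs_pos_eq y) by lra.
      replace (- 1 + (x, t))%C with (((x - 1)%R, t) : C) by (apply C_eq; unfold Re, Im; simpl; ring).
      rewrite !Cmod_inv by (apply pair_neq; lra).
      assert (I0 : / Cmod (x, t) <= / T) by (apply Rinv_le_contravar; lra).
      assert (I1 : / Cmod ((x - 1)%R, t) <= / T) by (apply Rinv_le_contravar; lra).
      assert (PT : 0 < / T) by (apply Rinv_0_lt_compat; lra).
      unfold Rdiv. nra. }
    unfold Rdiv in *. lra. }
  (* The preceding estimate leaves out the abscissas 0 and 1; the bound extends to them by
     continuity of [pentire], from points slightly to the left. *)
  assert (Hor' : forall x t, - tau <= x <= 2 -> Rabs t = T -> Cmod (pentire y (x, t)) <= 3 * (y * y) / T).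
  { intros x t Hx Htt. destruct (classic (x <> 0 /\ x <> 1)) as [[N0 N1]|N]; [now apply Hor|].
    apply Rle_of_eps. intros eps He.
    destruct (proj2 (cont_C_eps (pentire y) (x, t)) (CE _) eps He) as (d & Hd & Hw).
    set (e := Rmin (d / 2) (1 / 2)).
    assert (He1 : 0 < e) by (apply Rmin_pos; lra).
    assert (He2 := Rmin_l (d / 2) (1 / 2)). assert (He3 := Rmin_r (d / 2) (1 / 2)). fold e in He2, He3.
    assert (x = 0 \/ x = 1) by (destruct (Req_dec x 0); [now left | right; destruct (Req_dec x 1); tauto]).
    assert (K := Hor (x - e) t ltac:(lra) ltac:(lra) ltac:(lra) Htt).
    assert (M : Cmod (((x - e)%R, t) - (x, t)) < d).
    { replace (((x - e)%R, t) - (x, t))%C with (RtoC (- e)) by (apply C_eq; unfold Re, Im; simpl; ring).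
      rewrite Cmod_R, Rabs_Ropp, Rabs_pos_eq; lra. }
    specialize (Hw _ M). rewrite Cmod_minus_sym in Hw.
    generalize (Cmod_triangle_rev (pentire y (x, t)) (pentire y ((x - e)%R, t))). lra. }
  assert (Sh : Cmod (vline (pentire y) 2 T - vline (pentire y) (- tau) T) <= 2 * (3 * (y * y) / T) * (2 - - tau)).
  { apply (vline_shift (pentire y) dE (- tau) 2 1); try lra.
    - intros z _. apply HE.
    - intros x Hx. split; apply Hor'; try lra; [rewrite Rabs_pos_eq | rewrite Rabs_Ropp, Rabs_pos_eq]; lra. }
  (* Since [y >= 1] and the abscissa is [- tau], the kernel is at most [1 / (tau ^ 2 + t ^ 2)],
     whose integral is again an arctangent. *)
  assert (Lf : Cmod (vline (pkern y) (- tau) T) <= PI / tau).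
  { set (g := fun t => / tau * Re (/ ((tau, t) : C))).
    assert (CR : cont_on (fun t => / ((tau, t) : C))%C (- T) T).
    { apply (cont_on_vert Cinv). intros t. apply Cinv0. lra. }
    assert (EI := cont_on_Re _ (- T) T ltac:(lra) CR).
    unfold vline. eapply Rle_trans.
    - apply (CInt_norm_le _ g); [lra | | exact (ex_RInt_scal _ _ _ _ EI) |].
      + apply (cont_on_vert (pkern y)). intros t. apply pkern_cont; lra.
      + intros t _. unfold g, pkern.
        assert (Pd : 0 < tau * tau + t * t) by nra.
        rewrite Cmod_mult, Cmod_Rcpow.
        replace (Re (/ ((tau, t) : C))) with (tau / (tau * tau + t * t)).
        2:{ unfold Re, Cinv; simpl. field. nra. }
        replace (/ tau * (tau / (tau * tau + t * t))) with (1 * / (tau * tau + t * t)) by (field; lra).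
        assert (N0 := pair_neq (- tau) t 0 ltac:(lra)).
        assert (N1 := pair_neq (- tau - 1) t 0 ltac:(lra)).
        apply Rmult_le_compat; [left; apply Rpower_pos | apply Cmod_ge_0 | |].
        * unfold Re; simpl fst. rewrite <- (Rpower_O y) by lra. apply Rpower_le_exp; lra.
        * rewrite vert_minus_1, Cmod_inv, Cmod_mult by now apply Cmult_neq_0.
          apply Rinv_le_contravar; [exact Pd|].
          assert (Q0 := Cmod_sqr ((- tau)%R, t)). assert (Q1 := Cmod_sqr ((- tau - 1)%R, t)).
          unfold Re, Im in Q0, Q1; simpl in Q0, Q1.
          assert (P0 := Cmod_ge_0 ((- tau)%R, t)). assert (P1 := Cmod_ge_0 ((- tau - 1)%R, t)).
          assert (LL : Cmod ((- tau)%R, t) <= Cmod ((- tau - 1)%R, t)) by (apply Rsqr_incr_0_var; [unfold Rsqr; nra | assumption]).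
          nra.
    - assert (VI := vline_inv tau T ltac:(lra) ltac:(lra)). apply (f_equal Re) in VI.
      change (RInt (fun t => Re (/ ((tau, t) : C))) (- T) T = 2 * atan (T / tau)) in VI.
      assert (E : RInt g (- T) T = / tau * (2 * atan (T / tau))).
      { rewrite <- VI. exact (RInt_scal _ _ _ _ EI). }
      rewrite E. destruct (atan_bound (T / tau)) as [_ Ab].
      unfold Rdiv. rewrite Rmult_comm. apply Rmult_le_compat_r; [left; apply Rinv_0_lt_compat; lra | lra]. }
  assert (E1 := VS 2 ltac:(lra) ltac:(lra)). assert (E2 := VS (- tau) ltac:(lra) ltac:(lra)).
  rewrite VP in E1 by lra. rewrite VP in E2 by lra.
  replace (2 - 1) with 1 in E1 by ring.
  replace (T / (- tau - 1)) with (- (T / (tau + 1))) in E2 by (field; lra).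
  replace (T / - tau) with (- (T / tau)) in E2 by (field; lra).
  rewrite !atan_opp in E2.
  set (I1 := y * (2 * atan (T / 1)) - 2 * atan (T / 2)) in *.
  set (I2 := y * (2 * - atan (T / (tau + 1))) - 2 * - atan (T / tau)) in *.
  (* Shift error of the entire part, integral on the left line, and difference of the principal
     parts from their limit. *)
  replace (vline (pkern y) 2 T - RtoC (2 * PI * (y - 1)))%C with
    ((vline (pentire y) 2 T - vline (pentire y) (- tau) T) + vline (pkern y) (- tau) T + RtoC (I1 - I2 - 2 * PI * (y - 1)))%C.
  2:{ rewrite E1, E2, !RtoC_minus. ring. }
  eapply Rle_trans; [apply Cmod_triangle|].
  eapply Rle_trans; [apply Rplus_le_compat_r, Cmod_triangle|].
  rewrite Cmod_R.
  assert (It : 0 < / tau) by (apply Rinv_0_lt_compat; lra).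
  assert (F1 : 2 * (3 * (y * y) / T) * (2 - - tau) <= 18 * (y * y) / tau).
  { apply Rmult_le_reg_r with T; [lra|].
    replace (2 * (3 * (y * y) / T) * (2 - - tau) * T) with (6 * (y * y) * (2 + tau)) by (field; lra).
    replace (18 * (y * y) / tau * T) with (18 * (y * y) * tau) by (unfold T; field; lra). nra. }
  assert (F2 : PI / tau <= 4 * (y * y) / tau).
  { apply Rmult_le_compat_r; [lra|]. generalize PI_4. nra. }
  (* All four arctangents are within [2 / tau] of [PI / 2], so [I1 - I2] is close to
     [2 * PI * (y - 1)]. The three bounds add up to 18 + 4 + 12 = 34. *)
  assert (F3 : Rabs (I1 - I2 - 2 * PI * (y - 1)) <= 12 * (y * y) / tau).
  { assert (G1 := atan_near (T / 1) tau 1 ltac:(lra) ltac:(lra) ltac:(lra)).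
    assert (G2 := atan_near (T / 2) tau 2 ltac:(lra) ltac:(lra) ltac:(lra)).
    assert (G3 := atan_near (T / tau) tau 1 ltac:(lra) ltac:(lra)).
    assert (G4 := atan_near (T / (tau + 1)) tau 2 ltac:(lra) ltac:(lra)).
    specialize (G3 ltac:(replace (T / tau) with tau by (unfold T; field; lra); lra)).
    assert (Q : tau / 2 <= T / (tau + 1)).
    { apply Rmult_le_reg_r with (2 * (tau + 1)); [lra|].
      replace (tau / 2 * (2 * (tau + 1))) with (tau * (tau + 1)) by field.
      replace (T / (tau + 1) * (2 * (tau + 1))) with (2 * T) by (field; lra). unfold T; nra. }
    specialize (G4 Q). unfold I1, I2. unfold Rdiv in *. rewrite Rmult_1_l in G1, G3.
    set (x1 := atan (T * / 1)) in *. set (x2 := atan (T * / 2)) in *.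
    set (x3 := atan (T * / tau)) in *. set (x4 := atan (T * / (tau + 1))) in *.
    set (it := / tau) in *.
    replace (y * (2 * x1) - 2 * x2 - (y * (2 * - x4) - 2 * - x3) - 2 * PI * (y - 1)) with
      (2 * ((PI * / 2 - x2) + (PI * / 2 - x3)) - 2 * y * ((PI * / 2 - x1) + (PI * / 2 - x4))) by field.
    set (u1 := PI * / 2 - x2 + (PI * / 2 - x3)). set (u2 := PI * / 2 - x1 + (PI * / 2 - x4)).
    assert (U1 : 0 <= u1 <= 3 * it) by (unfold u1; lra).
    assert (U2 : 0 <= u2 <= 3 * it) by (unfold u2; lra).
    assert (U3 : 0 <= y * u2 <= y * (3 * it)) by (split; [nra | apply Rmult_le_compat_l; lra]).
    assert (U4 : it <= y * y * it) by nra.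
    assert (U5 : y * it <= y * y * it) by nra.
    apply Rabs_le. lra. }
  unfold Rdiv in *. lra.
Qed.

Lemma perron y tau : 0 < y -> 1 <= tau ->
  Cmod (vline (pkern y) 2 (tau * tau) - RtoC (2 * PI * Rmax 0 (y - 1))) <= 34 * (y * y) / tau.
Proof.
  intros Hy Ht. destruct (Rle_or_lt y 1) as [L|L].
  - rewrite Rmax_left by lra. rewrite Rmult_0_r.
    replace (vline (pkern y) 2 (tau * tau) - 0)%C with (vline (pkern y) 2 (tau * tau)) by ring.
    apply perron_small; lra.
  - rewrite Rmax_right by lra. apply perron_large; lra.
Qed.

(** * Partial sums of mu n / n *)

Definition kZ (x : R) (w : C) : C := (Rcpow x w * / (w * Zf w))%C.
Definition kZ' (x : R) (w : C) : C :=
  (RtoC (ln x) * Rcpow x w * / (w * Zf w) +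
   Rcpow x w * ((1 * Zf w + w * Zf' w) * - / (w * Zf w * (w * Zf w))))%C.

Lemma kZ_deriv (x : R) (w : C) : 0 < Re w -> Zf w <> 0%C -> cderiv (kZ x) w (kZ' x w) /\ continuous (kZ' x) w.
Proof.
  intros Hw HZ.
  assert (N0 : w <> 0%C) by (intros ->; simpl in Hw; lra).
  assert (N : (w * Zf w <> 0)%C) by now apply Cmult_neq_0.
  assert (D : cderiv (fun w => w * Zf w)%C w (1 * Zf w + w * Zf' w)%C).
  { apply (cderiv_mult (fun w => w) Zf); [apply cderiv_id | now apply Zf_deriv]. }
  split.
  - apply (cderiv_mult (fun w => Rcpow x w) (fun w => / (w * Zf w))%C); [apply cderiv_Rcpow|].
    exact (cderiv_inv (fun w => w * Zf w)%C w _ N D).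
  - assert (C1 := cderiv_cont _ _ _ (cderiv_Rcpow x w)).
    assert (C2 := cderiv_cont _ _ _ D).
    assert (C3 := cderiv_cont _ _ _ (Zf_deriv w Hw)).
    assert (C4 := cderiv_cont _ _ _ (Zf'_deriv w Hw)).
    unfold kZ'. apply cont_Cplus.
    + apply cont_Cmult; [apply cont_Cmult; [apply continuous_const | exact C1]|].
      now apply (cont_Cinv (fun w : C => w * Zf w)%C).
    + apply cont_Cmult; [exact C1|]. apply cont_Cmult.
      * apply cont_Cplus.
        -- apply cont_Cmult; [apply continuous_const | exact C3].
        -- apply cont_Cmult; [apply continuous_id | exact C4].
      * apply cont_Copp. apply (cont_Cinv (fun w : C => w * Zf w * (w * Zf w))%C).
        -- now apply cont_Cmult.
        -- now apply Cmult_neq_0.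
Qed.

Lemma Rcpow_div (x y : R) (s : C) : 0 < x -> 0 < y -> Rcpow (x / y) s = (Rcpow x s * Rcpow y (- s))%C.
Proof.
  intros Hx Hy. unfold Rcpow. rewrite <- Cexp_plus. f_equal.
  unfold Rdiv. rewrite ln_mult, ln_Rinv by (try apply Rinv_0_lt_compat; assumption).
  rewrite RtoC_plus, RtoC_opp. ring.
Qed.

Lemma csum_cont (f : nat -> C -> C) n z : (forall i, continuous (f i) z) -> continuous (fun w => csum (fun i => f i w) n) z.
Proof.
  intros H. induction n; simpl; [apply continuous_const|]. now apply cont_Cplus.
Qed.

Lemma vline_csum (f : nat -> C -> C) n c T : 0 <= T -> (forall i t, continuous (f i) (c, t)) ->
  vline (fun w => csum (fun i => f i w) n) c T = csum (fun i => vline (f i) c T) n.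
Proof.
  intros HT H. induction n; simpl.
  - unfold vline. rewrite CInt_const. ring.
  - rewrite <- IHn. apply (vline_plus (fun w => csum (fun i => f i w) n) (f n)); [assumption | |apply H].
    intros t. apply csum_cont. intros; apply H.
Qed.

(** The cut-off [N] is immaterial once [N >= x], by [Ssum_stable]; this lets two values of [x] share
    one range of summation. *)
Definition Ssum (x : R) (N : nat) : R := rsum (fun i => mu (S i) * Rmax 0 (x / INR (S i) - 1)) N.

Lemma Ssum_stable x N M : x <= INR N -> (N <= M)%nat -> Ssum x M = Ssum x N.
Proof.
  intros Hx HM. apply rsum_extend; [assumption|]. intros k Hk.
  assert (P := INR_S_pos k). assert (L : INR N <= INR (S k)) by (apply le_INR; lia).
  rewrite Rmax_left; [ring|].
  assert (x / INR (S k) <= 1); [|lra].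
  apply Rmult_le_reg_r with (INR (S k)); [assumption|].
  replace (x / INR (S k) * INR (S k)) with x by (field; lra). lra.
Qed.

Lemma Zf_nonzero_right (w : C) : 1 < Re w -> Zf w <> 0%C.
Proof.
  intros H. assert (N1 : w <> 1%C) by (intros ->; simpl in H; lra).
  rewrite Zf_zeta by (assumption || lra).
  apply Cmult_neq_0; [intros E; apply N1; now apply Ceq_minus | now apply zeta_lower].
Qed.

Lemma kZ_line2 (x : R) (w : C) N : 0 < x -> 1 < Re w ->
  kZ x w = (csum (fun i => RtoC (mu (S i)) * pkern (x / INR (S i)) w) N +
            pkern x w * (/ zeta w - csum (muterm w) N))%C.
Proof.
  intros Hx Hw. assert (N1 : w <> 1%C) by (intros ->; simpl in Hw; lra).
  assert (N0 : w <> 0%C) by (intros ->; simpl in Hw; lra).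
  assert (N2 : (w - 1 <> 0)%C) by (intros E; apply N1; now apply Ceq_minus).
  destruct (zeta_lower w Hw) as [Nz _].
  rewrite (csum_ext _ (fun i => pkern x w * muterm w i)%C).
  - rewrite csum_scal. unfold kZ, pkern. rewrite Zf_zeta by (assumption || lra).
    field. repeat split; assumption.
  - intros i _. unfold pkern, muterm, nterm. rewrite Rcpow_div by (assumption || apply INR_S_pos). ring.
Qed.

(** Avoids interchanging an infinite sum with the integral: at fixed height some finite [M] leaves
    an error below [eps], and the Perron errors of the first [M] terms have a bound independent of
    [M]. *)
Lemma perron_kZ x N tau : 0 < x <= INR N -> 1 <= tau ->
  Cmod (vline (kZ x) 2 (tau * tau) - RtoC (2 * PI * Ssum x N)) <= 34 * (x * x) * Series (npow 2) / tau.
Proof.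
  intros Hx Ht. set (T := tau * tau). assert (HT : 1 <= T) by (unfold T; nra).
  assert (E2 : ex_series (npow 2)) by (apply ex_series_npow; lra).
  set (S2 := Series (npow 2)).
  apply Rle_of_eps. intros eps He.
  assert (PX : 0 < 2 * T * (x * x)) by (repeat apply Rmult_lt_0_compat; lra).
  destruct (rsum_lim (npow 2) E2 (eps / (2 * T * (x * x)))) as [M0 HM0]; [now apply Rdiv_lt_0_compat|].
  set (M := (N + M0)%nat). specialize (HM0 M ltac:(unfold M; lia)). fold S2 in HM0.
  set (tl := S2 - rsum (npow 2) M).
  assert (Ptl : 0 <= tl).
  { unfold tl. generalize (rsum_le_Series (npow 2) M (fun k => Rlt_le _ _ (npow_pos _ k)) E2). fold S2. lra. }
  assert (Htl : tl * (2 * T * (x * x)) <= eps).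
  { assert (K : tl <= eps / (2 * T * (x * x))) by (apply Rabs_def2 in HM0; unfold tl; lra).
    apply Rmult_le_compat_r with (r := 2 * T * (x * x)) in K; [|lra].
    replace (eps / (2 * T * (x * x)) * (2 * T * (x * x))) with eps in K by (field; repeat split; lra). exact K. }
  rewrite <- (Ssum_stable x N M) by (try lra; unfold M; lia).
  assert (Ck : forall y t, continuous (pkern y) (2, t)) by (intros; apply pkern_cont; lra).
  set (f := fun (i : nat) (w : C) => (RtoC (mu (S i)) * pkern (x / INR (S i)) w)%C).
  assert (Cf : forall i t, continuous (f i) (2, t)).
  { intros i t. apply cont_Cmult; [apply continuous_const | apply Ck]. }
  assert (Cs : forall t, continuous (fun w => csum (fun i => f i w) M) (2, t)) by (intros t; apply csum_cont; intros; apply Cf).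
  assert (CkZ : forall t, continuous (kZ x) (2, t)).
  { intros t. apply (cderiv_cont _ _ (kZ' x (2, t))). apply kZ_deriv; [simpl; lra|].
    apply Zf_nonzero_right. simpl; lra. }
  set (err := fun w => (kZ x w - csum (fun i => f i w) M)%C).
  assert (Ce : forall t, continuous err (2, t)) by (intros t; apply cont_Cminus; [apply CkZ | apply Cs]).
  assert (Be : Cmod (vline err 2 T) <= 2 * T * (x * x * tl)).
  { apply vline_norm_const; [lra | exact Ce |].
    change (forall t : R, Cmod (err (@pair R R 2 t)) <= x * x * tl). intros t.
    replace (err (@pair R R 2 t)) with (pkern x (@pair R R 2 t) * (/ zeta (@pair R R 2 t) - csum (muterm (@pair R R 2 t)) M))%C.
    2:{ unfold err. rewrite (kZ_line2 x (@pair R R 2 t) M) by (simpl; lra). unfold f. cbv beta. ring. }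
    rewrite Cmod_mult. apply Rmult_le_compat; [apply Cmod_ge_0 | apply Cmod_ge_0 | |].
    - replace (x * x) with (Rpower x 2 * / (1 * 1)) by (rewrite Rpower_2; lra).
      apply pkern_bound; try lra.
      + eapply Rle_trans; [|apply Cmod_vert_Re]. rewrite Rabs_pos_eq; lra.
      + rewrite vert_minus_1. eapply Rle_trans; [|apply Cmod_vert_Re]. rewrite Rabs_pos_eq; lra.
    - destruct (zeta_mu (2, t) ltac:(simpl; lra)) as [M1 M2].
      replace (/ zeta (2, t))%C with (CSer (muterm (2, t))).
      + apply cser_tail; [exact M1 | intros k; exact (Cmod_muterm (2, t) k) | exact E2].
      + destruct (zeta_lower (2, t) ltac:(simpl; lra)) as [Nz _].
        replace (CSer (muterm (2, t))) with (/ zeta (2, t) * (zeta (2, t) * CSer (muterm (2, t))))%C by (field; exact Nz).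
        rewrite M2. ring. }
  assert (E : vline (kZ x) 2 T = (csum (fun i => vline (f i) 2 T) M + vline err 2 T)%C).
  { rewrite <- vline_csum by (try lra; exact Cf).
    rewrite <- vline_plus by (try lra; assumption).
    apply vline_ext; [lra|]. intros t. unfold err. ring. }
  (* The error for [n] is [34 * (x / n) ^ 2 / tau], and the squares of [1 / n] sum to at most
     [S2]. *)
  assert (B1 : Cmod (csum (fun i => vline (f i) 2 T) M - RtoC (2 * PI * Ssum x M)) <= 34 * (x * x) * S2 / tau).
  { assert (Q : RtoC (2 * PI * Ssum x M) = csum (fun i => RtoC (mu (S i)) * RtoC (2 * PI * Rmax 0 (x / INR (S i) - 1)))%C M).
    { unfold Ssum. rewrite <- rsum_scal, <- csum_RtoC. apply csum_ext. intros i _.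
      rewrite <- RtoC_mult. f_equal. ring. }
    rewrite Q, <- csum_minus.
    apply Rle_trans with (rsum (fun i => 34 * (x * x) / tau * npow 2 i) M).
    - apply csum_norm_le. intros i _. unfold f.
      rewrite vline_scal by (try lra; intros; apply Ck).
      replace (RtoC (mu (S i)) * vline (pkern (x / INR (S i))) 2 T - RtoC (mu (S i)) * RtoC (2 * PI * Rmax 0 (x / INR (S i) - 1)))%C
        with (RtoC (mu (S i)) * (vline (pkern (x / INR (S i))) 2 T - RtoC (2 * PI * Rmax 0 (x / INR (S i) - 1))))%C by ring.
      rewrite Cmod_mult, Cmod_R.
      assert (Pi := INR_S_pos i).
      assert (K := perron (x / INR (S i)) tau ltac:(apply Rdiv_lt_0_compat; lra) Ht). fold T in K.
      assert (Eq : 34 * (x / INR (S i) * (x / INR (S i))) / tau = 34 * (x * x) / tau * npow 2 i).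
      { unfold npow. rewrite Rpower_Ropp, Rpower_2 by assumption. field. split; lra. }
      rewrite Eq in K. generalize (mu_abs_le (S i)) (Rabs_pos (mu (S i))). 
      generalize (Cmod_ge_0 (vline (pkern (x / INR (S i))) 2 T - RtoC (2 * PI * Rmax 0 (x / INR (S i) - 1)))).
      intros. nra.
    - rewrite rsum_scal.
      assert (K := rsum_le_Series (npow 2) M (fun k => Rlt_le _ _ (npow_pos _ k)) E2). fold S2 in K.
      replace (34 * (x * x) * S2 / tau) with (34 * (x * x) / tau * S2) by (field; lra).
      apply Rmult_le_compat_l; [|exact K]. apply Rdiv_le_0_compat; nra. }
  rewrite E.
  replace (csum (fun i => vline (f i) 2 T) M + vline err 2 T - RtoC (2 * PI * Ssum x M))%C with
    (csum (fun i => vline (f i) 2 T) M - RtoC (2 * PI * Ssum x M) + vline err 2 T)%C by ring.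
  eapply Rle_trans; [apply Cmod_triangle|]. 
  replace (2 * T * (x * x * tl)) with (tl * (2 * T * (x * x))) in Be by ring. lra.
Qed.

(** The primitive is [- (1 + t) ^ (- eps) / eps] on the right half; the left half is its mirror
    image. *)
Lemma RInt_decay T eps : 0 <= T -> 0 < eps ->
  ex_RInt (fun t => Rpower (1 + Rabs t) (- 1 - eps)) (- T) T /\
  RInt (fun t => Rpower (1 + Rabs t) (- 1 - eps)) (- T) T <= 2 / eps.
Proof.
  intros HT He.
  assert (C0 : forall t, continuous (fun t => Rpower (1 + Rabs t) (- 1 - eps)) t).
  { intros t. unfold Rpower. apply (continuous_comp (fun t => (- 1 - eps) * ln (1 + Rabs t)) exp).
    - apply cont_Rmult; [apply continuous_const|]. apply cont_ln.
      + apply cont_Rplus; [apply continuous_const | apply continuous_Rabs].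
      + generalize (Rabs_pos t); lra.
    - apply continuity_pt_filterlim, derivable_continuous_pt, derivable_pt_exp. }
  assert (EX : forall a b, ex_RInt (fun t => Rpower (1 + Rabs t) (- 1 - eps)) a b).
  { intros a b. apply (ex_RInt_continuous (fun t => Rpower (1 + Rabs t) (- 1 - eps))). intros; apply C0. }
  split; [apply EX|].
  assert (D : forall x, - 1 < x -> is_derive (fun t => - / eps * Rpower (1 + t) (- eps)) x (Rpower (1 + x) (- 1 - eps))).
  { intros x Hx.
    assert (K : is_derive (fun t => Rpower (1 + t) (- eps)) x (- eps * Rpower (1 + x) (- eps - 1))).
    { assert (K0 : is_derive (fun u => Rpower u (- eps)) (1 + x) (- eps * Rpower (1 + x) (- eps - 1))).
      { apply is_derive_Reals. apply derivable_pt_lim_power. lra. }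
      assert (K1 : is_derive (fun t => 1 + t) x 1) by (auto_derive; trivial).
      assert (K2 := is_derive_comp (fun u => Rpower u (- eps)) (fun t => 1 + t) x _ _ K0 K1).
      unfold scal in K2; simpl in K2; unfold mult in K2; simpl in K2. rewrite Rmult_1_l in K2. exact K2. }
    assert (K2 := is_derive_scal (fun t => Rpower (1 + t) (- eps)) x (- / eps) _ K).
    replace (Rpower (1 + x) (- 1 - eps)) with (- / eps * (- eps * Rpower (1 + x) (- eps - 1))); [exact K2|].
    replace (- eps - 1) with (- 1 - eps) by ring. field. lra. }
  assert (I1 : is_RInt (fun t => Rpower (1 + Rabs t) (- 1 - eps)) 0 T
     (- / eps * Rpower (1 + T) (- eps) - - / eps * Rpower (1 + 0) (- eps))).
  { apply (is_RInt_ext (fun t => Rpower (1 + t) (- 1 - eps))).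
    - intros x Hx. rewrite Rmin_left, Rmax_right in Hx by lra. rewrite Rabs_pos_eq; [reflexivity | lra].
    - apply (is_RInt_derive (fun t => - / eps * Rpower (1 + t) (- eps))).
      + intros x Hx. rewrite Rmin_left, Rmax_right in Hx by lra. apply D. lra.
      + intros x Hx. rewrite Rmin_left, Rmax_right in Hx by lra.
        unfold Rpower. apply (continuous_comp (fun t => (- 1 - eps) * ln (1 + t)) exp).
        * apply cont_Rmult; [apply continuous_const|]. apply cont_ln; [|lra].
          apply cont_Rplus; [apply continuous_const | apply continuous_id].
        * apply continuity_pt_filterlim, derivable_continuous_pt, derivable_pt_exp. }
  apply (is_RInt_unique (V := R_CompleteNormedModule)) in I1.
  assert (Sym : RInt (fun t => Rpower (1 + Rabs t) (- 1 - eps)) (- T) 0 = RInt (fun t => Rpower (1 + Rabs t) (- 1 - eps)) 0 T).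
  { assert (L := RInt_comp_lin (fun t => Rpower (1 + Rabs t) (- 1 - eps)) (- 1) 0 0 T (EX _ _)).
    replace (- 1 * 0 + 0) with 0 in L by ring. replace (- 1 * T + 0) with (- T) in L by ring.
    assert (E1 : RInt (fun y => scal (- 1) (Rpower (1 + Rabs (- 1 * y + 0)) (- 1 - eps))) 0 T =
      - RInt (fun t => Rpower (1 + Rabs t) (- 1 - eps)) 0 T).
    { transitivity (RInt (fun t => opp (Rpower (1 + Rabs t) (- 1 - eps))) 0 T).
      - apply RInt_ext. intros t _. replace (- 1 * t + 0) with (- t) by ring. rewrite Rabs_Ropp.
        unfold scal; simpl; unfold mult; simpl. unfold opp; simpl. ring.
      - exact (RInt_opp _ 0 T (EX _ _)). }
    assert (L' := eq_trans (eq_sym E1) L).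
    assert (E3 := opp_RInt_swap (fun t => Rpower (1 + Rabs t) (- 1 - eps)) 0 (- T) (EX _ _)).
    unfold opp in E3; simpl in E3. lra. }
  assert (Ch := RInt_Chasles (fun t => Rpower (1 + Rabs t) (- 1 - eps)) (- T) 0 T (EX _ _) (EX _ _)).
  unfold plus in Ch; simpl in Ch.
  rewrite Sym in Ch. rewrite <- Ch, I1. rewrite Rplus_0_r, Rpower_1_l.
  assert (P := Rpower_pos (1 + T) (- eps)). assert (Pe : 0 < / eps) by (apply Rinv_0_lt_compat; lra).
  unfold Rdiv. nra.
Qed.

(** * Littlewood's bound for the sums of mu n / n *)

Section Moebius.
Hypothesis RH : riemann_hypothesis.
Variables (delta eps C1 : R).
Hypothesis Hdelta : 0 < delta <= 1 / 2.
Hypothesis Heps : 0 < eps < 1 / 2.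
Hypothesis HC1 : 0 < C1.
Hypothesis HZ : forall sigma t, 1 / 2 + delta <= sigma <= 2 ->
    Cmod (/ Zf (sigma, t)) <= C1 * Rpower (1 + Rabs t) (- 1 + eps).

(** On the horizontal edges [1 / Cmod w <= 1 / T] meets a bounded [1 / Zf], and the Riemann
    hypothesis leaves no pole to cross. For fixed [x] the error vanishes as [tau] grows. *)
Lemma kZ_shift x tau : 1 <= x -> 1 <= tau ->
  Cmod (vline (kZ x) 2 (tau * tau) - vline (kZ x) (1 / 2 + delta) (tau * tau)) <= 4 * C1 * (x * x) / tau.
Proof.
  intros Hx Ht. set (T := tau * tau). assert (HT : tau <= T) by (unfold T; nra).
  assert (B : forall s t, 1 / 2 + delta <= s <= 2 -> Rabs t = T -> Cmod (kZ x (s, t)) <= C1 * (x * x) / T).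
  { intros s t Hs Htt. unfold kZ.
    assert (N0 := pair_neq s t 0 ltac:(lra)).
    assert (NZ : Zf (s, t) <> 0%C) by (apply Zf_nonzero; [exact RH | simpl; lra]).
    assert (Iv : (/ ((s, t) * Zf (s, t)) = / (s, t) * / Zf (s, t))%C) by (field; split; assumption).
    rewrite Iv, !Cmod_mult, Cmod_Rcpow. unfold Re; simpl fst.
    assert (A1 : Rpower x s <= x * x) by (rewrite <- Rpower_2 by lra; apply Rpower_le_exp; lra).
    assert (A2 : Cmod (/ (s, t)) <= / T).
    { rewrite Cmod_inv by exact N0. apply Rinv_le_contravar; [lra|]. rewrite <- Htt. apply Cmod_vert_Im. }
    assert (A3 : Cmod (/ Zf (s, t)) <= C1).
    { eapply Rle_trans; [now apply HZ|]. rewrite <- (Rmult_1_r C1) at 2. apply Rmult_le_compat_l; [lra|].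
      assert (Pt := Rabs_pos t). apply Rle_trans with (Rpower (1 + Rabs t) 0).
      - apply Rpower_le_exp; lra.
      - rewrite Rpower_O; lra. }
    replace (C1 * (x * x) / T) with (x * x * (/ T * C1)) by (field; lra).
    apply Rmult_le_compat; [left; apply Rpower_pos | apply Rmult_le_pos; apply Cmod_ge_0 | exact A1 |].
    apply Rmult_le_compat; try apply Cmod_ge_0; assumption. }
  eapply Rle_trans.
  - apply (vline_shift (kZ x) (kZ' x) (1 / 2 + delta) 2 (delta / 2) T (C1 * (x * x) / T)); try lra.
    + intros z Hz. apply kZ_deriv; [lra|]. apply Zf_nonzero; [exact RH | lra].
    + intros s Hs. split; apply B; try lra; [rewrite Rabs_pos_eq | rewrite Rabs_Ropp, Rabs_pos_eq]; lra.
  - assert (P : 0 <= C1 * (x * x)) by nra.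
    assert (Q : C1 * (x * x) / T <= C1 * (x * x) / tau).
    { apply Rmult_le_compat_l; [assumption|]. apply Rinv_le_contravar; lra. }
    assert (Q0 : 0 <= C1 * (x * x) / T) by (apply Rdiv_le_0_compat; lra).
    replace (4 * C1 * (x * x) / tau) with (4 * (C1 * (x * x) / tau)) by (field; lra). nra.
Qed.

(** The trivial bound wins for large [Cmod w], the mean value theorem for small. Their minimum is
    what a difference of two integrals gains from a small step [h]. *)
Lemma Rcpow_diff_le x h (w : C) : 1 <= x -> 0 < h <= x -> 0 < Re w <= 1 ->
  Cmod (Rcpow (x + h) w - Rcpow x w) <= 3 * Rpower x (Re w) * Rmin 1 (Cmod w * h / x).
Proof.
  intros Hx Hh Hw. assert (Px := Rpower_pos x (Re w)). apply Rmin_case.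
  - rewrite Rmult_1_r. eapply Rle_trans; [apply Cmod_triangle_minus|]. rewrite !Cmod_Rcpow.
    assert (Rpower (x + h) (Re w) <= 2 * Rpower x (Re w)); [|lra].
    apply Rle_trans with (Rpower (2 * x) (Re w)); [apply Rpower_le_base; lra|].
    rewrite <- Rpower_mult_distr by lra. apply Rmult_le_compat_r; [lra|].
    rewrite <- (Rpower_1 2) at 2 by lra. apply Rpower_le_exp; lra.
  - assert (M := path_mvt (fun u => Rcpow (x + u) w) (fun u => w * Rcpow (x + u) (w - 1))%C
      (Cmod w * Rpower x (Re w - 1)) 0 h ltac:(lra)).
    cbv beta in M. rewrite Rplus_0_r in M.
    assert (M' : Cmod (Rcpow (x + h) w - Rcpow x w) <= Cmod w * Rpower x (Re w - 1) * (h - 0)).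
    { apply M.
      - intros t Ht. apply cpath_Rcpow. lra.
      - intros t Ht. rewrite Cmod_mult, Cmod_Rcpow. apply Rmult_le_compat_l; [apply Cmod_ge_0|].
        replace (Re (w - 1)) with (Re w - 1) by (unfold Re; simpl; ring).
        apply Rpower_le_base_neg; lra. }
    eapply Rle_trans; [exact M'|].
    replace (Rpower x (Re w - 1)) with (Rpower x (Re w) * / x).
    2:{ unfold Rminus. rewrite Rpower_plus. f_equal. rewrite Rpower_Ropp, Rpower_1; lra. }
    assert (P : 0 <= Cmod w * h / x) by (apply Rdiv_le_0_compat; [apply Rmult_le_pos; [apply Cmod_ge_0 | lra] | lra]).
    replace (Cmod w * (Rpower x (Re w) * / x) * (h - 0)) with (Rpower x (Re w) * (Cmod w * h / x)) by (field; lra).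
    nra.
Qed.

Lemma Rmin_1_le_Rpower v p : 0 < v -> 0 <= p <= 1 -> Rmin 1 v <= Rpower v p.
Proof.
  intros Hv Hp. destruct (Rle_or_lt v 1) as [L|L].
  - rewrite Rmin_right by assumption. rewrite <- (Rpower_1 v) at 1 by assumption. apply Rpower_le_1_exp; lra.
  - rewrite Rmin_left by lra. apply Rpower_ge_1; lra.
Qed.

(** The integrand has size [t ^ (- 2 + eps)] times [min 1 (t * h / x)]. Replacing the minimum by the
    power [1 - 2 * eps] of [t * h / x] leaves the integrable [t ^ (- 1 - eps)] and the factor
    [(h / x) ^ (1 - 2 * eps)]. *)
Lemma kZ_diff x h T : 1 <= x -> 0 < h <= x -> 0 <= T ->
  Cmod (vline (kZ (x + h)) (1 / 2 + delta) T - vline (kZ x) (1 / 2 + delta) T) <=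
  18 * C1 / eps * (Rpower x (1 / 2 + delta) * Rpower (h / x) (1 - 2 * eps)).
Proof.
  intros Hx Hh HT. set (s := 1 / 2 + delta).
  assert (NZ : forall t, Zf (s, t) <> 0%C) by (intros t; apply Zf_nonzero; [exact RH | unfold s; simpl; lra]).
  assert (Ck : forall y t, continuous (kZ y) (s, t)).
  { intros y t. apply (cderiv_cont _ _ (kZ' y (s, t))). apply kZ_deriv; [unfold s; simpl; lra | apply NZ]. }
  rewrite <- vline_minus by (try assumption; intros; apply Ck).
  set (A := Rpower x s * Rpower (h / x) (1 - 2 * eps)).
  assert (PA : 0 < A) by (apply Rmult_lt_0_compat; apply Rpower_pos).
  destruct (RInt_decay T eps HT ltac:(lra)) as [EX LE].
  unfold vline. eapply Rle_trans.
  - apply (CInt_norm_le _ (fun t => 9 * C1 * A * Rpower (1 + Rabs t) (- 1 - eps))); [lra | | exact (ex_RInt_scal _ _ _ _ EX) |].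
    + apply (cont_on_vert (fun z => kZ (x + h) z - kZ x z)%C). intros t. apply cont_Cminus; apply Ck.
    + intros t _. unfold kZ. assert (N0 := pair_neq s t 0 ltac:(unfold s; lra)).
      assert (Pt := Rabs_pos t).
      replace (Rcpow (x + h) (s, t) * / ((s, t) * Zf (s, t)) - Rcpow x (s, t) * / ((s, t) * Zf (s, t)))%C
        with ((Rcpow (x + h) (s, t) - Rcpow x (s, t)) * (/ (s, t) * / Zf (s, t)))%C
        by (field; split; [apply NZ | exact N0]).
      rewrite !Cmod_mult.
      assert (D := Rcpow_diff_le x h (s, t) Hx Hh ltac:(unfold s; simpl; lra)).
      change (Re (s, t)) with s in D.
      assert (W1 : Cmod (s, t) <= 1 + Rabs t).
      { eapply Rle_trans; [apply Cmod_le_Re_Im|]. unfold Re, Im; simpl. rewrite (Rabs_pos_eq s); unfold s; lra. }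
      assert (W2 : (1 + Rabs t) / 3 <= Cmod (s, t)).
      { assert (Q1 := Cmod_vert_Re s t). assert (Q2 := Cmod_vert_Im s t).
        rewrite (Rabs_pos_eq s) in Q1 by (unfold s; lra). unfold s in *. lra. }
      set (v := (1 + Rabs t) * h / x).
      assert (Pv : 0 < v) by (unfold v; apply Rdiv_lt_0_compat; [apply Rmult_lt_0_compat; lra | lra]).
      assert (D2 : Cmod (Rcpow (x + h) (s, t) - Rcpow x (s, t)) <= 3 * Rpower x s * Rpower v (1 - 2 * eps)).
      { eapply Rle_trans; [exact D|]. apply Rmult_le_compat_l; [generalize (Rpower_pos x s); lra|].
        eapply Rle_trans; [|apply Rmin_1_le_Rpower; lra].
        apply Rle_min_compat_l. unfold v, Rdiv. apply Rmult_le_compat_r; [left; apply Rinv_0_lt_compat; lra|].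
        apply Rmult_le_compat_r; lra. }
      assert (D3 : Cmod (/ (s, t)) <= 3 * / (1 + Rabs t)).
      { rewrite Cmod_inv by exact N0. replace (3 * / (1 + Rabs t)) with (/ ((1 + Rabs t) / 3)) by (field; lra).
        apply Rinv_le_contravar; lra. }
      assert (D4 := HZ s t ltac:(unfold s; lra)).
      assert (E : 9 * C1 * A * Rpower (1 + Rabs t) (- 1 - eps) =
        3 * Rpower x s * Rpower v (1 - 2 * eps) * (3 * / (1 + Rabs t) * (C1 * Rpower (1 + Rabs t) (- 1 + eps)))).
      { unfold A, v. replace ((1 + Rabs t) * h / x) with ((1 + Rabs t) * (h / x)) by (field; lra).
        rewrite <- Rpower_mult_distr by (try lra; apply Rdiv_lt_0_compat; lra).
        replace (/ (1 + Rabs t)) with (Rpower (1 + Rabs t) (- (1))) by (rewrite Rpower_Ropp, Rpower_1; lra).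
        replace (- 1 - eps) with ((1 - 2 * eps) + (- (1) + (- 1 + eps))) by ring.
        rewrite !(Rpower_plus _ _ (1 + Rabs t)). ring. }
      rewrite E. assert (Pv2 := Rpower_pos v (1 - 2 * eps)). assert (Px := Rpower_pos x s).
      apply Rmult_le_compat; [apply Cmod_ge_0 | apply Rmult_le_pos; apply Cmod_ge_0 | exact D2 |].
      apply Rmult_le_compat; [apply Cmod_ge_0 | apply Cmod_ge_0 | exact D3 | exact D4].
  - assert (E : RInt (fun t => 9 * C1 * A * Rpower (1 + Rabs t) (- 1 - eps)) (- T) T =
      9 * C1 * A * RInt (fun t => Rpower (1 + Rabs t) (- 1 - eps)) (- T) T) by exact (RInt_scal _ _ _ _ EX).
    rewrite E. replace (18 * C1 / eps * A) with (9 * C1 * A * (2 / eps)) by (field; lra).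
    apply Rmult_le_compat_l; [|exact LE]. apply Rmult_le_pos; [lra|lra].
Qed.

Lemma Ssum_diff N h : (1 <= h <= N)%nat ->
  2 * PI * Rabs (Ssum (INR N + INR h) (N + h) - Ssum (INR N) (N + h)) <=
  18 * C1 / eps * (Rpower (INR N) (1 / 2 + delta) * Rpower (INR h / INR N) (1 - 2 * eps)).
Proof.
  intros Hh. assert (PP := PI_RGT_0).
  assert (H1 : 1 <= INR h) by (apply (le_INR 1); lia).
  assert (H2 : INR h <= INR N) by (apply le_INR; lia).
  set (x := INR N) in *. set (k := INR h) in *. set (Bd := 18 * C1 / eps * _).
  assert (Hsum : INR (N + h) = x + k) by apply plus_INR.
  apply Rle_of_eps. intros e He.
  (* [Q / tau] collects the errors of both Perron formulas and of both shifts of the line; [tau] is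
     chosen to make it at most [e]. *)
  set (Q := 34 * ((x + k) * (x + k)) * Series (npow 2) + 34 * (x * x) * Series (npow 2)
            + 4 * C1 * ((x + k) * (x + k)) + 4 * C1 * (x * x)).
  set (tau := 1 + Rabs Q / e).
  assert (PQ := Rabs_pos Q).
  assert (Ht : 1 <= tau) by (unfold tau; assert (0 <= Rabs Q / e) by (apply Rdiv_le_0_compat; lra); lra).
  assert (P1 := perron_kZ (x + k) (N + h) tau ltac:(lra) Ht).
  assert (P2 := perron_kZ x (N + h) tau ltac:(lra) Ht).
  assert (S1 := kZ_shift (x + k) tau ltac:(lra) Ht).
  assert (S2 := kZ_shift x tau ltac:(lra) Ht).
  assert (D := kZ_diff x k (tau * tau) ltac:(lra) ltac:(lra) ltac:(nra)). fold Bd in D.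
  set (T := tau * tau) in *.
  set (U1 := Ssum (x + k) (N + h)) in *. set (U2 := Ssum x (N + h)) in *.
  assert (E : 2 * PI * Rabs (U1 - U2) = Cmod (RtoC (2 * PI * U1) - RtoC (2 * PI * U2))).
  { rewrite <- RtoC_minus, Cmod_R. replace (2 * PI * U1 - 2 * PI * U2) with (2 * PI * (U1 - U2)) by ring.
    rewrite Rabs_mult, (Rabs_pos_eq (2 * PI)); lra. }
  rewrite E.
  set (s := 1 / 2 + delta) in *.
  replace (RtoC (2 * PI * U1) - RtoC (2 * PI * U2))%C with
    ((vline (kZ (x + k)) s T - vline (kZ x) s T)
     + ((vline (kZ (x + k)) 2 T - vline (kZ (x + k)) s T) - (vline (kZ x) 2 T - vline (kZ x) s T))
     + ((vline (kZ x) 2 T - RtoC (2 * PI * U2)) - (vline (kZ (x + k)) 2 T - RtoC (2 * PI * U1))))%C by ring.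
  eapply Rle_trans; [apply Cmod_triangle|].
  eapply Rle_trans; [apply Rplus_le_compat; [apply Cmod_triangle | apply Cmod_triangle_minus]|].
  assert (T3 := Cmod_triangle_minus (vline (kZ (x + k)) 2 T - vline (kZ (x + k)) s T) (vline (kZ x) 2 T - vline (kZ x) s T)).
  assert (EQ : 34 * ((x + k) * (x + k)) * Series (npow 2) / tau + 34 * (x * x) * Series (npow 2) / tau
     + 4 * C1 * ((x + k) * (x + k)) / tau + 4 * C1 * (x * x) / tau = Q / tau) by (unfold Q; field; lra).
  assert (LQ : Q / tau <= e).
  { apply Rmult_le_reg_r with tau; [lra|]. replace (Q / tau * tau) with Q by (field; lra).
    unfold tau. replace (e * (1 + Rabs Q / e)) with (e + Rabs Q) by (field; lra).
    generalize (Rle_abs Q); lra. }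
  lra.
Qed.

Definition mert (N : nat) : R := rsum (fun i => mu (S i) / INR (S i)) N.

(** For [n <= N] both weights are nonnegative and differ by [h / n], which produces [h * mert N];
    the [h] integers beyond [N] have weights at most [h / N]. *)
Lemma Ssum_mert N h : (1 <= N)%nat ->
  Rabs (INR h * mert N) <= Rabs (Ssum (INR N + INR h) (N + h) - Ssum (INR N) (N + h)) + INR h * INR h / INR N.
Proof.
  intros HN. assert (PN : 0 < INR N) by (apply lt_0_INR; lia). assert (Ph := pos_INR h).
  set (R1 := rsum (fun k => mu (S (N + k)) * Rmax 0 ((INR N + INR h) / INR (S (N + k)) - 1)) h).
  assert (E : Ssum (INR N + INR h) (N + h) - Ssum (INR N) (N + h) = INR h * mert N + R1).
  { unfold Ssum. rewrite !rsum_add.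
    rewrite (rsum_0 (fun k => mu (S (N + k)) * Rmax 0 (INR N / INR (S (N + k)) - 1))).
    - fold R1.
      assert (E1 : rsum (fun i => mu (S i) * Rmax 0 ((INR N + INR h) / INR (S i) - 1)) N =
        rsum (fun i => mu (S i) * Rmax 0 (INR N / INR (S i) - 1) + INR h * (mu (S i) / INR (S i))) N).
      { apply rsum_ext. intros i Hi. assert (Pi := INR_S_pos i).
        assert (Li : INR (S i) <= INR N) by (apply le_INR; lia).
        assert (K1 : 1 <= INR N / INR (S i)).
        { apply Rmult_le_reg_r with (INR (S i)); [assumption|].
          replace (INR N / INR (S i) * INR (S i)) with (INR N) by (field; lra). lra. }
        assert (K2 : (INR N + INR h) / INR (S i) = INR N / INR (S i) + INR h / INR (S i)) by (field; lra).
        assert (K3 : 0 <= INR h / INR (S i)) by (apply Rdiv_le_0_compat; lra).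
        rewrite K2, !Rmax_right by lra. field. lra. }
      rewrite E1, rsum_plus, rsum_scal. unfold mert. ring.
    - intros k Hk. assert (Pk := INR_S_pos (N + k)).
      assert (Lk : INR N <= INR (S (N + k))) by (apply le_INR; lia).
      rewrite Rmax_left; [ring|].
      assert (INR N / INR (S (N + k)) <= 1); [|lra].
      apply Rmult_le_reg_r with (INR (S (N + k))); [assumption|].
      replace (INR N / INR (S (N + k)) * INR (S (N + k))) with (INR N) by (field; lra). lra. }
  assert (B : Rabs R1 <= INR h * INR h / INR N).
  { apply Rle_trans with (rsum (fun _ => INR h / INR N) h).
    - apply rsum_abs_le. intros k Hk. rewrite Rabs_mult.
      assert (Pk := INR_S_pos (N + k)).
      assert (Lk : INR N <= INR (S (N + k))) by (apply le_INR; lia).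
      assert (M := mu_abs_le (S (N + k))). assert (M0 := Rabs_pos (mu (S (N + k)))).
      assert (Q : 0 <= INR h / INR N) by (apply Rdiv_le_0_compat; lra).
      assert (V : Rabs (Rmax 0 ((INR N + INR h) / INR (S (N + k)) - 1)) <= INR h / INR N).
      { rewrite Rabs_pos_eq by apply Rmax_l. apply Rmax_lub; [assumption|].
        apply Rle_trans with ((INR N + INR h) / INR N - 1).
        - apply Rplus_le_compat_r. apply Rmult_le_compat_l; [lra|]. apply Rinv_le_contravar; lra.
        - right. field. lra. }
      assert (V0 := Rabs_pos (Rmax 0 ((INR N + INR h) / INR (S (N + k)) - 1))). nra.
    - right. rewrite rsum_const. unfold Rdiv. ring. }
  replace (INR h * mert N) with (Ssum (INR N + INR h) (N + h) - Ssum (INR N) (N + h) - R1) by (rewrite E; ring).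
  unfold Rminus at 1. eapply Rle_trans; [apply Rabs_triang|]. rewrite Rabs_Ropp. lra.
Qed.

Lemma mert_bound_aux N : (1 <= N)%nat ->
  Rabs (mert N) <= (36 * C1 / eps + 1) * Rpower (INR N) (- (1 / 2) + (delta + eps)).
Proof.
  intros HN. assert (PN : 1 <= INR N) by (apply (le_INR 1); lia).
  (* With [h] near the square root, the boundary error [h / N] is about [N ^ (- 1 / 2)], and the
     bound of [Ssum_diff] divided by [h] has the same exponent up to [delta + eps]. *)
  set (h := Nat.sqrt N). destruct (Nat.sqrt_spec N ltac:(lia)) as [Q1 Q2]. fold h in Q1, Q2.
  assert (Hh : (1 <= h <= N)%nat) by nia.
  assert (H1 : 1 <= INR h) by (apply (le_INR 1); lia).
  set (x := INR N) in *. set (k := INR h) in *.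
  set (rt := Rpower x (1 / 2)).
  assert (Prt : 0 < rt) by apply Rpower_pos.
  assert (Rr : rt * rt = x).
  { unfold rt. rewrite <- Rpower_plus. replace (1 / 2 + 1 / 2) with 1 by field. apply Rpower_1. lra. }
  assert (K1 : k * k <= x) by (unfold k, x; rewrite <- mult_INR; apply le_INR; lia).
  assert (K2 : x <= (k + 1) * (k + 1)).
  { unfold k, x. rewrite <- S_INR, <- mult_INR. apply le_INR. lia. }
  assert (K3 : k <= rt) by nra.
  assert (K4 : rt <= 2 * k) by nra.
  assert (A := Ssum_diff N h Hh). fold x k in A.
  assert (B := Ssum_mert N h HN). fold x k in B.
  set (D := Rabs (Ssum (x + k) (N + h) - Ssum x (N + h))) in *.
  set (G := Rpower x (1 / 2 + delta) * Rpower (k / x) (1 - 2 * eps)) in *.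
  assert (PG : 0 < G) by (apply Rmult_lt_0_compat; apply Rpower_pos).
  assert (PD : 0 <= D) by apply Rabs_pos.
  assert (PC : 0 < 18 * C1 / eps) by (apply Rdiv_lt_0_compat; lra).
  assert (A' : D <= 18 * C1 / eps * G) by (generalize PI2_1; unfold Rdiv in *; nra).
  rewrite Rabs_mult, (Rabs_pos_eq k) in B by lra.
  assert (G1 : G <= rt * Rpower x (- (1 / 2) + (delta + eps))).
  { assert (L : Rpower (k / x) (1 - 2 * eps) <= Rpower x (- (1 / 2) * (1 - 2 * eps))).
    { rewrite <- Rpower_mult. apply Rpower_le_base; [|lra]. split; [apply Rdiv_lt_0_compat; lra|].
      rewrite Rpower_Ropp. fold rt. apply Rmult_le_reg_r with (x * rt); [nra|].
      replace (k / x * (x * rt)) with (k * rt) by (field; lra).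
      replace (/ rt * (x * rt)) with x by (field; lra). nra. }
    unfold G. eapply Rle_trans; [apply Rmult_le_compat_l; [left; apply Rpower_pos | exact L]|].
    unfold rt. rewrite <- !Rpower_plus. right. f_equal. field. }
  assert (G2 : k / x <= Rpower x (- (1 / 2) + (delta + eps))).
  { apply Rle_trans with (Rpower x (- (1 / 2))); [|apply Rpower_le_exp; lra].
    rewrite Rpower_Ropp. fold rt. apply Rmult_le_reg_r with (x * rt); [nra|].
    replace (k / x * (x * rt)) with (k * rt) by (field; lra).
    replace (/ rt * (x * rt)) with x by (field; lra). nra. }
  set (P := Rpower x (- (1 / 2) + (delta + eps))) in *.
  assert (PP : 0 < P) by apply Rpower_pos.
  apply Rmult_le_reg_l with k; [lra|].
  eapply Rle_trans; [exact B|].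
  assert (F1 : D <= 18 * C1 / eps * (2 * k * P)).
  { eapply Rle_trans; [exact A'|]. apply Rmult_le_compat_l; [lra|].
    eapply Rle_trans; [exact G1|]. apply Rmult_le_compat_r; lra. }
  assert (F2 : k * k / x <= k * P).
  { replace (k * k / x) with (k * (k / x)) by (field; lra). apply Rmult_le_compat_l; lra. }
  replace (k * ((36 * C1 / eps + 1) * P)) with (18 * C1 / eps * (2 * k * P) + k * P) by (field; lra).
  lra.
Qed.

End Moebius.

(** The loss [e] is divided evenly between the distance to the critical line and the growth exponent
    of [1 / Zf]. *)
Lemma mert_bound : riemann_hypothesis -> forall e, 0 < e < 1 / 2 -> exists K, 0 < K /\
  forall N, (1 <= N)%nat -> Rabs (mert N) <= K * Rpower (INR N) (- (1 / 2) + e).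
Proof.
  intros RH e He.
  destruct (inv_Zf_bound RH (e / 2) (e / 2)) as (C1 & HC1 & HZ); [lra | lra |].
  exists (36 * C1 / (e / 2) + 1). split.
  - assert (0 < 36 * C1 / (e / 2)) by (apply Rdiv_lt_0_compat; lra). lra.
  - intros N HN. replace e with (e / 2 + e / 2) at 2 by field.
    apply mert_bound_aux; try assumption; lra.
Qed.

(** * The sequence a *)

Lemma rsum_swap (F : nat -> nat -> R) m n :
  rsum (fun i => rsum (fun j => F i j) m) n = rsum (fun j => rsum (fun i => F i j) n) m.
Proof.
  induction n; simpl.
  - symmetry. now apply rsum_0.
  - rewrite IHn, <- rsum_plus. reflexivity.
Qed.

Lemma rsum_div_indicator (G : nat -> R) i n :
  rsum G (n / S i) = rsum (fun j => if (S i * S j <=? n)%nat then G j else 0) n.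
Proof.
  assert (E1 := Nat.div_mod_eq n (S i)). assert (B1 := Nat.mod_upper_bound n (S i) ltac:(lia)).
  rewrite (rsum_extend _ (n / S i) n).
  - apply rsum_ext. intros j Hj. destruct (S i * S j <=? n)%nat eqn:E; [reflexivity|].
    apply Nat.leb_gt in E. nia.
  - apply Nat.Div0.div_le_upper_bound. nia.
  - intros j Hj. destruct (S i * S j <=? n)%nat eqn:E; [|reflexivity].
    apply Nat.leb_le in E. nia.
Qed.

(** Both sides run over the symmetric region under the hyperbola. *)
Lemma rsum_hyperbola_swap (F : nat -> nat -> R) n :
  rsum (fun i => rsum (fun j => F i j) (n / S i)) n = rsum (fun j => rsum (fun i => F i j) (n / S j)) n.
Proof.
  rewrite (rsum_ext _ (fun i => rsum (fun j => if (S i * S j <=? n)%nat then F i j else 0) n))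
    by (intros i _; apply rsum_div_indicator).
  rewrite rsum_swap. apply rsum_ext. intros j _. rewrite rsum_div_indicator.
  apply rsum_ext. intros i _. now rewrite Nat.mul_comm.
Qed.

Lemma div_divide k i : (S k mod S i =? 0)%nat = true -> (S i * (S k / S i) = S k)%nat.
Proof.
  intros E. apply Nat.eqb_eq in E. assert (H := Nat.div_mod_eq (S k) (S i)). lia.
Qed.

(** Grouping by the product [k] leaves [divsum mu k / k], so only [k = 1] survives. *)
Lemma mert_inversion n : (1 <= n)%nat -> rsum (fun h => / INR (S h) * mert (n / S h)) n = 1.
Proof.
  intros Hn.
  rewrite (rsum_ext _ (fun h => rsum (fun e => / INR (S h) * (mu (S e) / INR (S e))) (n / S h)))
    by (intros h _; unfold mert; now rewrite rsum_scal).
  rewrite (rsum_hyperbola_swap (fun h e => / INR (S h) * (mu (S e) / INR (S e)))).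
  rewrite (rsum_regroup (fun d h => / INR h * (mu d / INR d))).
  rewrite (rsum_ext _ (fun k => / INR (S k) * divsum mu (S k))).
  - destruct n; [lia|]. rewrite rsum_shift, rsum_0.
    + unfold divsum. simpl. rewrite mu_1. field.
    + intros k _. rewrite divsum_mu by lia. ring.
  - intros k _. unfold divsum. rewrite <- rsum_scal. apply rsum_ext. intros i Hi.
    destruct (S k mod S i =? 0)%nat eqn:E; [|ring].
    apply div_divide in E. rewrite <- E at 2. rewrite mult_INR.
    assert (P := INR_S_pos i).
    assert (Q : 0 < INR (S k / S i)) by (apply lt_0_INR; destruct (S k / S i)%nat; lia).
    field. split; lra.
Qed.

(** The coefficient of [mert (N / k)] is the sum of [a g / h] over [g * h = k]. For fixed [g] the
    sum over [h] is [mert_inversion] at [N / g], which returns [a g]. *)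
Lemma summatory_inversion (a : nat -> R) N :
  rsum (fun i => a (S i)) N =
  rsum (fun k => divsum (fun d => INR d * a d) (S k) / INR (S k) * mert (N / S k)) N.
Proof.
  symmetry.
  rewrite (rsum_ext _ (fun k => rsum (fun i => if (S k mod S i =? 0)%nat
     then a (S i) / INR (S k / S i) * mert (N / (S i * (S k / S i))) else 0) (S k))).
  - rewrite <- (rsum_regroup (fun g h => a g / INR h * mert (N / (g * h)))).
    apply rsum_ext. intros i Hi.
    rewrite (rsum_ext _ (fun j => a (S i) * (/ INR (S j) * mert (N / S i / S j)))).
    + rewrite rsum_scal, mert_inversion; [ring|].
      apply Nat.div_le_lower_bound; lia.
    + intros j _. rewrite Nat.Div0.div_div. unfold Rdiv. ring.
  - intros k _. unfold divsum, Rdiv. rewrite Rmult_assoc, Rmult_comm, <- rsum_scal.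
    apply rsum_ext. intros i _. destruct (S k mod S i =? 0)%nat eqn:E; [|ring].
    apply div_divide in E. rewrite E.
    assert (P := INR_S_pos i).
    assert (Q : 0 < INR (S k / S i)) by (apply lt_0_INR; destruct (S k / S i)%nat; lia).
    rewrite <- E at 1. rewrite mult_INR. field. split; lra.
Qed.

(** Each [d] has [N / d] multiples up to [N]. *)
Lemma rsum_divsum (b : nat -> R) N :
  rsum (fun i => b (S i) * INR (N / S i)) N = rsum (fun k => divsum b (S k)) N.
Proof.
  unfold divsum. rewrite <- (rsum_regroup (fun d _ => b d)).
  apply rsum_ext. intros i _.
  rewrite rsum_const. ring.
Qed.

Lemma sum_n_m_rsum (f : nat -> R) n : sum_n_m f 1 n = rsum (fun i => f (S i)) n.
Proof.
  induction n.
  - rewrite sum_n_m_zero by lia. reflexivity.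
  - rewrite sum_n_Sm by lia. simpl rsum. rewrite <- IHn. reflexivity.
Qed.

(** Turns the recurrence into a sum with integer quotients, which [rsum_divsum] reads as a partial
    sum of divisor sums. *)
Lemma Phi_ratio (k n : nat) : (0 < k)%nat -> (0 < n)%nat ->
  Phi (INR k / INR n) = INR k * INR (n / k) / INR n.
Proof.
  intros Hk Hn. assert (Pk := lt_0_INR k Hk). assert (Pn := lt_0_INR n Hn).
  unfold Phi. replace (/ (INR k / INR n)) with (INR n / INR k) by (field; lra).
  assert (E : Int_part (INR n / INR k) = Z.of_nat (n / k)).
  { symmetry. apply Int_part_spec. rewrite <- INR_IZR_INZ.
    assert (E1 := Nat.div_mod_eq n k). assert (B1 := Nat.mod_upper_bound n k ltac:(lia)).
    set (q := (n / k)%nat) in *. set (m := (n mod k)%nat) in *.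
    assert (F : INR n = INR k * INR q + INR m) by (rewrite E1, plus_INR, mult_INR; reflexivity).
    assert (Pm := pos_INR m). assert (Lm : INR m < INR k) by now apply lt_INR.
    split.
    - apply Rmult_lt_reg_r with (INR k); [assumption|].
      replace ((INR n / INR k - 1) * INR k) with (INR n - INR k) by (field; lra). nra.
    - apply Rmult_le_reg_r with (INR k); [assumption|].
      replace (INR n / INR k * INR k) with (INR n) by (field; lra). nra. }
  rewrite E, <- INR_IZR_INZ. field. lra.
Qed.

(** Slow variation at the single ratio 2 gives [L (2 x) <= 2 ^ eta * L x] beyond some [x0]. Iterated
    doubling produces the power; monotonicity covers the values between doublings and those below
    [x0]. *)
Lemma slowly_varying_growth (L : R -> R) :
  (forall x, 0 <= x -> 0 <= L x) -> slowly_varying L ->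
  (forall x y, 1 <= x -> x <= y -> L x <= L y) ->
  forall eta, 0 < eta -> exists CL, 0 <= CL /\ forall x, 1 <= x -> L x <= CL * Rpower x eta.
Proof.
  intros Hpos Hslow Hinc eta He.
  assert (H2 : 1 < Rpower 2 eta) by (rewrite <- (Rpower_O 2) at 1 by lra; apply Rpower_lt; lra).
  set (c := Rpower 2 eta) in *.
  (* [c - 1] keeps the ratio below [c]. The bound 1 excludes [L x = 0], where the quotient is 0 by
     convention and lies at distance 1 from the limit. *)
  assert (Pe : 0 < Rmin 1 (c - 1)) by (apply Rmin_pos; lra).
  assert (Lim := Hslow 2 ltac:(lra)). apply is_lim_spec in Lim.
  destruct (Lim (mkposreal _ Pe)) as [M HM]. simpl in HM.
  assert (M1 := Rmin_l 1 (c - 1)). assert (M2 := Rmin_r 1 (c - 1)).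
  set (x0 := Rmax 1 (M + 1)).
  assert (X1 : 1 <= x0) by apply Rmax_l.
  assert (X2 : M + 1 <= x0) by apply Rmax_r.
  assert (Dbl : forall x, x0 <= x -> L (2 * x) <= c * L x).
  { intros x Hx. specialize (HM x ltac:(lra)). assert (P := Hpos x ltac:(lra)).
    destruct (Req_dec (L x) 0) as [Z|Z].
    - exfalso. unfold Rdiv in HM. rewrite Z, Rinv_0, Rmult_0_r, Rminus_0_l, Rabs_Ropp, Rabs_R1 in HM. lra.
    - apply Rabs_def2 in HM. destruct HM as [HM _].
      apply Rmult_le_reg_r with (/ L x); [apply Rinv_0_lt_compat; lra|].
      rewrite (Rmult_assoc c), Rinv_r by exact Z. unfold Rdiv in HM. lra. }
  assert (P0 := Hpos x0 ltac:(lra)).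
  assert (Main : forall k x, x0 <= x <= 2 ^ k * x0 -> L x <= c * L x0 * Rpower (x / x0) eta).
  { induction k; intros x Hx.
    - simpl in Hx. assert (x = x0) as -> by lra. replace (x0 / x0) with 1 by (field; lra).
      rewrite Rpower_1_l. nra.
    - destruct (Rle_or_lt x0 (x / 2)) as [G|G].
      + assert (IH := IHk (x / 2) ltac:(simpl in Hx; lra)).
        assert (D := Dbl (x / 2) G). replace (2 * (x / 2)) with x in D by field.
        eapply Rle_trans; [exact D|].
        replace (c * L x0 * Rpower (x / x0) eta) with (c * (c * L x0 * Rpower (x / 2 / x0) eta)).
        * apply Rmult_le_compat_l; lra.
        * assert (Q : Rpower (x / x0) eta = c * Rpower (x / 2 / x0) eta); [|rewrite Q; ring].
          unfold c. rewrite Rpower_mult_distr; [f_equal; field; lra | lra |].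
          apply Rdiv_lt_0_compat; lra.
      + assert (D := Dbl x0 ltac:(lra)).
        assert (Li := Hinc x (2 * x0) ltac:(lra) ltac:(lra)).
        assert (Q : 1 <= Rpower (x / x0) eta).
        { apply Rpower_ge_1; [|lra]. apply Rmult_le_reg_r with x0; [lra|].
          replace (x / x0 * x0) with x by (field; lra). lra. }
        assert (0 <= c * L x0) by nra. nra. }
  exists (c * L x0). split; [nra|]. intros x Hx.
  assert (Px := Rpower_pos x eta).
  destruct (Rle_or_lt x0 x) as [G|G].
  - destruct (INR_unbounded (x / x0)) as [k Hk].
    assert (K2 : forall n, INR n <= 2 ^ n).
    { induction n; [simpl; lra|]. rewrite S_INR. simpl. assert (1 <= 2 ^ n) by (apply pow_R1_Rle; lra). lra. }
    specialize (K2 k).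
    assert (B : x <= 2 ^ k * x0).
    { replace x with (x / x0 * x0) by (field; lra). apply Rmult_le_compat_r; lra. }
    eapply Rle_trans; [apply (Main k x); lra|]. apply Rmult_le_compat_l; [nra|].
    apply Rpower_le_base; [|lra]. split; [apply Rdiv_lt_0_compat; lra|].
    apply Rmult_le_reg_r with x0; [lra|]. replace (x / x0 * x0) with x by (field; lra). nra.
  - assert (Li := Hinc x x0 Hx ltac:(lra)). assert (Q : 1 <= Rpower x eta) by (apply Rpower_ge_1; lra).
    assert (L x0 <= c * L x0) by nra. assert (0 <= c * L x0) by nra. nra.
Qed.

(* One increment of [x ^ (1 - beta) L x], weighted: the increment of [L] is telescoped
   rather than bounded, since only its sum is small. *)
Lemma weighted_increment (L : R -> R) (beta e CL x : R) :
  1 / 2 <= beta -> 0 < e -> 1 <= x -> 0 <= L x <= L (x + 1) -> L x <= CL * Rpower x (e / 2) ->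
  Rabs (Rpower (x + 1) (1 - beta) * L (x + 1) - Rpower x (1 - beta) * L x) * Rpower (x + 1) (- (1 / 2) - e) <=
  (Rpower (x + 1) (- e) * L (x + 1) - Rpower x (- e) * L x) + (e + Rabs (1 - beta)) * CL * Rpower x (- (1 + e / 2)).
Proof.
  intros Hb He Hx HL HLx.
  set (W := Rpower (x + 1) (- (1 / 2) - e)). assert (PW : 0 < W) by apply Rpower_pos.
  set (U := Rpower (x + 1) (1 - beta)). set (V := Rpower x (1 - beta)).
  assert (PU : 0 < U) by apply Rpower_pos. assert (PV : 0 < V) by apply Rpower_pos.
  assert (S1 : Rabs (U * L (x + 1) - V * L x) <= U * (L (x + 1) - L x) + Rabs (U - V) * L x).
  { replace (U * L (x + 1) - V * L x) with (U * (L (x + 1) - L x) + (U - V) * L x) by ring.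
    eapply Rle_trans; [apply Rabs_triang|]. rewrite !Rabs_mult.
    rewrite (Rabs_pos_eq U), (Rabs_pos_eq (L (x + 1) - L x)), (Rabs_pos_eq (L x)) by lra. lra. }
  (* The exponent of the product is [1 / 2 - beta - e]; [beta >= 1 / 2] enters here and in [S3]. *)
  assert (S2 : U * W <= Rpower (x + 1) (- e)).
  { unfold U, W. rewrite <- Rpower_plus. apply Rpower_le_exp; lra. }
  destruct (Rpower_mvt x (x + 1) (1 - beta)) as (z & Hz & Ez); [lra|].
  replace (x + 1 - x) with 1 in Ez by ring. rewrite Rmult_1_r in Ez.
  replace (1 - beta - 1) with (- beta) in Ez by ring.
  assert (S3 : Rabs (U - V) <= Rabs (1 - beta) * Rpower x (- (1 / 2))).
  { unfold U, V. rewrite Ez, Rabs_mult, (Rabs_pos_eq (Rpower z (- beta))) by (left; apply Rpower_pos).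
    apply Rmult_le_compat_l; [apply Rabs_pos|].
    apply Rle_trans with (Rpower x (- beta)); [apply Rpower_le_base_neg; lra | apply Rpower_le_exp; lra]. }
  assert (S4 : W <= Rpower x (- (1 / 2) - e)) by (apply Rpower_le_base_neg; lra).
  destruct (Rpower_mvt x (x + 1) (- e)) as (y & Hy & Ey); [lra|].
  replace (x + 1 - x) with 1 in Ey by ring. rewrite Rmult_1_r in Ey.
  assert (S5 : Rpower x (- e) - Rpower (x + 1) (- e) <= e * Rpower x (- e - 1)).
  { assert (Rpower y (- e - 1) <= Rpower x (- e - 1)) by (apply Rpower_le_base_neg; lra). nra. }
  set (X := Rpower x (- (1 + e / 2))). assert (PX : 0 < X) by apply Rpower_pos.
  assert (S6 : L x * Rpower x (- e - 1) <= CL * X).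
  { apply Rle_trans with (CL * Rpower x (e / 2) * Rpower x (- e - 1)).
    - apply Rmult_le_compat_r; [left; apply Rpower_pos | exact HLx].
    - rewrite Rmult_assoc, <- Rpower_plus. right. unfold X. do 2 f_equal. field. }
  assert (T1 : U * (L (x + 1) - L x) * W <= Rpower (x + 1) (- e) * (L (x + 1) - L x)).
  { replace (U * (L (x + 1) - L x) * W) with (U * W * (L (x + 1) - L x)) by ring.
    apply Rmult_le_compat_r; lra. }
  (* The increment of [x ^ (- e) * L x] equals the right side of [T1] minus this product, so
     telescoping costs only a summable correction. *)
  assert (T2 : L x * (Rpower x (- e) - Rpower (x + 1) (- e)) <= e * (CL * X)).
  { apply Rle_trans with (L x * (e * Rpower x (- e - 1))); [apply Rmult_le_compat_l; lra|].
    replace (L x * (e * Rpower x (- e - 1))) with (e * (L x * Rpower x (- e - 1))) by ring.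
    apply Rmult_le_compat_l; lra. }
  assert (T3 : Rabs (U - V) * L x * W <= Rabs (1 - beta) * (CL * X)).
  { apply Rle_trans with (Rabs (1 - beta) * Rpower x (- (1 / 2)) * L x * Rpower x (- (1 / 2) - e)).
    - assert (0 < Rpower x (- (1 / 2))) by apply Rpower_pos. assert (PB := Rabs_pos (1 - beta)).
      apply Rmult_le_compat; [apply Rmult_le_pos; [apply Rabs_pos | lra] | lra | | exact S4].
      apply Rmult_le_compat_r; lra.
    - replace (Rabs (1 - beta) * Rpower x (- (1 / 2)) * L x * Rpower x (- (1 / 2) - e)) with
        (Rabs (1 - beta) * (L x * (Rpower x (- (1 / 2)) * Rpower x (- (1 / 2) - e)))) by ring.
      rewrite <- Rpower_plus. replace (- (1 / 2) + (- (1 / 2) - e)) with (- e - 1) by field.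
      apply Rmult_le_compat_l; [apply Rabs_pos | exact S6]. }
  apply Rle_trans with ((U * (L (x + 1) - L x) + Rabs (U - V) * L x) * W); [apply Rmult_le_compat_r; lra|].
  lra.
Qed.

(** In the sum of the bounds from [weighted_increment], the telescoped part stays below [CL] because
    [x ^ (- e) * L x] is bounded; the rest is a convergent series. *)
Lemma weighted_sum_bounded (L : R -> R) (beta : R) (G : nat -> R) (e : R) :
  (forall x, 0 <= x -> 0 <= L x) -> slowly_varying L ->
  (forall x y, 1 <= x -> x <= y -> L x <= L y) -> 1 / 2 <= beta -> 0 < e ->
  (forall n, (2 <= n)%nat -> G n = Rpower (INR n) (1 - beta) * L (INR n)) ->
  exists B, 0 <= B /\ forall N,
    rsum (fun i => Rabs (G (S i) - G i) * Rpower (INR (S i)) (- (1 / 2) - e)) N <= B.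
Proof.
  intros Hpos Hslow Hinc Hb He HG.
  destruct (slowly_varying_growth L Hpos Hslow Hinc (e / 2) ltac:(lra)) as (CL & HCL & Hgr).
  set (term := fun i => Rabs (G (S i) - G i) * Rpower (INR (S i)) (- (1 / 2) - e)).
  assert (Pt : forall i, 0 <= term i).
  { intros i. apply Rmult_le_pos; [apply Rabs_pos | left; apply Rpower_pos]. }
  set (p := 1 + e / 2). assert (Ex : ex_series (npow p)) by (apply ex_series_npow; unfold p; lra).
  set (Kc := (e + Rabs (1 - beta)) * CL).
  assert (PK : 0 <= Kc) by (apply Rmult_le_pos; [generalize (Rabs_pos (1 - beta)); lra | assumption]).
  set (T := fun k => Rpower (INR (k + 2)) (- e) * L (INR (k + 2))).
  assert (PT : forall k, 0 <= T k <= CL).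
  { intros k. assert (1 <= INR (k + 2)) by (apply (le_INR 1); lia). unfold T. split.
    - apply Rmult_le_pos; [left; apply Rpower_pos | apply Hpos; lra].
    - eapply Rle_trans; [apply Rmult_le_compat_l; [left; apply Rpower_pos | now apply Hgr]|].
      rewrite (Rmult_comm CL), <- Rmult_assoc, <- Rpower_plus.
      assert (Rpower (INR (k + 2)) (- e + e / 2) <= 1).
      { apply Rle_trans with (Rpower (INR (k + 2)) 0); [apply Rpower_le_exp; lra | rewrite Rpower_O; lra]. }
      nra. }
  (* The formula for [G] starts at 2, so the first two terms are set apart and enter the final bound
     as [rsum term 2]. *)
  assert (St : forall k, term (2 + k)%nat <= (T (S k) - T k) + Kc * npow p (S k)).
  { intros k. unfold term, T. rewrite !HG by lia.
    set (x := INR (k + 2)).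
    assert (Hx : 1 <= x) by (unfold x; apply (le_INR 1); lia).
    replace (INR (S (2 + k))) with (x + 1) by (unfold x; rewrite <- S_INR; f_equal; lia).
    replace (INR (2 + k)) with x by (unfold x; f_equal; lia).
    replace (INR (S k + 2)) with (x + 1) by (unfold x; rewrite <- S_INR; f_equal; lia).
    unfold npow. replace (INR (S (S k))) with x by (unfold x; f_equal; lia).
    apply weighted_increment; try assumption; [|now apply Hgr].
    split; [apply Hpos; lra | apply Hinc; lra]. }
  exists (rsum term 2 + (CL + Kc * Series (npow p))).
  assert (PS : 0 <= Series (npow p)).
  { apply Rle_trans with (rsum (npow p) 0); [simpl; lra|]. apply rsum_le_Series; [intros; left; apply npow_pos | exact Ex]. }
  split.
  - apply Rplus_le_le_0_compat; [apply rsum_nonneg; auto|]. nra.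
  - intros N. apply Rle_trans with (rsum term (2 + N)).
    + replace (2 + N)%nat with (N + 2)%nat by lia. rewrite rsum_add.
      assert (0 <= rsum (fun k => term (N + k)%nat) 2) by (apply rsum_nonneg; auto). lra.
    + rewrite rsum_add. apply Rplus_le_compat_l.
      assert (Tel : rsum (fun k => term (2 + k)%nat) N <= (T N - T O) + Kc * rsum (fun k => npow p (S k)) N).
      { clear - St. induction N; [simpl rsum; lra|]. specialize (St N).
        change (rsum (fun k => term (2 + k)%nat) N + term (2 + N)%nat <=
          T (S N) - T O + Kc * (rsum (fun k => npow p (S k)) N + npow p (S N))). lra. }
      assert (Ns : rsum (fun k => npow p (S k)) N <= Series (npow p)).
      { apply Rle_trans with (rsum (npow p) (S N)).
        - rewrite rsum_shift. generalize (npow_pos p 0). lra.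
        - apply rsum_le_Series; [intros; left; apply npow_pos | exact Ex]. }
      assert (Kc * rsum (fun k => npow p (S k)) N <= Kc * Series (npow p)) by now apply Rmult_le_compat_l.
      generalize (PT N) (PT O). lra.
Qed.

Theorem theorem5p1
  (RH : riemann_hypothesis)
  (L0 : R -> R)
  (L0_nonneg : forall x : R, 0 <= x -> 0 <= L0 x)
  (L0_slow : slowly_varying L0)
  (L0_incr : forall x y : R, 1 <= x -> x <= y -> L0 x <= L0 y)
  (L0_step : exists K : R, forall n : nat, (1 <= n)%nat ->
     0 <= L0 (INR (n + 1)) - L0 (INR n) < K)
  (beta : R) (beta_ge : 1 / 2 <= beta)
  (a : nat -> R)
  (a1 : a 1%nat = 1)
  (a_rec : forall n : nat, (2 <= n)%nat ->
     sum_n_m (fun k => a k * Phi (INR k / INR n)) 1 n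
       = Rpower (INR n) (- beta) * L0 (INR n)) :
  forall eps : R, 0 < eps ->
    bigO_infty (summatory a) (fun x => Rpower x (- (1 / 2) + eps)).
Proof.
  intros eps Heps.
  (* [e <= 1 / 4] meets the range of [mert_bound] and keeps the exponent [c] negative; a larger
     [eps] only weakens the claim. *)
  set (e := Rmin eps (1 / 4)).
  assert (He1 : 0 < e) by (apply Rmin_pos; lra).
  assert (He2 : e <= eps) by apply Rmin_l. assert (He3 : e <= 1 / 4) by apply Rmin_r.
  set (c := - (1 / 2) + e).
  destruct (mert_bound RH e ltac:(lra)) as (K & HK & Hm). fold c in Hm.
  set (b := fun d => INR d * a d).
  set (G := fun N => rsum (fun k => divsum b (S k)) N).
  assert (HG : forall n, (2 <= n)%nat -> G n = Rpower (INR n) (1 - beta) * L0 (INR n)).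
  { intros n Hn. assert (Pn : 0 < INR n) by (apply lt_0_INR; lia).
    unfold G. rewrite <- rsum_divsum.
    assert (E := a_rec n Hn). rewrite sum_n_m_rsum in E.
    rewrite (rsum_ext _ (fun i => / INR n * (b (S i) * INR (n / S i)))) in E.
    - rewrite rsum_scal in E. unfold Rminus. rewrite Rpower_plus, Rpower_1, Rmult_assoc, <- E by assumption.
      field. lra.
    - intros i _. rewrite Phi_ratio by lia. unfold b. field. lra. }
  destruct (weighted_sum_bounded L0 beta G e L0_nonneg L0_slow L0_incr beta_ge He1 HG) as (B & HB & Hsum).
  (* As [c] is negative, replacing the integer quotient of [N] by [d] with the smaller [N / (2 d)]
     costs the factor [2 ^ (- c)]. *)
  assert (P2 : Rpower 2 (- c) <= 2).
  { rewrite <- (Rpower_1 2) at 2 by lra. apply Rpower_le_exp; unfold c; lra. }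
  assert (PA : forall N, (1 <= N)%nat -> Rabs (rsum (fun i => a (S i)) N) <= 2 * K * B * Rpower (INR N) c).
  { intros N HN. assert (PN : 0 < INR N) by (apply lt_0_INR; lia).
    rewrite summatory_inversion. fold b.
    apply Rle_trans with (rsum (fun i => 2 * K * Rpower (INR N) c *
      (Rabs (G (S i) - G i) * Rpower (INR (S i)) (- (1 / 2) - e))) N).
    - apply rsum_abs_le. intros i Hi. assert (Pi := INR_S_pos i).
      assert (E1 : G (S i) - G i = divsum b (S i)) by (unfold G; simpl rsum; ring).
      rewrite E1.
      assert (Hq : (1 <= N / S i)%nat) by (apply Nat.div_le_lower_bound; lia).
      assert (Lq : INR N / (2 * INR (S i)) <= INR (N / S i)).
      { assert (D1 := Nat.div_mod_eq N (S i)). assert (D2 := Nat.mod_upper_bound N (S i) ltac:(lia)).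
        assert (D3 : (N <= 2 * S i * (N / S i))%nat) by nia.
        apply le_INR in D3. rewrite !mult_INR in D3. change (INR 2) with 2 in D3.
        apply Rmult_le_reg_r with (2 * INR (S i)); [lra|].
        replace (INR N / (2 * INR (S i)) * (2 * INR (S i))) with (INR N) by (field; lra). lra. }
      assert (Bm : Rabs (mert (N / S i)) <= K * (2 * Rpower (INR N) c * Rpower (INR (S i)) (- c))).
      { eapply Rle_trans; [now apply Hm|]. apply Rmult_le_compat_l; [lra|].
        apply Rle_trans with (Rpower (INR N / (2 * INR (S i))) c).
        - apply Rpower_le_base_neg; [|unfold c; lra]. split; [apply Rdiv_lt_0_compat; lra | exact Lq].
        - assert (Q : Rpower (INR N / (2 * INR (S i))) c = Rpower (INR N) c * (Rpower 2 (- c) * Rpower (INR (S i)) (- c))).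
          { rewrite Rpower_mult_distr by lra. unfold Rdiv.
            rewrite <- Rpower_mult_distr by (try lra; apply Rinv_0_lt_compat; lra). f_equal.
            rewrite Rpower_Ropp. unfold Rpower. rewrite ln_Rinv by lra. rewrite <- exp_Ropp. f_equal. ring. }
          rewrite Q. assert (P3 := Rpower_pos (INR N) c). assert (P4 := Rpower_pos (INR (S i)) (- c)).
          replace (2 * Rpower (INR N) c * Rpower (INR (S i)) (- c)) with
            (Rpower (INR N) c * (2 * Rpower (INR (S i)) (- c))) by ring.
          apply Rmult_le_compat_l; [lra|]. apply Rmult_le_compat_r; lra. }
      rewrite Rabs_mult. unfold Rdiv. rewrite Rabs_mult, (Rabs_pos_eq (/ INR (S i))) by (left; now apply Rinv_0_lt_compat).
      set (D := Rabs (divsum b (S i))). assert (PD : 0 <= D) by apply Rabs_pos.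
      (* [- 1 / 2 - e = - 1 - c]: the weight is the factor [1 / d] of the inversion formula times
         the [d ^ (- c)] coming from [mert]. *)
      assert (E2 : Rpower (INR (S i)) (- (1 * / 2) - e) = / INR (S i) * Rpower (INR (S i)) (- c)).
      { rewrite <- (Rpower_1 (INR (S i))) at 2 by assumption. rewrite <- Rpower_Ropp, <- Rpower_plus.
        f_equal. unfold c. field. }
      rewrite E2.
      replace (2 * K * Rpower (INR N) c * (D * (/ INR (S i) * Rpower (INR (S i)) (- c)))) with
        (D * / INR (S i) * (K * (2 * Rpower (INR N) c * Rpower (INR (S i)) (- c)))) by ring.
      apply Rmult_le_compat_l; [apply Rmult_le_pos; [assumption | left; now apply Rinv_0_lt_compat] | exact Bm].
    - rewrite rsum_scal. assert (P3 := Rpower_pos (INR N) c).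
      replace (2 * K * B * Rpower (INR N) c) with (2 * K * Rpower (INR N) c * B) by ring.
      apply Rmult_le_compat_l; [|apply Hsum]. apply Rmult_le_pos; lra. }
  (* A further factor 2 comes from bounding the integer part of [x] below by [x / 2], again under
     the negative exponent [c]. *)
  exists (4 * K * B), 1. intros x Hx.
  unfold summatory. rewrite sum_n_m_rsum.
  destruct (base_Int_part x) as [I1 I2]. set (z := Int_part x) in *.
  assert (Hz : (1 <= z)%Z).
  { assert (H0 : (0 < z)%Z); [|lia]. apply lt_IZR. lra. }
  set (N := Z.to_nat z).
  assert (EN : INR N = IZR z) by (unfold N; rewrite INR_IZR_INZ, Z2Nat.id by lia; reflexivity).
  assert (HN : (1 <= N)%nat) by (unfold N; lia).
  assert (HN1 : 1 <= INR N) by (apply (le_INR 1); lia).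
  eapply Rle_trans; [apply (PA N HN)|].
  rewrite (Rabs_pos_eq (Rpower x _)) by (left; apply Rpower_pos).
  assert (LN : Rpower (INR N) c <= 2 * Rpower x (- (1 / 2) + eps)).
  { apply Rle_trans with (Rpower (x / 2) c).
    - apply Rpower_le_base_neg; [lra | unfold c; lra].
    - assert (Q : Rpower (x / 2) c = Rpower x c * Rpower 2 (- c)).
      { unfold Rdiv. rewrite <- Rpower_mult_distr by lra. f_equal.
        unfold Rpower. rewrite ln_Rinv by lra. f_equal. ring. }
      rewrite Q. assert (Q2 : Rpower x c <= Rpower x (- (1 / 2) + eps)) by (apply Rpower_le_exp; unfold c; lra).
      assert (P5 := Rpower_pos x c). assert (P6 := Rpower_pos 2 (- c)). nra. }
  replace (4 * K * B * Rpower x (- (1 / 2) + eps)) with (2 * K * B * (2 * Rpower x (- (1 / 2) + eps))) by ring.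
  apply Rmult_le_compat_l; [|exact LN]. apply Rmult_le_pos; lra.
Qed.
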